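(* Let $d\ge 2$. Let $(X,\sigma)$ be a symbolic system having a family of patterns $\mathcal{C}$ with property $F$, and let $(Y,T)$ be a shift space with $h_{top}(Y,T)<h(\mathcal{C})$. Then there is an equivariant Borel embedding (an injective equivariant Borel map) from $\mathrm{Free}(Y)$ to $X$.
   Context: A symbolic system is a shift-invariant subset $X\subseteq\mathcal{A}^{\mathbb{Z}^d}$, $\mathcal{A}$ finite, with shift $(\sigma^\gamma x)_\delta=x_{\gamma+\delta}$; a shift space is a closed such set; $\mathrm{Free}(Y)=\{y:\sigma^\gamma y\ne y\ \forall\gamma\ne\bar 0\}$; $h_{top}$ is topological entropy. For $B\subseteq\mathbb{Z}^d$, $\mathcal{L}(X,B)=\{x|_B:x\in X\}$. A set $B\subseteq\mathbb{Z}^d$ is a $k$-grid union if there exist $C\subseteq k\mathbb{Z}^d$ and $\gamma\in\mathbb{Z}^d$ with $B=\gamma+C+[1,k]^d$ and both $B$ and $\mathbb{Z}^d\setminus B$ connected (edges $\{\alpha,\alpha\pm\epsilon^i\}$). A family of patterns is a translation-invariant collection $\mathcal{C}=(P_C)$ indexed by $k$-grid unions $C$ with $P_C\subseteq\mathcal{L}(X,C)$ (a pattern on $C$ is in $P_C$ iff its translate to $C+\alpha$ is in $P_{C+\alpha}$). It has property $F$ (with gap $m$) if: (1) for all $k$-grid unions $C,C_1,\dots,C_r$ and $c_i\in P_{C_i}$ with the $C_j+[-m,m]^d$ pairwise disjoint and contained in $C$, there is $c\in P_C$ with $c|_{C_j}=c_j$ for all $j$; (2) if $x\in\mathcal{A}^{\mathbb{Z}^d}$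 and $x|_{C}\in P_C$ for every $C$ in some increasing sequence of $k$-grid unions covering $\mathbb{Z}^d$, then $x\in X$. Its entropy is $h(\mathcal{C})=\liminf_{n\to\infty}(nk)^{-d}\log|P_{[1,nk]^d}|$. *)

(* Defs.v *)
From HB Require Import structures.
From mathcomp Require Import all_boot all_order all_algebra.
From mathcomp Require Import all_classical all_reals all_analysis.
From mathcomp Require Import Rstruct Rstruct_topology.

Set Implicit Arguments.
Unset Strict Implicit.
Unset Printing Implicit Defensive.

Import Order.TTheory GRing.Theory Num.Theory.
Local Open Scope classical_set_scope.
Local Open Scope ring_scope.

Definition Zd (d : nat) := 'rV[int]_d.

Definition shift (d : nat) (A : Type) (g : Zd d) (x : Zd d -> A) : Zd d -> A :=
  fun a => x (g + a).

Definition shift_invariant (d : nat) (A : Type) (X : set (Zd d -> A)) :=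
  forall (g : Zd d) x, X x -> X (shift g x).

Definition symbolic_system (d : nat) (A : finType) (X : set (Zd d -> A)) :=
  shift_invariant X.

(** The box [-n,n]^d and closedness in the product (of discrete) topology:
    x is in the closure of X iff every central box pattern of x is seen in X. *)
Definition cbox (d : nat) (n : nat) : set (Zd d) :=
  [set a | forall j, `|a ord0 j| <= n%:Z].

Definition closed_config (d : nat) (A : Type) (X : set (Zd d -> A)) :=
  forall x : Zd d -> A,
    (forall n : nat, exists2 z, X z & forall a, @cbox d n a -> z a = x a) -> X x.

Definition shift_space (d : nat) (A : finType) (Y : set (Zd d -> A)) :=
  shift_invariant Y /\ closed_config Y.

Definition Free (d : nat) (A : Type) (Y : set (Zd d -> A)) : set (Zd d -> A) :=
  [set y | Y y /\ forall g : Zd d, g != 0 -> shift g y <> y].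

(** Borel sigma-algebra on A^(Z^d): generated by the cylinder sets
    (which form a basis of the product topology of the discrete spaces). *)
Definition cylinders (d : nat) (A : Type) : set (set (Zd d -> A)) :=
  [set S | exists (a : Zd d) (s : A), S = [set x | x a = s]].

Definition borel_config (d : nat) (A : Type) : set (set (Zd d -> A)) :=
  <<s @cylinders d A >>.

(** A map defined on the Borel set D is Borel if preimages (within D) of Borel
    sets are Borel; it suffices to test the generating cylinders. *)
Definition borel_on (d : nat) (B A : Type) (D : set (Zd d -> B))
  (f : (Zd d -> B) -> (Zd d -> A)) :=
  forall S, cylinders S -> borel_config (D `&` (f @^-1` S)).

Definition equivariant_borel_embedding (d : nat) (B A : Type)
  (D : set (Zd d -> B)) (X : set (Zd d -> A)) (f : (Zd d -> B) -> (Zd d -> A)) :=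
  [/\ forall y, D y -> X (f y),
      {in D &, injective f},
      forall (g : Zd d) y, D y -> f (shift g y) = shift g (f y)
    & borel_on D f].

Definition unitv (d : nat) (i : 'I_d) : Zd d := delta_mx ord0 i.

Definition adj (d : nat) (a b : Zd d) :=
  exists i : 'I_d, b = a + unitv i \/ b = a - unitv i.

Inductive reach (d : nat) (S : set (Zd d)) (a : Zd d) : Zd d -> Prop :=
  | reach_refl : S a -> reach S a a
  | reach_step b c : reach S a b -> S c -> adj b c -> reach S a c.

Definition connected_set (d : nat) (S : set (Zd d)) :=
  forall a b, S a -> S b -> reach S a b.

Definition box1 (d : nat) (k : nat) : set (Zd d) :=
  [set v | forall j, 1 <= v ord0 j <= k%:Z].

Definition thicken (d : nat) (S : set (Zd d)) (m : nat) : set (Zd d) :=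
  [set a + v | a in S & v in @cbox d m].

Definition translate (d : nat) (S : set (Zd d)) (g : Zd d) : set (Zd d) :=
  [set a + g | a in S].

Definition grid_union (d : nat) (k : nat) (S : set (Zd d)) :=
  (exists (C : set (Zd d)) (g : Zd d),
      (forall c, C c -> exists w : Zd d, c = k%:Z *: w) /\
      S = [set g + c + v | c in C & v in @box1 d k])
  /\ connected_set S /\ connected_set (~` S).

(** Patterns on a set S are partial configurations with domain exactly S. *)
Definition restr (d : nat) (A : Type) (S : set (Zd d)) (x : Zd d -> A) :
  Zd d -> option A := fun a => if `[< S a >] then Some (x a) else None.

Definition lang (d : nat) (A : Type) (X : set (Zd d -> A)) (S : set (Zd d)) :
  set (Zd d -> option A) := restr S @` X.

Definition tpat (d : nat) (A : Type) (c : Zd d -> option A) (g : Zd d) :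
  Zd d -> option A := fun a => c (a - g).

Definition pattern_family (d : nat) (A : finType) (X : set (Zd d -> A)) (k : nat)
  (P : set (Zd d) -> set (Zd d -> option A)) :=
  (forall S, grid_union k S -> P S `<=` lang X S) /\
  (forall S (g : Zd d) c, grid_union k S ->
     (P S c <-> P (translate S g) (tpat c g))).

Definition property_F (d : nat) (A : finType) (X : set (Zd d -> A)) (k : nat)
  (P : set (Zd d) -> set (Zd d -> option A)) (m : nat) :=
  (forall (S : set (Zd d)) (r : nat) (Ss : 'I_r -> set (Zd d))
          (cs : 'I_r -> (Zd d -> option A)),
      grid_union k S -> (forall i, grid_union k (Ss i)) ->
      (forall i, P (Ss i) (cs i)) ->
      (forall i j, i != j -> thicken (Ss i) m `&` thicken (Ss j) m = set0) ->
      (forall i, thicken (Ss i) m `<=` S) ->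
      exists2 c, P S c & forall i a, Ss i a -> c a = cs i a)
  /\
  (forall (x : Zd d -> A) (Cn : nat -> set (Zd d)),
      (forall n, grid_union k (Cn n)) ->
      (forall n, Cn n `<=` Cn n.+1) ->
      \bigcup_n Cn n = setT ->
      (forall n, P (Cn n) (restr (Cn n) x)) ->
      X x).

Definition boxpt (d n : nat) (i : 'rV['I_n]_d) : Zd d :=
  \row_j ((i ord0 j : nat)%:Z + 1).

Definition npat (d : nat) (A : finType) (P : set (Zd d) -> set (Zd d -> option A))
  (n : nat) : nat :=
  #|[set p : {ffun 'rV['I_n]_d -> A} |
      `[< exists c, P (@box1 d n) c /\ forall i, c (boxpt i) = Some (p i) >]]|.

Definition nlang (d : nat) (A : finType) (Y : set (Zd d -> A)) (n : nat) : nat :=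
  #|[set p : {ffun 'rV['I_n]_d -> A} |
      `[< exists y, Y y /\ forall i, y (boxpt i) = p i >]]|.

Definition family_entropy (d : nat) (A : finType) (k : nat)
  (P : set (Zd d) -> set (Zd d -> option A)) : \bar Rdefinitions.R :=
  limn_einf (fun n : nat =>
    ((ln ((npat P (n * k))%:R : Rdefinitions.R)) / (((n * k) ^ d)%N%:R))%:E).

(** h_top(Y) = lim_n n^(-d) log |L(Y,[1,n]^d)| (the limit exists; we take the
    limsup, which equals it). *)
Definition htop (d : nat) (A : finType) (Y : set (Zd d -> A)) : \bar Rdefinitions.R :=
  limn_esup (fun n : nat =>
    ((ln ((nlang Y n)%:R : Rdefinitions.R)) / ((n ^ d)%N%:R))%:E).

(* Main.v *)
(* Fix a fast growing sequence of scales.  On the free part of [Y] a greedy construction yields, at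
   every scale, Borel equivariant families of well separated centres, in finitely many colours that
   together come close to every point; for one colour, depending only on the orbit, the balls around
   the centres exhaust the lattice.  Moving each centre to an anchor that stays away from the tiles of
   lower level, and letting the ball around it absorb the clusters of lower tiles that it meets, one
   gets a toast: finite grid unions, far apart or deeply nested, that exhaust the orbit.
   By induction on the level every tile is filled with a pattern of the family that extends the
   patterns of the lower tiles.  It carries a marker at the anchor, a unary header giving the level and
   the colour of the tile, and code words on cubes aligned with the anchor.  As [htop Y < h(C)] there
   are more code words than [Y]-patterns on a cube, and the surplus also stores the part of [y] near
   the boundary of the tile that the cubes do not reach.  Code words are chosen not to occur in the
   marker, which has no small periods; a box of the size of the marker that is not very close to an
   anchor contains a code word, hence the marker occurs exactly at the anchors.  Reading the headers
   level by level then recovers the tiles, and the code words recover [y].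
   All maps are Borel because each step is an arbitrary function of finitely many Borel functions with
   countably many values. *)

(* Property F lets patterns be prescribed but leaves the symbols between them out of control, so a
   marker could arise by accident. The remedy is not control of the gaps but density of code words,
   which shapes the constants: code words have side [k * n], markers [k * (n * n)]. The collar of a
   marker then has smaller order than its volume, so by counting some pattern of the family has no
   small period; and a marker has only polynomially many subwords in [n], which can be struck out of
   exponentially many code words.

   The second obstacle is the boundary of a tile, where no whole cube fits. Each tile answers for
   [y] on its own [cN + mm]-neighbourhood, so a tile above it may skip sites that close to it. What
   remains uncovered is a shell of order [rho n ^ d.-1] and a ball around the anchor whose radius is
   fixed before [rho n], whereas the data cubes number of order [rho n ^ d]; one spare bit per cube
   is enough once [rho n] is large against all lower scales.

   Patterns may be chosen arbitrarily, since decoding reads only markers and code words. *)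
Require Import Defs.
From mathcomp Require Import all_boot all_order all_algebra.
From mathcomp Require Import all_classical all_reals all_analysis.
From mathcomp Require Import Rstruct Rstruct_topology.
From mathcomp Require Import zify ring lra.
Import Defs.
Set Implicit Arguments.
Unset Strict Implicit.
Unset Printing Implicit Defensive.
Import Order.TTheory GRing.Theory Num.Theory.
Local Open Scope classical_set_scope.
Local Open Scope ring_scope.

(** * Norms and connectedness *)

(* The zify preprocessing of [lia] compares atoms syntactically, so the coordinates of vectors must
   all be displayed as elements of [int]. *)
Ltac zlia :=
  repeat match goal with
  | H : context [@fun_of_matrix ?T 1%N ?d ?a ?i ?j] |- _ =>
      lazymatch T with int => fail | _ =>
        change (@fun_of_matrix T 1%N d a i j) with (@fun_of_matrix int 1%N d a i j) in H end
  | |- context [@fun_of_matrix ?T 1%N ?d ?a ?i ?j] =>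
      lazymatch T with int => fail | _ =>
        change (@fun_of_matrix T 1%N d a i j) with (@fun_of_matrix int 1%N d a i j) end
  end; lia.

Section Norm.
Variable d : nat.
Implicit Types (a b c : Zd d) (S T : set (Zd d)).

Lemma coordD a b j : (a + b) ord0 j = a ord0 j + b ord0 j :> int.
Proof. by rewrite mxE. Qed.

Lemma coordN a j : (- a) ord0 j = - a ord0 j :> int.
Proof. by rewrite mxE. Qed.

Lemma coord0 j : (0%R : Zd d) ord0 j = 0%R :> int.
Proof. by rewrite mxE. Qed.

Lemma coordZ (t : int) a j : (t *: a) ord0 j = t * a ord0 j :> int.
Proof. by rewrite mxE. Qed.

Lemma coord_row (f : 'I_d -> int) j : (\row_i f i : Zd d) ord0 j = f j :> int.
Proof. by rewrite mxE. Qed.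

Lemma coord_unitv i j : (unitv i : Zd d) ord0 j = (j == i)%:Z :> int.
Proof. by rewrite mxE eqxx; case: (_ == _). Qed.

Definition coordE := (coordD, coordN, coordZ, coord_row, coord_unitv, coord0).

Lemma zdP a b : (forall j, a ord0 j = b ord0 j) -> a = b.
Proof. by move=> h; apply/rowP => j; exact: h. Qed.

Definition nrm a : nat := \max_(j < d) absz (a ord0 j).
Arguments nrm a%_R.

Lemma nrm_leP a n : reflect (forall j, (absz (a ord0 j) <= n)%N) (nrm a <= n)%N.
Proof.
apply: (iffP idP) => [H j|H]; first exact: leq_trans (leq_bigmax _) H.
by apply/bigmax_leqP.
Qed.

Lemma nrm_ge a j : (absz (a ord0 j) <= nrm a)%N.
Proof. by have /nrm_leP := leqnn (nrm a). Qed.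

Lemma nrmN a : nrm (- a) = nrm a.
Proof. by apply: eq_bigr => j _; rewrite coordE abszN. Qed.

Lemma nrm0 : nrm 0 = 0%N.
Proof. by apply/eqP; rewrite -leqn0; apply/nrm_leP => j; rewrite coordE. Qed.

Lemma nrmD a b : (nrm (a + b) <= nrm a + nrm b)%N.
Proof.
apply/nrm_leP => j; rewrite coordE.
have := nrm_ge a j; have := nrm_ge b j; lia.
Qed.

Lemma nrmBC a b : nrm (a - b) = nrm (b - a).
Proof. by rewrite -nrmN opprB. Qed.

Lemma nrm_tri c a b : (nrm (a - b) <= nrm (a - c) + nrm (c - b))%N.
Proof. by have := nrmD (a - c) (c - b); rewrite addrA subrK. Qed.

Lemma nrmB a b : (nrm (a - b) <= nrm a + nrm b)%N.
Proof. by rewrite -(nrmN b); exact: nrmD. Qed.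

Lemma cboxE n a : cbox n a <-> (nrm a <= n)%N.
Proof.
split=> [h|/nrm_leP h j]; last by have := h j; lia.
by apply/nrm_leP => j; have := h j; rewrite /=; lia.
Qed.

Lemma thickenE S r a : thicken S r a <-> exists2 b, S b & (nrm (a - b) <= r)%N.
Proof.
split=> [[b Sb [v /cboxE hv <-]]|[b Sb h]]; first by exists b; rewrite // addrAC subrr add0r.
exists b => //; exists (a - b); first exact/cboxE.
by rewrite addrC subrK.
Qed.

Lemma thicken_sub S r s : (r <= s)%N -> thicken S r `<=` thicken S s.
Proof.
move=> rs a /thickenE[b Sb h]; apply/thickenE; exists b => //.
exact: leq_trans h rs.
Qed.

Lemma sub_thicken S r : S `<=` thicken S r.
Proof. by move=> a Sa; apply/thickenE; exists a; rewrite // subrr nrm0. Qed.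

Lemma translateE S g a : translate S g a <-> S (a - g).
Proof.
split=> [[b Sb <-]|h]; first by rewrite addrK.
by exists (a - g) => //; rewrite subrK.
Qed.

Lemma reach_l S a b : reach S a b -> S a.
Proof. by elim. Qed.

Lemma reach_r S a b : reach S a b -> S b.
Proof. by case. Qed.

Lemma reach_trans S b a c : reach S a b -> reach S b c -> reach S a c.
Proof. by move=> h; elim=> // x y _ IH Sy xy; apply: reach_step xy. Qed.

Lemma adj_sym a b : adj a b -> adj b a.
Proof.
case=> i [->|->]; exists i; [right|left]; first by rewrite addrK.
by rewrite subrK.
Qed.

Lemma reach_sym S a b : reach S a b -> reach S b a.
Proof.
elim=> [Sa|b' c h IH Sc bc]; first exact: reach_refl.
apply: (@reach_trans _ b') => //; apply: (@reach_step _ _ _ c) (reach_r h) (adj_sym bc).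
exact: reach_refl.
Qed.

Lemma reach_mono S T a b : S `<=` T -> reach S a b -> reach T a b.
Proof.
move=> ST; elim=> [Sa|b' c h IH Sc bc]; first exact/reach_refl/ST.
by apply: (@reach_step _ _ _ b') => //; exact: ST.
Qed.

Definition upd a (i : 'I_d) (t : int) : Zd d := \row_j (if j == i then t else a ord0 j).

Lemma upd_id a i : upd a i (a ord0 i) = a.
Proof. by apply: zdP => j; rewrite coordE; case: eqP => [->|]. Qed.

Lemma adj_upd a i t : adj (upd a i t) (upd a i (t + 1)).
Proof.
by exists i; left; apply: zdP => j; rewrite !coordE; case: eqP => _; rewrite ?addr0.
Qed.

Definition betw (x y z : int) := (x <= z <= y) || (y <= z <= x).

Lemma reach_upd T a i (n : nat) t :
  (forall s : int, t <= s <= t + n%:Z -> T (upd a i s)) -> reach T (upd a i t) (upd a i (t + n%:Z)).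
Proof.
elim: n => [|n IH] H.
  by rewrite addr0; apply: reach_refl; apply: H; lia.
apply: (@reach_step _ _ _ (upd a i (t + n%:Z))).
- by apply: IH => s hs; apply: H; lia.
- by apply: H; lia.
- by rewrite (_ : t + n.+1%:Z = t + n%:Z + 1); [exact: adj_upd|lia].
Qed.

Lemma reach_line T a i t :
  (forall s, betw (a ord0 i) t s -> T (upd a i s)) -> reach T a (upd a i t).
Proof.
rewrite /betw => H; rewrite -{1}(upd_id a i).
case: (lerP (a ord0 i) t) => h.
  have -> : t = a ord0 i + (absz (t - a ord0 i))%:Z by lia.
  by apply: reach_upd => s hs; apply: H; lia.
apply: reach_sym.
have -> : a ord0 i = t + (absz (t - a ord0 i))%:Z by lia.
by apply: reach_upd => s hs; apply: H; lia.
Qed.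

Definition mix (s : seq 'I_d) a b : Zd d :=
  \row_j (if j \in s then b ord0 j else a ord0 j).

(** The coordinates in [s] are moved one at a time along axis-parallel segments; the hypothesis
    covers every point that such a path can visit. *)
Lemma reach_mix T (s : seq 'I_d) a b :
  (forall c, (forall j, betw (a ord0 j) (b ord0 j) (c ord0 j)) ->
     (forall j, j \notin s -> c ord0 j = a ord0 j) -> T c) ->
  reach T a (mix s a b).
Proof.
rewrite /betw.
elim: s => [|i s IH] H.
  have -> : mix [::] a b = a by apply: zdP => j; rewrite coordE.
  by apply: reach_refl; apply: H => // j; lia.
apply: (@reach_trans _ (mix s a b)).
  apply: IH => c h1 h2; apply: H => // j; rewrite inE negb_or => /andP[_]; exact: h2.
have -> : mix (i :: s) a b = upd (mix s a b) i (b ord0 i).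
  by apply: zdP => j; rewrite !coordE inE; case: eqP => [->|].
apply: reach_line => t; rewrite /betw coordE => ht.
apply: H => j.
  rewrite !coordE; case: eqP => [->|_]; last by case: ifP; lia.
  by move: ht; case: ifP; lia.
by rewrite inE negb_or !coordE => /andP[/negPf-> /negPf->].
Qed.

Lemma mix_enum a b : mix (enum 'I_d) a b = b.
Proof. by apply: zdP => j; rewrite coordE mem_enum. Qed.

Definition rect (lo hi : 'I_d -> int) : set (Zd d) :=
  [set a | forall j, lo j <= a ord0 j <= hi j].

Lemma connected_rect lo hi : connected_set (rect lo hi).
Proof.
move=> a b ha hb; rewrite -(mix_enum a b); apply: reach_mix => c hc _ j.
by have := ha j; have := hb j; have := hc j; rewrite /betw; lia.
Qed.

(** Every outside point is joined to the corner [o]: keep a violating coordinate [j] while the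
    others move to [o], then move [j] itself. During the last move some coordinate [l != j] is
    already too large; this is where [d >= 2] is needed. *)
Lemma connected_out lo hi : (2 <= d)%N -> connected_set (~` rect lo hi).
Proof.
move=> d2.
pose o : Zd d := \row_j (hi j + 1).
have outP a j : ~~ (lo j <= a ord0 j <= hi j) -> (~` rect lo hi) a.
  by move=> h /(_ j); apply/negP.
suff H a : (~` rect lo hi) a -> reach (~` rect lo hi) a o.
  by move=> a b /H ha /H hb; apply: reach_trans ha (reach_sym hb).
move=> /existsNP[j /negP hj].
pose s := [seq i <- enum 'I_d | i != j].
have sE i : (i \in s) = (i != j) by rewrite mem_filter mem_enum andbT.
apply: (@reach_trans _ (mix s a o)).
  by apply: reach_mix => c _ hc; apply: (@outP _ j); rewrite hc // sE eqxx.
have [l lj] : exists l : 'I_d, l != j.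
  case: (posnP j) => h; last by exists (Ordinal (ltnW d2)); rewrite -val_eqE /= neq_ltn h.
  by exists (Ordinal d2); rewrite -val_eqE /= h.
have {2}-> : o = upd (mix s a o) j (o ord0 j).
  by apply: zdP => i; rewrite !coordE sE; case: eqP => [->|].
apply: reach_line => t _; apply: (@outP _ l).
by rewrite coordE (negPf lj) coordE sE lj coordE; lia.
Qed.

Definition ball a (r : nat) : set (Zd d) := [set b : Zd d | (nrm (b - a) <= r)%N].

Lemma ball_rect a r : ball a r =
  rect (fun j => a ord0 j - r%:Z) (fun j => a ord0 j + r%:Z).
Proof.
apply/seteqP; split=> b /=.
  by move=> /nrm_leP h j; have := h j; rewrite !coordE; lia.
by move=> h; apply/nrm_leP => j; have := h j; rewrite !coordE; lia.
Qed.

Lemma connected_ball a r : connected_set (ball a r).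
Proof. by rewrite ball_rect; exact: connected_rect. Qed.

Lemma connected_thicken S r : connected_set S -> connected_set (thicken S r).
Proof.
move=> cS.
have H a : thicken S r a -> exists2 b, S b & reach (thicken S r) a b.
  move=> /thickenE[b Sb h]; exists b => //.
  apply: (@reach_mono (ball b r)); first by move=> c; rewrite /ball /= => hc; apply/thickenE; exists b.
  by apply: connected_ball => //; rewrite /ball /= subrr nrm0.
move=> a b /H[a' Sa' ha] /H[b' Sb' hb].
apply: reach_trans ha _; apply: reach_trans (reach_sym hb).
exact/(reach_mono (@sub_thicken _ _))/cS.
Qed.

End Norm.
Arguments nrm {d} a%_R.

(** * Grid unions and filling of holes *)

Section Cubes.
Variable d : nat.
Implicit Types (a b c v w : Zd d) (S T : set (Zd d)).

(** Cubes start at coordinate 1, as [box1] does; hence the shift by one in [cidx]. *)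
Definition cube (s : nat) v : set (Zd d) :=
  rect (fun j => s%:Z * v ord0 j + 1) (fun j => s%:Z * v ord0 j + s%:Z).

Definition cidx (s : nat) a : Zd d := \row_j ((a ord0 j - 1) %/ s%:Z)%Z.

Lemma box1_rect n : @box1 d n = rect (fun=> Posz 1) (fun=> n%:Z).
Proof. by []. Qed.

Lemma box1P n a : @box1 d n a <-> forall j, Posz 1 <= a ord0 j <= n%:Z.
Proof. by []. Qed.

Lemma divz_sandwich (s : nat) (x v : int) : (0 < s)%N ->
  s%:Z * v + 1 <= x <= s%:Z * v + s%:Z <-> ((x - 1) %/ s%:Z)%Z = v.
Proof.
move=> s0; have s0' : s%:Z != 0 by lia.
have := divz_eq (x - 1) s%:Z; have := modz_ge0 (x - 1) s0'.
have := ltz_pmod (x - 1) (_ : 0 < s%:Z); rewrite ltz_nat => /(_ s0).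
set q := divz _ _; set r := modz _ _; clearbody q r => h1 h2 h3.
split=> [h|<-]; last by lia.
have : s%:Z * (q - v) < s%:Z by lia.
have : - s%:Z < s%:Z * (q - v) by lia.
by nia.
Qed.

Lemma cubeE s v a : (0 < s)%N -> cube s v a <-> cidx s a = v.
Proof.
move=> s0; split=> [h|<- j].
  by apply: zdP => j; rewrite coordE; apply/divz_sandwich => //; exact: h.
by apply/divz_sandwich => //; rewrite coordE.
Qed.

Lemma cube_cidx s a : (0 < s)%N -> cube s (cidx s a) a.
Proof. by move=> s0; apply/cubeE. Qed.

Lemma cube_dist s v a b : cube s v a -> cube s v b -> (nrm (a - b) <= s)%N.
Proof.
by move=> ha hb; apply/nrm_leP => j; rewrite !coordE; have := ha j; have := hb j; lia.
Qed.

Definition aligned (s : nat) S := forall v a b, cube s v a -> cube s v b -> S a -> S b.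

Lemma aligned_mul (k q : nat) S : (0 < k)%N -> (0 < q)%N -> aligned (k * q) S -> aligned k S.
Proof.
move=> k0 q0 H v a b /(cubeE _ _ k0) ha /(cubeE _ _ k0) hb.
have kq0 : (0 < k * q)%N by rewrite muln_gt0 k0.
apply: (H (cidx (k * q) a)); apply/(cubeE _ _ kq0) => //.
apply: zdP => j; rewrite !coordE PoszM !divzMA_ge0 //.
have /(congr1 (fun c : Zd d => c ord0 j)) := etrans ha (esym hb).
by rewrite !coordE => ->.
Qed.

Lemma grid_unionP (k : nat) S : (0 < k)%N -> aligned k S ->
  connected_set S -> connected_set (~` S) -> grid_union k S.
Proof.
move=> k0 alS cS cS'; split=> //.
exists [set c | exists w, c = k%:Z *: w /\ exists2 a, cube k w a & S a], 0; split.
  by move=> c [w [-> _]]; exists w.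
apply/seteqP; split=> a.
  move=> Sa; exists (k%:Z *: cidx k a).
    by exists (cidx k a); split=> //; exists a => //; exact: cube_cidx.
  exists (a - k%:Z *: cidx k a); last by rewrite add0r addrC subrK.
  by apply/box1P => j; rewrite !coordE; have := cube_cidx a k0 j; rewrite !coordE; lia.
move=> [c [w [-> [a' ha' Sa']]] [v hv <-]].
apply: (alS w a') => // j; have /box1P/(_ j) := hv; rewrite !coordE; lia.
Qed.

Lemma adj_translate a b g : adj a b -> adj (a + g) (b + g).
Proof. by case=> i [->|->]; exists i; [left|right]; rewrite addrAC. Qed.

Lemma reach_translate S g a b : reach S a b -> reach (translate S g) (a + g) (b + g).
Proof.
elim=> [Sa|x c _ IH Sc xc]; first by apply: reach_refl; exists a.
by apply: reach_step IH _ (adj_translate _ xc); exists c.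
Qed.

Lemma connected_translate S g : connected_set S -> connected_set (translate S g).
Proof.
by move=> cS a b [a' Sa' <-] [b' Sb' <-]; apply: reach_translate; exact: cS.
Qed.

Lemma translateC S g : translate (~` S) g = ~` translate S g.
Proof. by apply/seteqP; split=> a; rewrite /setC /= !translateE. Qed.

Lemma grid_union_translate (k : nat) S g : grid_union k S -> grid_union k (translate S g).
Proof.
move=> [[C [h [hC ->]]] [cS cS']]; split; last first.
  by split; [|rewrite -translateC]; exact: connected_translate.
exists C, (h + g); split=> //; apply/seteqP; split=> a.
  move=> [_ [c Cc [v hv <-]] <-]; exists c => //; exists v => //.
  by rewrite -!addrA; congr (_ + _); rewrite addrC addrA.
move=> [c Cc [v hv <-]]; exists (h + c + v); first by exists c => //; exists v.
by rewrite -!addrA; congr (_ + _); rewrite [RHS]addrC addrA.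
Qed.

Lemma grid_union_box (k q : nat) : (2 <= d)%N -> (0 < k)%N -> grid_union k (@box1 d (k * q)).
Proof.
move=> d2 k0; apply: grid_unionP => //; last 2 first.
- by rewrite box1_rect; exact: connected_rect.
- by rewrite box1_rect; exact: connected_out.
move=> v a b ha hb /box1P h; apply/box1P => j; have := ha j; have := hb j; have := h j.
rewrite PoszM => h1 h2 h3.
have v0 : 0 <= v ord0 j by nia.
have vq : v ord0 j + 1 <= q%:Z by nia.
by nia.
Qed.

Lemma connected_cube s v : connected_set (cube s v).
Proof. exact: connected_rect. Qed.

(** [S] together with the bounded components of its complement: when [S] lies in the ball of radius
    [r], getting beyond norm [r] means being in the unbounded component. *)
Definition fill (r : nat) S : set (Zd d) :=
  [set a | ~ exists2 b, (r < nrm b)%N & reach (~` S) a b].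

Section Fill.
Variables (r : nat) (S : set (Zd d)).
Hypothesis Sr : forall a, S a -> (nrm a <= r)%N.

Lemma sub_fill : S `<=` fill r S.
Proof. by move=> a Sa [b _ /reach_l]; apply. Qed.

Lemma fill_nrm a : fill r S a -> (nrm a <= r)%N.
Proof.
move=> h; rewrite leqNgt; apply/negP => ra; apply: h; exists a => //.
by apply: reach_refl => /Sr; rewrite leqNgt ra.
Qed.

Lemma fill_reach a b : reach (~` S) a b -> fill r S a -> fill r S b.
Proof. by move=> ab h [c rc bc]; apply: h; exists c => //; exact: reach_trans bc. Qed.

Lemma fillC_reach a b : reach (~` S) a b -> ~ fill r S a -> reach (~` fill r S) a b.
Proof.
elim=> [_ h|b' c ab IH Sc bc h]; first exact: reach_refl.
apply: (reach_step _ _ bc); first exact: IH.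
move=> hc; apply: h; apply: fill_reach hc; apply: reach_sym.
exact: reach_step ab Sc bc.
Qed.

Lemma fill_coconnected : (2 <= d)%N -> connected_set (~` fill r S).
Proof.
move=> d2 a b ha hb.
have [a' ra aa'] := contrapT ha; have [b' rb bb'] := contrapT hb.
apply: (reach_trans (fillC_reach aa' ha)); apply: reach_trans (reach_sym (fillC_reach bb' hb)).
have sub : ~` ball 0 r `<=` ~` fill r S.
  by move=> c; rewrite /ball /setC /= subr0 => h /fill_nrm.
apply: (reach_mono sub); rewrite ball_rect; apply: connected_out => //; rewrite -ball_rect /setC /ball /= subr0; apply/negP; rewrite -ltnNge //.
Qed.

(** A ray from a filled point stays in the filled set as long as it has not met [S]. It has to meet
    [S], since the filled set is bounded. *)
Lemma fill_connected : (0 < d)%N -> connected_set S -> connected_set (fill r S).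
Proof.
move=> d0 cS.
suff H a : fill r S a -> exists2 b, S b & reach (fill r S) a b.
  move=> a b /H[a' Sa' ha] /H[b' Sb' hb].
  apply: reach_trans ha _; apply: reach_trans (reach_sym hb).
  by apply: (reach_mono sub_fill); exact: cS.
move=> fa; apply: contrapT => /forall2NP nh.
pose i := Ordinal d0.
have H n : let c := upd a i (a ord0 i + n%:Z) in reach (fill r S) a c /\ ~ S c.
  elim: n => [|n [IH1 IH2]] /=.
    rewrite addr0 upd_id; split; first exact: reach_refl.
    by move=> Sa; have [//|] := nh a; apply; apply: reach_refl.
  set c := upd _ _ _; set c' := upd _ _ _ in IH1 IH2.
  have cc' : adj c' c by rewrite /c (_ : a ord0 i + n.+1%:Z = a ord0 i + n%:Z + 1); [exact: adj_upd|lia].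
  have fc : fill r S c.
    have [/sub_fill//|Sc] := pselect (S c).
    apply: fill_reach (reach_r IH1); apply: reach_step cc' => //; exact: reach_refl.
  have rc : reach (fill r S) a c by apply: reach_step cc'.
  by split=> // Sc; have [] := nh c.
have [/reach_r /fill_nrm /nrm_leP /(_ i) + _] := H (absz (a ord0 i) + r.+1)%N.
by rewrite coordE eqxx; lia.
Qed.

(** A connected set that misses [S] lies in one component of the complement, and a component is
    filled entirely or not at all. *)
Lemma fill_dichotomy T : connected_set T -> T `&` S = set0 ->
  T `<=` fill r S \/ T `&` fill r S = set0.
Proof.
move=> cT TS.
have TS' : T `<=` ~` S by move=> a Ta Sa; have : (T `&` S) a by []; rewrite TS.
have [[a [Ta fa]]|h] := pselect (exists a, T a /\ fill r S a).
  by left=> b Tb; apply: fill_reach fa; apply: (reach_mono TS'); exact: cT.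
right; apply/seteqP; split=> // a [Ta fa]; apply: h; by exists a.
Qed.

Lemma fill_aligned s : aligned s S -> aligned s (fill r S).
Proof.
move=> al v a b ha hb fa.
have [[c [hc Sc]]|h] := pselect (exists c, cube s v c /\ S c).
  by apply: sub_fill; exact: (al v c).
apply: fill_reach fa; apply: (reach_mono _ (connected_cube ha hb)) => c hc Sc.
by apply: h; exists c.
Qed.

End Fill.

End Cubes.

(** * Borel functions with countably many values *)

Section BorelFun.
Variables (d : nat) (B : finType).
Notation cfg := (Zd d -> B).
Implicit Types (Q : cfg -> Prop) (g a : Zd d).

Definition bpred Q := borel_config [set y : cfg | Q y].

Lemma bpred_not Q : bpred Q -> bpred (fun y => ~ Q y).
Proof. by move=> h; have := sigma_algebraCD h; rewrite setTD. Qed.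

Lemma bpred_exn (Q : nat -> cfg -> Prop) :
  (forall n, bpred (Q n)) -> bpred (fun y => exists n, Q n y).
Proof.
move=> h; have := sigma_algebra_bigcup h; congr borel_config.
by apply/seteqP; split=> y [n]; [move=> _|]; exists n.
Qed.

Lemma bpred_cst (p : Prop) : bpred (fun=> p).
Proof.
have b0 : bpred (fun=> False) by apply: sigma_algebra0.
have [hp|hp] := pselect p; last by congr bpred: b0; apply/funext => y; apply/propext.
by have := bpred_not b0; congr bpred; apply/funext => y; apply/propext; split=> // _ [].
Qed.

Lemma bpred_or Q1 Q2 : bpred Q1 -> bpred Q2 -> bpred (fun y => Q1 y \/ Q2 y).
Proof.
move=> h1 h2; have := @bpred_exn (fun n => if n is 0 then Q1 else Q2).
rewrite /bpred; move/(_ _) => H; have {}H := H (fun n => match n with 0 => h1 | _ => h2 end).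
move: H; congr borel_config; apply/seteqP; split=> y /=; first by move=> [[|n]]; [left|right].
by case=> h; [exists 0%N|exists 1%N].
Qed.

Lemma bpred_and Q1 Q2 : bpred Q1 -> bpred Q2 -> bpred (fun y => Q1 y /\ Q2 y).
Proof.
move=> h1 h2; have := bpred_not (bpred_or (bpred_not h1) (bpred_not h2)).
congr bpred; apply/funext => y; apply/propext; split=> [/not_orP[/contrapT ? /contrapT]//|[? ?]].
by case.
Qed.

Lemma bpred_shift g Q : bpred Q -> bpred (fun y => Q (shift g y)).
Proof.
move=> hQ.
suff H : @borel_config d B `<=` [set S : set cfg | borel_config (shift g @^-1` S)] by exact: (H [set y | Q y]).
apply: smallest_sub; first split.
- exact: sigma_algebra0.
- by move=> S hS; rewrite /= setTD preimage_setC; exact: bpred_not hS.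
- by move=> S hS; rewrite /= preimage_bigcup; exact: sigma_algebra_bigcup.
- move=> _ [a [s ->]]; apply: sub_sigma_algebra; by exists (g + a), s.
Qed.

(* [T] carries no sigma-algebra: [G] factors through a Borel map to [nat], so that any function of [G]
   is again of this kind. *)
Definition bfun (T : Type) (G : cfg -> T) :=
  exists h : cfg -> nat, (forall c, bpred (fun y => h y = c)) /\
    forall y y', h y = h y' -> G y = G y'.

Lemma bfun_bpred Q : bfun Q -> bpred Q.
Proof.
move=> [h [hb hQ]].
have := @bpred_exn (fun c y => h y = c /\ exists2 y', h y' = c & Q y').
have H c : bpred (fun y => h y = c /\ exists2 y', h y' = c & Q y').
  by apply: bpred_and => //; exact: bpred_cst.
move=> /(_ H); congr bpred; apply/funext => y; apply/propext; split.
  by move=> [c [yc [y' y'c]]]; rewrite (hQ _ y') // yc.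
by move=> Qy; exists (h y); split=> //; exists y.
Qed.

Lemma bpred_bfun Q : bpred Q -> bfun Q.
Proof.
move=> hQ; exists (fun y => nat_of_bool `[<Q y>]); split.
  move=> c.
  have := bpred_or (bpred_and hQ (bpred_cst (c = 1%N))) (bpred_and (bpred_not hQ) (bpred_cst (c = 0%N))).
  congr bpred; apply/funext => y; apply/propext; split.
    by case=> [[/asboolT-> ->]|[/asboolF-> ->]].
  by case: asboolP => hy <-; [left|right].
by move=> y y'; do 2 case: asboolP => ?; move=> // _; apply/propext.
Qed.

Lemma bfun_comp (T U : Type) (F : T -> U) (G : cfg -> T) : bfun G -> bfun (fun y => F (G y)).
Proof. by move=> [h [hb hG]]; exists h; split=> // y y' /hG ->. Qed.

Lemma bfun_cst (T : Type) (t : T) : bfun (fun=> t).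
Proof. by exists (fun=> 0%N); split=> // c; exact: bpred_cst. Qed.

Lemma bfun_pair (T U : Type) (G : cfg -> T) (H : cfg -> U) :
  bfun G -> bfun H -> bfun (fun y => (G y, H y)).
Proof.
move=> [g [gb gG]] [h [hb hH]]; exists (fun y => pickle (g y, h y)); split; last first.
  by move=> y y' /(pcan_inj pickleK) [/gG -> /hH ->].
move=> c.
have H0 c1 c2 : bpred (fun y => (c = pickle (c1, c2)) /\ (g y = c1 /\ h y = c2)).
  by apply: bpred_and; [exact: bpred_cst|exact: bpred_and].
have := bpred_exn (fun c1 => bpred_exn (H0 c1)); congr bpred.
apply/funext => y; apply/propext; split; first by move=> [c1 [c2 [-> [-> ->]]]].
by move=> <-; exists (g y), (h y).
Qed.

Lemma bfun_comp2 (T U V : Type) (F : T -> U -> V) (G : cfg -> T) (H : cfg -> U) :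
  bfun G -> bfun H -> bfun (fun y => F (G y) (H y)).
Proof. by move=> hG hH; exact: (bfun_comp (fun p => F p.1 p.2) (bfun_pair hG hH)). Qed.

(** Only finitely many coordinates of the resulting function vary, which keeps the number of its
    values countable. *)
Lemma bfun_fin (I : eqType) (s : seq I) (T : Type) (dflt : I -> T) (G : I -> cfg -> T) :
  (forall i, bfun (G i)) -> bfun (fun y => fun i => if i \in s then G i y else dflt i).
Proof.
move=> hG; elim: s => [|i s IH]; first exact: (bfun_cst dflt).
have := bfun_comp2 (fun (t : T) (f : I -> T) j => if j == i then t else f j) (hG i) IH.
congr bfun; apply/funext => y; apply/funext => j.
by rewrite inE; case: eqP => [->|].
Qed.

Lemma bfun_ex (I : countType) (Q : I -> cfg -> Prop) :
  (forall i, bfun (Q i)) -> bfun (fun y => exists i, Q i y).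
Proof.
move=> h; apply: bpred_bfun.
have H n : bpred (fun y => if unpickle n is Some i then Q i y else False).
  by case: unpickle => [i|]; [exact: bfun_bpred|exact: bpred_cst].
have := bpred_exn H; congr bpred; apply/funext => y; apply/propext; split.
  by move=> [n]; case: unpickle => // i; exists i.
by move=> [i Qi]; exists (pickle i); rewrite pickleK.
Qed.

Lemma bfun_all (I : countType) (Q : I -> cfg -> Prop) :
  (forall i, bfun (Q i)) -> bfun (fun y => forall i, Q i y).
Proof.
move=> h; have := bfun_comp not (bfun_ex (fun i => bfun_comp not (h i))); congr bfun.
apply/funext => y; apply/propext; split=> [H i|H [i]]; last exact.
by apply: contrapT => nQ; apply: H; exists i.
Qed.

Lemma bfun_shift g (T : Type) (G : cfg -> T) : bfun G -> bfun (fun y => G (shift g y)).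
Proof.
move=> [h [hb hG]]; exists (fun y => h (shift g y)); split=> [c|y y' /hG //].
exact: (bpred_shift _ (hb c)).
Qed.

Lemma bfun_eval a : bfun (fun y : cfg => y a).
Proof.
exists (fun y => pickle (y a)); split=> [c|y y' /(pcan_inj pickleK) //].
have [[s hs]|hs] := pselect (exists s : B, pickle s = c).
  suff : bpred (fun y => y a = s).
    congr bpred; apply/funext => y; apply/propext; split=> [->//|].
    by rewrite -hs => /(pcan_inj pickleK).
  by apply: sub_sigma_algebra; exists a, s.
have := bpred_cst False; congr bpred; apply/funext => y; apply/propext; split=> // h.
by apply: hs; exists (y a).
Qed.

End BorelFun.
Arguments bfun_eval {d B} a.
Arguments bfun_cst {d B T} t.

Section BorelLogic.
Variables (d : nat) (B : finType).
Implicit Types (Q : (Zd d -> B) -> Prop).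

Lemma bfun_and Q1 Q2 : bfun Q1 -> bfun Q2 -> bfun (fun y => Q1 y /\ Q2 y).
Proof. exact: bfun_comp2. Qed.

Lemma bfun_or Q1 Q2 : bfun Q1 -> bfun Q2 -> bfun (fun y => Q1 y \/ Q2 y).
Proof. exact: bfun_comp2. Qed.

Lemma bfun_not Q : bfun Q -> bfun (fun y => ~ Q y).
Proof. exact: bfun_comp. Qed.

Lemma bfun_imp (p : Prop) Q : bfun Q -> bfun (fun y => p -> Q y).
Proof. exact: (bfun_comp (fun q : Prop => p -> q)). Qed.

Lemma bfun_eq (T : Type) (G : (Zd d -> B) -> T) t : bfun G -> bfun (fun y => G y = t).
Proof. exact: (bfun_comp (fun u => u = t)). Qed.

End BorelLogic.

(** * Separated sets *)

Section FiniteBall.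
Variable d : nat.

Definition zball (r : nat) : seq (Zd d) :=
  [seq (\row_j ((nat_of_ord (i ord0 j))%:Z - r%:Z) : Zd d) | i : 'rV['I_(2 * r).+1]_d].

Lemma mem_zball r (z : Zd d) : (z \in zball r) = (nrm z <= r)%N.
Proof.
apply/mapP/idP => [[i _ ->]|/nrm_leP h].
  by apply/nrm_leP => j; rewrite coordE; case: (i ord0 j) => v /= hv; lia.
exists (\row_j inord (absz (z ord0 j + r%:Z))); first by rewrite mem_enum.
by apply: zdP => j; rewrite coordE mxE inordK; have := h j; lia.
Qed.

Lemma zball_uniq r : uniq (zball r).
Proof.
rewrite map_inj_uniq ?enum_uniq // => i i' h; apply/rowP => j; apply/val_inj.
have := congr1 (fun z : Zd d => z ord0 j) h; rewrite !coordE /=.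
by move/eqP; rewrite (inj_eq (addIr _)) => /eqP [].
Qed.

Lemma size_zball r : size (zball r) = ((2 * r).+1 ^ d)%N.
Proof. by rewrite size_map -cardE card_mx card_ord mul1n. Qed.

End FiniteBall.

Section Shift.
Variables (d : nat) (B : Type).
Implicit Type y : Zd d -> B.

Lemma shift_shift (a b : Zd d) y : shift a (shift b y) = shift (b + a) y.
Proof. by apply/funext => c; rewrite /shift addrA. Qed.

Lemma shift0 y : shift 0 y = y.
Proof. by apply/funext => c; rewrite /shift add0r. Qed.

Definition aperiodic y := forall g : Zd d, g != 0 -> shift g y <> y.

End Shift.

Section Separated.
Variables (d : nat) (B : finType).
Notation cfg := (Zd d -> B).
Implicit Types (E : cfg -> Prop) (y : cfg) (z g : Zd d) (w : seq (Zd d * B)).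

Definition matches w y := forall p, p \in w -> y p.1 = p.2.

Lemma bfun_matches w : bfun (matches w).
Proof.
apply: bfun_all => p.
exact/bfun_imp/bfun_eq/bfun_eval.
Qed.

Variable G : nat.

Definition cand w y :=
  matches w y /\ forall g, g != 0 -> (nrm g <= G)%N -> ~ matches w (shift g y).

Lemma bfun_cand w : bfun (cand w).
Proof.
apply: bfun_and; first exact: bfun_matches.
apply: bfun_all => g; do 2 apply: bfun_imp; apply: bfun_not.
exact/bfun_shift/bfun_matches.
Qed.

(** For each [g], aperiodicity provides a site [a g] at which [y] and its shift by [g] differ; the
    pattern of [y] on these finitely many sites is a witness. *)
Lemma cand_ex y : aperiodic y -> exists w, cand w y.
Proof.
move=> hy.
have [a ha] : {a : Zd d -> Zd d & forall g, g != 0 -> y (a g) <> y (g + a g)}.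
  suff H g : exists a, g != 0 -> y a <> y (g + a).
    by exists (fun g => projT1 (cid (H g))) => g; exact: (projT2 (cid (H g))).
  apply: contrapT => /forallNP h; have [g0|] := pselect (g != 0); last first.
    by move=> g0; apply: (h 0).
  apply: (hy g g0); apply/funext => c; apply: contrapT => e.
  by apply: (h c) => _ ee; apply: e; rewrite /shift ee.
exists [seq (a g, y (a g)) | g <- zball d G]; split; first by move=> _ /mapP[g _ ->].
move=> g g0 hg /(_ (a g, y (a g))) h; apply: (ha g g0).
by apply: esym; apply: h; apply/mapP; exists g; rewrite ?mem_zball.
Qed.

Definition pat_of (t : nat) : seq (Zd d * B) := odflt [::] (unpickle t).

Lemma pat_ofK w : pat_of (pickle w) = w.
Proof. by rewrite /pat_of pickleK. Qed.

(* Greedy construction of a maximal [G]-separated subset of [E]: the patterns [w] are a countable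
   colouring in which points at distance at most [G] never share a colour. *)
Fixpoint greedy E (t : nat) : cfg -> Prop :=
  if t is t'.+1 then fun y => greedy E t' y \/
    (E y /\ cand (pat_of t') y) /\
      (forall z, (nrm z <= G)%N -> ~ greedy E t' (shift z y))
  else fun=> False.

Definition maxsep E y := exists t, greedy E t y.

Lemma bfun_greedy E t : bfun E -> bfun (greedy E t).
Proof.
move=> hE; elim: t => [|t IH] /=; first exact: bfun_cst.
apply: bfun_or => //; apply: bfun_and.
  by apply: bfun_and => //; exact: bfun_cand.
by apply: bfun_all => z; apply/bfun_imp/bfun_not/bfun_shift.
Qed.

Lemma bfun_maxsep E : bfun E -> bfun (maxsep E).
Proof. by move=> hE; apply: bfun_ex => t; exact: bfun_greedy. Qed.

Lemma maxsep_sub E y : maxsep E y -> E y.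
Proof. by move=> [t]; elim: t => //= t IH [/IH|[[]]]. Qed.

Lemma greedy_mono E s t y : (s <= t)%N -> greedy E s y -> greedy E t y.
Proof.
elim: t => [|t IH]; first by rewrite leqn0 => /eqP->.
by rewrite leq_eqVlt => /orP[/eqP->//|st h]; left; exact: IH.
Qed.

Lemma greedy_first E t y : greedy E t y -> exists s, [/\ ~ greedy E s y,
  greedy E s.+1 y & [/\ E y, cand (pat_of s) y &
  forall z, (nrm z <= G)%N -> ~ greedy E s (shift z y)]].
Proof.
elim: t => //= t IH [/IH//|h].
have [/IH//|ny] := pselect (greedy E t y).
exists t; split=> //; first by right.
by move: h => [[hE hw] hz]; split.
Qed.

(** Compare the stages at which the two points entered. At different stages the later point would
    have been refused; at the same stage both match one pattern, which [cand] forbids within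
    distance [G]. *)
Lemma maxsep_sep E y z : maxsep E y -> maxsep E (shift z y) -> z != 0 -> (G < nrm z)%N.
Proof.
move=> [t /greedy_first[s [_ hs [Ey cw fy]]]].
move=> [t' /greedy_first[s' [_ hs' [Ez cw' fz]]]] z0.
rewrite ltnNge; apply/negP => zG.
have [ss'|s's|e] := ltngtP s s'.
- apply: (fz (- z)); first by rewrite nrmN.
  by rewrite shift_shift subrr shift0; exact: greedy_mono hs.
- by apply: (fy z zG); exact: greedy_mono hs'.
- move: cw'; rewrite -e => -[mz _].
  by case: cw => _ /(_ z z0 zG).
Qed.

Lemma maxsep_max E y : aperiodic y -> E y -> exists2 z, (nrm z <= G)%N & maxsep E (shift z y).
Proof.
move=> /cand_ex[w cw] Ey.
have [[z hz]|h] := pselect (exists z, (nrm z <= G)%N /\ greedy E (pickle w) (shift z y)).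
  by exists z; [case: hz|exists (pickle w); case: hz].
exists 0; first by rewrite nrm0.
exists (pickle w).+1; rewrite shift0 /=; right; rewrite pat_ofK; split=> // z zG hz.
by apply: h; exists z.
Qed.

End Separated.

(** * Centres in finitely many colours *)

Section RawCentres.
Variables (d : nat) (B : finType) (t : nat).
Notation cfg := (Zd d -> B).
Local Notation G := (20 * t)%N.

(** Colour [i] is drawn from the points that no earlier colour approaches within [t]. The separation
    [20 * t] becomes the required [10 * rho] for [rho = 2 * t]. *)
Fixpoint elig (i : nat) : cfg -> Prop :=
  if i is i'.+1 then fun y => elig i' y /\
    forall z, (nrm z <= t)%N -> ~ maxsep G (elig i') (shift z y)
  else fun=> True.

Definition raw i := maxsep G (elig i).

Lemma bfun_elig i : bfun (elig i).
Proof.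
elim: i => [|i IH] /=; first exact: bfun_cst.
apply: bfun_and => //; apply: bfun_all => z.
exact/bfun_imp/bfun_not/bfun_shift/bfun_maxsep.
Qed.

Lemma bfun_raw i : bfun (raw i).
Proof. exact/bfun_maxsep/bfun_elig. Qed.

Lemma elig_mono i j y : (i <= j)%N -> elig j y -> elig i y.
Proof.
elim: j => [|j IH]; first by rewrite leqn0 => /eqP->.
by rewrite leq_eqVlt => /orP[/eqP->//|ij [h _]]; exact: IH.
Qed.

(** The ball of radius [20 * t] splits into [41 ^ d] cells of side [t.+1]; among [ncol] of its
    points two share a cell and are thus within [t]. *)
Definition ncol := (41 ^ d).+1.

(* A point covered by no colour is eligible at every stage, which produces [ncol] points of the ball of
   radius [20 * t] that are pairwise more than [t] apart. *)
Lemma raw_cover (y : cfg) : aperiodic y ->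
  exists (i : 'I_ncol) (z : Zd d), (nrm z <= t)%N /\ raw i (shift z y).
Proof.
move=> hy; apply: contrapT => /forallNP nh.
have el i : (i <= ncol)%N -> elig i y.
  elim: i => // i IH hi /=; split; first exact/IH/ltnW.
  by move=> z zt hz; apply: (nh (Ordinal hi)); exists z.
have H (i : 'I_ncol) : exists z : Zd d, (nrm z <= G)%N /\ raw i (shift z y).
  by have [z h1 h2] := maxsep_max G hy (el i (ltnW (ltn_ord i))); exists z.
pose z i := projT1 (cid (H i)).
have zP i : (nrm (z i) <= G)%N /\ raw i (shift (z i) y) by exact: (projT2 (cid (H i))).
have far (i j : 'I_ncol) : (i < j)%N -> (t < nrm (z i - z j))%N.
  move=> ij; rewrite ltnNge; apply/negP => h.
  have /maxsep_sub/(elig_mono ij)[_ /(_ _ h)] := (zP j).2.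
  by rewrite shift_shift addrC subrK; apply; exact: (zP i).2.
pose cell (i : 'I_ncol) : 'rV['I_41]_d :=
  \row_j inord (absz (z i ord0 j + G%:Z)%R %/ t.+1)%N.
suff inj : injective cell.
  by have := leq_card cell inj; rewrite card_ord card_mx card_ord mul1n ltnn.
have close i j : cell i = cell j -> (nrm (z i - z j) <= t)%N.
  move=> e; apply/nrm_leP => l; rewrite !coordE.
  have bd i' : (absz (z i' ord0 l + G%:Z)%R%R %/ t.+1 < 41)%N.
    rewrite ltn_divLR //; have := (zP i').1 => /nrm_leP/(_ l); lia.
  have := congr1 (fun c : 'rV['I_41]_d => nat_of_ord (c ord0 l)) e.
  rewrite !mxE !inordK //.
  have := divn_eq (absz (z i ord0 l + G%:Z)%R) t.+1.
  have := divn_eq (absz (z j ord0 l + G%:Z)%R) t.+1.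
  have := ltn_pmod (absz (z i ord0 l + G%:Z)%R) (ltn0Sn t).
  have := ltn_pmod (absz (z j ord0 l + G%:Z)%R) (ltn0Sn t).
  have := (zP i).1 => /nrm_leP/(_ l); have := (zP j).1 => /nrm_leP/(_ l).
  set q := divn _ _; set q' := divn _ _; set r := modn _ _; set r' := modn _ _.
  clearbody q q' r r' => h1 h2 h3 h4 h5 h6 e'; subst q'; lia.
move=> i j e; apply/val_inj; have := close i j e; have := close j i (esym e).
by have [ij|ij|//] := ltngtP i j; have := far _ _ ij; rewrite ltnNge => /negP.
Qed.

Lemma raw_sep i (y : cfg) z : raw i y -> raw i (shift z y) -> z != 0 -> (G < nrm z)%N.
Proof. exact: maxsep_sep. Qed.

End RawCentres.

(** * Toasts *)

Lemma nrm_ex d (n : nat) : (0 < d)%N -> exists v : Zd d, nrm v = n.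
Proof.
move=> d0; exists (\row_i n%:Z); apply/eqP; rewrite eqn_leq; apply/andP; split.
  by apply/nrm_leP => j; rewrite coordE.
by apply: leq_trans (nrm_ge _ (Ordinal d0)); rewrite coordE.
Qed.

Section Conn.
Variable d : nat.
Implicit Types (F : set (set (Zd d))) (e a b : Zd d).

(** Chains of members of [F] in which consecutive members share a point; the points reached from [e]
    form its cluster. *)
Inductive conn F e : Zd d -> Prop :=
  | conn0 : conn F e e
  | connS b a T : conn F e b -> F T -> T b -> T a -> conn F e a.

Lemma conn_sub F F' e a : F `<=` F' -> conn F e a -> conn F' e a.
Proof.
move=> FF'; elim=> [|b c T _ IH FT Tb Tc]; first exact: conn0.
exact: connS IH (FF' _ FT) Tb Tc.
Qed.

Definition hull (s : nat) (S : set (Zd d)) : set (Zd d) :=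
  [set a | exists2 b, S b & cidx s a = cidx s b].

Variable s : nat.
Hypothesis s0 : (0 < s)%N.

Lemma sub_hull S : S `<=` hull s S.
Proof. by move=> a Sa; exists a. Qed.

Lemma cidx_dist a b : cidx s a = cidx s b -> (nrm (a - b) <= s)%N.
Proof. by move=> e; apply: (@cube_dist _ _ (cidx s a)); apply/cubeE. Qed.

Lemma hull_aligned S : aligned s (hull s S).
Proof. by move=> v a b /(cubeE _ _ s0) ha /(cubeE _ _ s0) hb [c Sc e]; exists c; rewrite // hb -ha. Qed.

Lemma hull_connected S : connected_set S -> connected_set (hull s S).
Proof.
move=> cS.
suff H a : hull s S a -> exists2 b, S b & reach (hull s S) a b.
  move=> a b /H[a' Sa' ha] /H[b' Sb' hb].
  apply: reach_trans ha _; apply: reach_trans (reach_sym hb).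
  exact/(reach_mono (@sub_hull _))/cS.
move=> [b Sb e]; exists b => //.
apply: (@reach_mono _ (cube s (cidx s b))) => [c /(cubeE _ _ s0) hc|]; first by exists b.
by apply: connected_cube; apply/cubeE.
Qed.

End Conn.

(* [kk] and [mm] are the [k] and [m] of the theorem.  Code words live on boxes of side [cN' = kk * nn]
   inside cubes of side [cN], markers on boxes of side [cM], and tiles are unions of cubes of side [cW].
   At level [n] a tile is roughly a ball of radius [rho n] around its anchor, [gf n] is the radius of the
   region around an anchor of higher level that is free of level [n] tiles, [sc n] the distance an
   anchor may be moved, [ab n] the reach of clusters of tiles of level less than [n], and [kap n] the
   place of the header cube number [n]; [cap n] compares the data [cb] bits per site to be stored with
   the number [qn n ^ d] of data cubes. *)
Record scales (d : nat) := Scales {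
  kk : nat; mm : nat; nn : nat; qq : nat; ll : nat; cb : nat;
  sc : nat -> nat; ab : nat -> nat; gf : nat -> nat; rho : nat -> nat;
  kap : nat -> nat; qn : nat -> nat;
  cN' := (kk * nn)%N;
  cN := (cN' + 2 * mm)%N;
  cW := (kk * qq)%N;
  cM := (kk * ll)%N;
  cD := (6 * cW)%N;
  d2 : (2 <= d)%N;
  kk0 : (0 < kk)%N;
  nn0 : (0 < nn)%N;
  W_ge : (2 * (cN + mm) + 2 <= cW)%N;
  M_ge : (4 * cW <= cM)%N;
  sc_S : forall n, (sc n + 4 * rho n + 2 * (gf n + sc n) + 1 <= sc n.+1)%N;
  ab_S : forall n, (2 * ab n + 4 * rho n + 2 * (cD + cW) <= ab n.+1)%N;
  rho_ge : forall n, (ab n + 2 * cW + cD + 2 * gf n + 3 * sc n + n + 1 <= rho n)%N;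
  gf0_ge : (8 * cM <= gf 0)%N;
  kap0_ge : (cM + mm + sc 0 + 2 * cN < kap 0)%N;
  kap_gf : forall n, (kap n + sc n + cN + mm < gf n)%N;
  gf_kap : forall n, (gf n + sc n.+1 + 2 * cN < kap n.+1)%N;
  qn_rho : forall n, (gf n + (2 * (sc n + cN) + 1) * (qn n).+1 + 2 * cN <= rho n)%N;
  cap : forall n, (cb * ((2 * (rho n + ab n + 2 * cW)).+1 ^ d - (2 * (rho n - cN)).+1 ^ d
                          + (2 * (gf n + cN)).+1 ^ d) <= qn n ^ d)%N }.

Record rawseq (d : nat) (B : finType) (S : scales d) := RawSeq {
  raw_at : nat -> (Zd d -> B) -> Prop;
  raw_far : forall n y z, raw_at n y -> raw_at n (shift z y) -> z != 0 -> (10 * rho S n < nrm z)%N;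
  raw_bfun : forall n, bfun (raw_at n) }.

Section Toast.
Variables (d : nat) (B : finType) (S : scales d) (r : rawseq B S).
Notation cfg := (Zd d -> B).
Local Notation W := (cW S).
Local Notation D := (cD S).
Local Notation D1 := (D + W)%N.
Local Notation sc := (sc S).
Local Notation ab := (ab S).
Local Notation gf := (gf S).
Local Notation rho := (rho S).
Local Notation raw := (raw_at r).
Local Notation d2 := (d2 S).
Local Notation sc_S := (sc_S S).
Local Notation ab_S := (ab_S S).
Local Notation rho_ge := (rho_ge S).

Lemma W0 : (0 < W)%N.
Proof. by have := W_ge S; lia. Qed.
Local Hint Resolve W0 : core.

(** Whether the origin is an anchor, and the tile belonging to it; the second component is defined
    even where there is no anchor. *)
Definition ldata := (Prop * set (Zd d))%type.
(* A tile of level [n] depends on the lower tiles with anchors at distance at most [4 * rho n] only, and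
   is thus a function of finitely many Borel functions.  Everything is seen from the origin, so that
   equivariance holds by construction. *)
Definition trunc n : seq (nat * Zd d) := [seq (j, z) | j <- iota 0 n, z <- zball d (4 * rho n)].

Lemma mem_trunc n j z : ((j, z) \in trunc n) = (j < n)%N && (nrm z <= 4 * rho n)%N.
Proof.
apply/allpairsP/andP => [[[j' z'] /= [h1 h2 [-> ->]]]|[h1 h2]].
  by move: h1 h2; rewrite mem_iota mem_zball.
by exists (j, z); rewrite /= mem_iota mem_zball.
Qed.

Definition low (lo : nat -> cfg -> ldata) n (y : cfg) (p : nat * Zd d) : ldata :=
  if p \in trunc n then lo p.1 (shift p.2 y) else (False, set0).

Definition ltile (L : nat * Zd d -> ldata) j z := translate (L (j, z)).2 z.

Definition ngood n (L : nat * Zd d -> ldata) (z : Zd d) :=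
  forall j (z' a : Zd d), (j < n)%N -> (L (j, z')).1 -> ltile L j z' a -> (gf j < nrm (a - z))%N.

Definition zpick n L := xget 0 [set z | (nrm z <= sc n)%N /\ ngood n L z].

Definition lfam (L : nat * Zd d -> ldata) : set (set (Zd d)) :=
  [set T | exists j z, (L (j, z)).1 /\ T = thicken (ltile L j z) D1].

Definition core n L : set (Zd d) := [set a | exists2 e, (nrm e <= rho n)%N & conn (lfam L) e a].

Definition tileF n L := fill (rho n + ab n + W) (hull W (core n L)).

(** The anchor condition is read backwards: the origin is an anchor if some raw centre [c] nearby,
    choosing from its own point of view, moves to it. *)
Definition step (lo : nat -> cfg -> ldata) n (y : cfg) : ldata :=
  (exists c, (nrm c <= sc n)%N /\ raw n (shift c y) /\ zpick n (low lo n (shift c y)) = - c,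
   tileF n (low lo n y)).

(** Course-of-values recursion: [tow n] is the table of all levels below [n], so that [step] can
    consult each of them. *)
Fixpoint tow n : nat -> cfg -> ldata :=
  if n is n'.+1 then fun j y => if j == n' then step (tow n') n' y else tow n' j y
  else fun _ _ => (False, set0).

Definition data n := tow n.+1 n.
Definition anc n y := (data n y).1.
Definition tile n y := (data n y).2.
Definition atile y j z := translate (tile j (shift z y)) z.
Notation Low := (low data).

Lemma tow_data n j : (j < n)%N -> tow n j = data j.
Proof.
elim: n => // n IH; rewrite ltnS leq_eqVlt => /orP[/eqP->//|jn].
by apply/funext => y /=; rewrite (ltn_eqF jn) IH.
Qed.

Lemma low_tow n : low (tow n) n = Low n.
Proof.
apply/funext => y; apply/funext => -[j z]; rewrite /low mem_trunc.
by case: ifP => // /andP[/tow_data->].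
Qed.

Lemma dataE n y : data n y = step data n y.
Proof. by rewrite /data /= eqxx /step low_tow. Qed.

Lemma ancE n y : anc n y =
  exists c, (nrm c <= sc n)%N /\ raw n (shift c y) /\ zpick n (Low n (shift c y)) = - c.
Proof. by rewrite /anc dataE. Qed.

Lemma tileE n y : tile n y = tileF n (Low n y).
Proof. by rewrite /tile dataE. Qed.

Lemma bfun_low n : (forall j, (j < n)%N -> bfun (data j)) -> bfun (Low n).
Proof.
move=> h.
have H p : bfun (fun y => if (p.1 < n)%N then data p.1 (shift p.2 y) else (False, set0)).
  have [pn|_] := boolP (p.1 < n)%N; last exact: bfun_cst.
  exact: (bfun_shift p.2 (h _ pn)).
have := bfun_fin (trunc n) (fun=> (False, set0)) H; congr bfun.
apply/funext => y; apply/funext => -[j z]; rewrite /low mem_trunc.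
by case: ifP => // /andP[/= ->].
Qed.

Lemma bfun_data n : bfun (data n).
Proof.
elim/ltn_ind: n => n IH; have hL := bfun_low IH.
have -> : data n = fun y => step data n y by apply/funext => y; exact: dataE.
apply: bfun_pair; last exact: (bfun_comp (tileF n) hL).
apply: bfun_ex => c; apply: bfun_and; first exact: bfun_cst.
apply: bfun_and; first exact: (bfun_shift c (raw_bfun r n)).
exact: bfun_eq (bfun_shift c (bfun_comp (zpick n) hL)).
Qed.

Lemma Low_anc n y j z : (Low n y (j, z)).1 <->
  [/\ (j < n)%N, (nrm z <= 4 * rho n)%N & anc j (shift z y)].
Proof.
rewrite /low mem_trunc; case: (ltnP j n) => h1 /=; last by split=> // -[].
by case: (leqP (nrm z) _) => h2 /=; split=> // -[].
Qed.

Lemma Low_tile n y j z : (j < n)%N -> (nrm z <= 4 * rho n)%N -> ltile (Low n y) j z = atile y j z.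
Proof. by move=> h1 h2; rewrite /ltile /low mem_trunc h1 h2. Qed.

Lemma atile_shift g y j z a : atile (shift g y) j z a <-> atile y j (g + z) (g + a).
Proof.
rewrite /atile !translateE shift_shift.
by have -> : g + a - (g + z) = a - z by rewrite opprD addrACA subrr add0r.
Qed.


Lemma sc_mono m n : (m <= n)%N -> (sc m <= sc n)%N.
Proof.
elim: n => [|n IH]; first by rewrite leqn0 => /eqP->.
by rewrite leq_eqVlt => /orP[/eqP->//|/IH h]; have := sc_S n; lia.
Qed.

Lemma sc_lt j n : (j < n)%N -> (sc j + 4 * rho j + 2 * gf j + 1 <= sc n)%N.
Proof. by move=> /sc_mono; have := sc_S j; lia. Qed.

(** Distinct anchors come from distinct raw centres, as a centre picks a single point. The centres
    are more than [10 * rho n] apart and each moves by at most [sc n]. *)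
Lemma anc_far n y z : anc n y -> anc n (shift z y) -> z != 0 ->
  (8 * rho n + 4 * (gf n + sc n) + 1 < nrm z)%N.
Proof.
rewrite !ancE => -[c [hc [rc pc]]] [c' [hc' [rc' pc']]] z0.
have [e|ne] := eqVneq c (z + c').
  move: pc'; rewrite shift_shift -e pc => /oppr_inj cc'.
  by move: e; rewrite cc' => /eqP; rewrite -subr_eq0 opprD addrCA subrr addr0 oppr_eq0 (negPf z0).
have := raw_far (z := z + c' - c) rc; rewrite !shift_shift in rc' *.
rewrite addrC subrK subr_eq0 eq_sym => /(_ rc' ne).
have := nrmB (z + c') c; have := nrmD z c'; have := rho_ge n; lia.
Qed.

Definition fam n y : set (set (Zd d)) :=
  [set T | exists j z, [/\ (j < n)%N, anc j (shift z y) & T = thicken (atile y j z) D1]].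

Lemma lfam_sub n y : lfam (Low n y) `<=` fam n y.
Proof.
move=> T [j [z [/Low_anc[jn zn az] ->]]]; exists j, z; split=> //.
by rewrite Low_tile.
Qed.

(** The cluster bound is a hypothesis because both bounds grow in one induction: tiles of level [n]
    involve clusters of lower tiles, and clusters one level up involve tiles of level [n]. *)
Lemma nrm_tile_of n (conn_nrm : forall y e a, conn (fam n y) e a -> (nrm (a - e) <= ab n)%N) y a :
  tile n y a -> (nrm a <= 2 * rho n)%N.
Proof.
rewrite tileE => /fill_nrm h; apply: leq_trans (_ : (rho n + ab n + W <= _)%N); last by have := rho_ge n; lia.
apply: h => b [c [e re /(conn_sub (@lfam_sub _ _)) /conn_nrm ec] /(cidx_dist W0) bc].
have := nrmD (b - c) c; rewrite subrK; have := nrmD (c - e) e; rewrite subrK; lia.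
Qed.

(* A chain of lower tiles uses at most one tile of the top level, as these are far apart. *)
Lemma conn_nrm n y e a : conn (fam n y) e a -> (nrm (a - e) <= ab n)%N.
Proof.
elim: n y e a => [|n IH] y e a.
  by elim=> [|b c T _ _ [j [z []]]//]; rewrite subrr nrm0.
have tb := nrm_tile_of IH.
have thick_near z b : thicken (atile y n z) D1 b -> (nrm (b - z) <= 2 * rho n + D1)%N.
  move=> /thickenE[c /translateE /tb hc bc]; have := nrm_tri c b z; lia.
have sub : fam n y `<=` fam n.+1 y.
  by move=> T [j [z [jn az ->]]]; exists j, z; split=> //; exact: ltnW.
have {}famS T : fam n.+1 y T -> fam n y T \/ exists2 z, anc n (shift z y) & T = thicken (atile y n z) D1.
  move=> [j [z [+ az ->]]]; rewrite ltnS leq_eqVlt => /orP[/eqP jn|jn].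
    by right; exists z; rewrite -jn.
  by left; exists j, z.
have H : conn (fam n.+1 y) e a -> conn (fam n y) e a \/
  exists z, [/\ anc n (shift z y),
   exists2 b, thicken (atile y n z) D1 b & conn (fam n y) e b &
   exists2 b, thicken (atile y n z) D1 b & conn (fam n y) b a].
  elim=> [|b c T _ IHc FT Tb Tc]; first by left; exact: conn0.
  case: (famS _ FT) => [FT'|[z az Te]].
    case: IHc => [h|[z [az h [b' b'T h']]]]; first by left; exact: connS FT' Tb Tc.
    by right; exists z; split=> //; exists b' => //; exact: connS h' FT' Tb Tc.
  rewrite Te in Tb Tc; right; exists z; split=> //.
    case: IHc => [h|[z' [az' h [b' b'T h']]]]; first by exists b.
    suff <- : z' = z by [].
    apply/eqP; apply: contraT => zz'.
    have := @anc_far n (shift z y) (z' - z) az; rewrite shift_shift addrC subrK => /(_ az').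
    rewrite subr_eq0 => /(_ zz').
    have := thick_near _ _ b'T; have := thick_near _ _ Tb; have := IH _ _ _ h'.
    have := nrm_tri b' z' z; have := nrm_tri b b' z; rewrite (nrmBC z' b') (nrmBC b' b).
    have := rho_ge n; lia.
  by exists c => //; exact: conn0.
have abS := ab_S n.
move=> /H[/IH|[z [az [b Tb /IH h1] [b' Tb' /IH h2]]]]; first by lia.
have := thick_near _ _ Tb; have := thick_near _ _ Tb'.
have := nrm_tri b' a e; have := nrm_tri b b' e; have := nrm_tri z b' b.
rewrite (nrmBC z b); lia.
Qed.

Lemma nrm_tile n y a : tile n y a -> (nrm a <= 2 * rho n)%N.
Proof. exact: (nrm_tile_of (@conn_nrm n)). Qed.

Lemma nrm_atile n y z a : atile y n z a -> (nrm (a - z) <= 2 * rho n)%N.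
Proof. by move=> /translateE; exact: nrm_tile. Qed.

Lemma hull_core_nrm n y a : hull W (core n (Low n y)) a -> (nrm a <= rho n + ab n + W)%N.
Proof.
move=> [c [e re /(conn_sub (@lfam_sub _ _)) /conn_nrm ec] /(cidx_dist W0) bc].
have := nrmD (a - c) c; rewrite subrK; have := nrmD (c - e) e; rewrite subrK; lia.
Qed.

Lemma core_ball n y a : (nrm a <= rho n)%N -> core n (Low n y) a.
Proof. by move=> h; exists a => //; exact: conn0. Qed.

Lemma core_sub_tile n y : core n (Low n y) `<=` tile n y.
Proof.
move=> a ha; rewrite tileE; apply: sub_fill; exact: sub_hull.
Qed.

Lemma tile_ball n y a : (nrm a <= rho n)%N -> tile n y a.
Proof. by move=> h; apply: core_sub_tile; exact: core_ball. Qed.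

Lemma tile_aligned n y : aligned W (tile n y).
Proof. by rewrite tileE; apply: fill_aligned; exact: hull_aligned. Qed.

Lemma tile_coconnected n y : connected_set (~` tile n y).
Proof. by rewrite tileE; apply: fill_coconnected d2 => a; exact: hull_core_nrm. Qed.

Lemma tile_connected n y : connected_set (tile n y).
Proof.
elim/ltn_ind: n y => n IH y; rewrite tileE.
apply: fill_connected; [by move=> a; exact: hull_core_nrm|exact: (ltnW d2)|].
apply: hull_connected => //.
have c0 : core n (Low n y) 0 by apply: core_ball; rewrite nrm0.
suff H a : core n (Low n y) a -> reach (core n (Low n y)) 0 a.
  by move=> a b /H ha /H hb; exact: reach_trans (reach_sym ha) hb.
move=> [e re]; elim=> [|b c T eb IHc [j [z [+ Te]]] Tb Tc].
  apply: (@reach_mono _ (ball 0 (rho n))) => [b|]; first by rewrite /ball /= subr0; exact: core_ball.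
  by apply: connected_ball; rewrite /ball /= subr0 // nrm0.
move=> /[dup] la /Low_anc[jn zn az]; apply: reach_trans IHc _.
apply: (@reach_mono _ T) => [x Tx|].
  by exists e => //; apply: (connS eb _ Tb Tx); exists j, z.
rewrite Te in Tb Tc *; apply: connected_thicken => //.
rewrite Low_tile //; apply: connected_translate; exact: IH.
Qed.

Lemma tile_grid n y : grid_union (kk S) (tile n y).
Proof.
apply: grid_unionP; first exact: kk0; last 2 first.
- exact: tile_connected.
- exact: tile_coconnected.
apply: (@aligned_mul _ _ (qq S)); [exact: kk0| |exact: tile_aligned].
by have := W0; rewrite /cW muln_gt0 => /andP[].
Qed.

(** If the [D1]-neighbourhood of the lower tile meets the core, it is absorbed whole. Otherwise its
    [D]-neighbourhood misses even the hull, since rounding to cubes moves points by at most [W],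
    which is why [D1] is [D + W]; being connected, it then lies in a filled hole or outside. Tiles
    beyond the truncation radius are too far away to matter. *)
Lemma tile_dichotomy n y j z : (j < n)%N -> anc j (shift z y) ->
  thicken (atile y j z) D `<=` tile n y \/ thicken (atile y j z) D `&` tile n y = set0.
Proof.
move=> jn az; have hsc := sc_lt jn; have hr := rho_ge n.
have [zn|zn] := leqP (nrm z) (4 * rho n); last first.
  right; apply/seteqP; split=> // a [/thickenE[b /nrm_atile hb ab'] /nrm_tile ta]; exfalso.
  have := nrm_tri b a z; have := nrmB a (a - z); rewrite opprB addrC subrK; lia.
have la : (Low n y (j, z)).1 by apply/Low_anc.
have lt : ltile (Low n y) j z = atile y j z by exact: Low_tile.
have sub : thicken (atile y j z) D `<=` thicken (atile y j z) D1.
  by apply: thicken_sub; exact: leq_addr.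
have [[b [Tb [e re eb]]]|h] := pselect (exists b, thicken (atile y j z) D1 b /\ core n (Low n y) b).
  left=> a /sub Ta; apply: core_sub_tile; exists e => //.
  by apply: (connS eb _ Tb Ta); exists j, z; rewrite lt.
rewrite tileE; apply: fill_dichotomy.
  apply/connected_thicken/connected_translate/tile_connected.
apply/seteqP; split=> // a [/thickenE[b Tb ba] [c cc /(cidx_dist W0) ac]]; apply: h.
exists c; split=> //; apply/thickenE; exists b => //.
have := nrm_tri a c b; rewrite (nrmBC c a); lia.
Qed.

(** Levels are avoided from the top down. At most one tile of the highest level comes within
    [gf n + sc n] of the origin, and a jump longer than its diameter plus twice that distance
    escapes it without coming near another. The surplus [sc n] in the clearance pays for the later
    moves that avoid the lower levels. *)
Lemma ngood_ex n y : exists2 z, (nrm z <= sc n)%N & forall j z' a, (j < n)%N ->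
  anc j (shift z' y) -> atile y j z' a -> (gf j < nrm (a - z))%N.
Proof.
elim: n y => [|n IH] y; first by exists 0; rewrite ?nrm0.
pose far (c : Zd d) := forall z' a, anc n (shift z' y) -> atile y n z' a ->
  (gf n + sc n < nrm (a - c))%N.
have [c hc fc] : exists2 c, (nrm c <= 4 * rho n + 2 * (gf n + sc n) + 1)%N & far c.
  have [f0|/existsNP[z /existsNP[a /not_implyP[az /not_implyP[Ta /negP ha]]]]] := pselect (far 0).
    by exists 0; rewrite ?nrm0.
  rewrite -leqNgt subr0 in ha.
  have [v nv] := nrm_ex (4 * rho n + 2 * (gf n + sc n) + 1)%N (ltnW d2).
  exists v; first by rewrite nv.
  move=> z' a' az' Ta'; rewrite ltnNge; apply/negP => ha'.
  have h1 := nrm_atile Ta; have h2 := nrm_atile Ta'.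
  have [e|zz'] := eqVneq z' z.
    rewrite e in h2.
    have := nrm_tri a' v 0; have := nrm_tri z a' a; have := nrmD (a' - a) a.
    rewrite subrK !subr0 nv (nrmBC _ a') (nrmBC z a); lia.
  have := @anc_far n (shift z y) (z' - z) az; rewrite shift_shift addrC subrK => /(_ az').
  rewrite subr_eq0 => /(_ zz').
  have := nrm_tri a' z' z; have := nrm_tri a a' z; have := nrmB a' a.
  have := nrmD (a' - v) v; rewrite subrK nv (nrmBC z' a'); lia.
have [z hz gz] := IH (shift c y).
exists (c + z); first by have := nrmD c z; have := sc_S n; lia.
move=> j z' a; rewrite ltnS leq_eqVlt => /orP[/eqP->|jn] az' Ta.
  have := fc z' a az' Ta; have := nrm_tri (c + z) a c; rewrite [c + z - c]addrAC subrr add0r; lia.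
have := gz j (z' - c) (a - c) jn; rewrite shift_shift [c + _]addrC subrK => /(_ az').
rewrite opprD addrA; apply; apply/atile_shift.
by rewrite ![c + _]addrC !subrK.
Qed.

Lemma zpickP n y : (nrm (zpick n (Low n y)) <= sc n)%N /\ ngood n (Low n y) (zpick n (Low n y)).
Proof.
rewrite /zpick; apply: (@xgetPex _ 0 [set z | (nrm z <= sc n)%N /\ ngood n (Low n y) z]).
have [z hz gz] := ngood_ex n y; exists z; split=> // j z' a jn /Low_anc[_ zn az]; rewrite Low_tile //.
exact: gz.
Qed.

Lemma anc_free n y j z a : anc n y -> (j < n)%N -> anc j (shift z y) -> atile y j z a -> (gf j < nrm a)%N.
Proof.
rewrite ancE => -[c [hc [_ e]]] jn az Ta.
have hn := nrm_atile Ta; have hs := sc_lt jn; have hr := rho_ge n.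
have [zn|zn] := leqP (nrm (z - c)) (4 * rho n); last first.
  have := nrmB z c; have := nrm_tri a z 0; rewrite !subr0 (nrmBC z a); lia.
have [_ /(_ j (z - c) (a - c) jn)] := zpickP n (shift c y).
rewrite e opprK subrK; apply.
  by apply/Low_anc; split=> //; rewrite shift_shift [c + _]addrC subrK.
by rewrite Low_tile //; apply/atile_shift; rewrite ![c + _]addrC !subrK.
Qed.

Lemma anc_ex n y : raw n y -> exists2 z, (nrm z <= sc n)%N & anc n (shift z y).
Proof.
move=> ry; have [h _] := zpickP n y; exists (zpick n (Low n y)) => //.
rewrite ancE; exists (- zpick n (Low n y)).
by rewrite nrmN shift_shift subrr shift0 opprK.
Qed.

End Toast.

(** * Separation of tiles and places of the header cubes *)

Section ToastGeometry.
Variables (d : nat) (B : finType) (S : scales d) (r : rawseq B S).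
Notation cfg := (Zd d -> B).
Implicit Types (y : cfg) (z a v : Zd d).
Local Notation m := (mm S).
Local Notation N := (cN S).
Local Notation D := (cD S).
Local Notation rho := (rho S).
Local Notation gf := (gf S).
Local Notation sc := (sc S).
Local Notation kap := (kap S).
Local Notation Low := (low S (data r)).

Lemma N0 : (0 < N)%N.
Proof. by rewrite /cN /cN' ltn_addr // muln_gt0 kk0 nn0. Qed.

Lemma D_ge : (12 * (N + m) + 12 <= D)%N.
Proof. have := W_ge S; rewrite /cD; lia. Qed.

Lemma D_M : (D <= 2 * cM S)%N.
Proof. have := M_ge S; rewrite /cD; lia. Qed.

Lemma gf_mono j n : (j <= n)%N -> (gf j <= gf n)%N.
Proof.
elim: n => [|n IH]; first by rewrite leqn0 => /eqP->.
by rewrite leq_eqVlt => /orP[/eqP->//|/IH h]; have := gf_kap S n; have := kap_gf S n.+1; lia.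
Qed.

Lemma gf_big j : (8 * cM S <= gf j)%N.
Proof. exact: leq_trans (gf0_ge S) (gf_mono (leq0n j)). Qed.

Lemma kap_big j : (cM S + m + sc j + 2 * N < kap j)%N.
Proof.
case: j => [|j]; first exact: kap0_ge.
by have := gf_kap S j; have := gf_big j; have := D_ge; have := D_M; lia.
Qed.

Lemma gf_lt_kap j n : (j < n)%N -> (gf j + sc n + 2 * N < kap n)%N.
Proof. by case: n => // n; rewrite ltnS => /gf_mono; have := gf_kap S n; lia. Qed.

Lemma tile_dich y j z j' z' : (j < j')%N -> anc r j (shift z y) ->
  thicken (atile r y j z) D `<=` atile r y j' z' \/
  thicken (atile r y j z) D `&` atile r y j' z' = set0.
Proof.
move=> jj' az.
have az' : anc r j (shift (z - z') (shift z' y)) by rewrite shift_shift addrC subrK.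
have E a : thicken (atile r y j z) D a ->
    thicken (atile r (shift z' y) j (z - z')) D (a - z').
  move=> /thickenE[b Tb ab]; apply/thickenE; exists (b - z'); last by rewrite opprB addrA subrK.
  by apply/atile_shift; rewrite ![z' + _]addrC !subrK.
case: (tile_dichotomy jj' az') => h; [left=> a /E/h|right].
  by move=> ?; apply/translateE.
apply/seteqP; split=> // a [/E ha /translateE ha'].
by have : (thicken (atile r (shift z' y) j (z - z')) D `&` tile r j' (shift z' y)) (a - z') by []; rewrite h.
Qed.

Lemma tile_same y j z z' : anc r j (shift z y) -> anc r j (shift z' y) -> z != z' ->
  thicken (atile r y j z) D `&` atile r y j z' = set0.
Proof.
move=> az az' zz'; apply/seteqP; split=> // a [/thickenE[b /nrm_atile hb ab] /nrm_atile ha].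
have := @anc_far _ _ _ _ j (shift z y) (z' - z) az.
rewrite shift_shift addrC subrK subr_eq0 eq_sym => /(_ az' zz').
have := nrm_tri a z' z; have := nrm_tri b a z; rewrite (nrmBC z' a).
have := rho_ge S j; lia.
Qed.

Lemma thicken_disj (T T' : set (Zd d)) s q : (s + q <= D)%N -> thicken T D `&` T' = set0 ->
  thicken T s `&` thicken T' q = set0.
Proof.
move=> sq h; apply/seteqP; split=> // a [/thickenE[b Tb ab] /thickenE[c Tc ac]].
have : (thicken T D `&` T') c; last by rewrite h.
split=> //; apply/thickenE; exists b => //.
have := nrm_tri a c b; rewrite (nrmBC c a); lia.
Qed.

Lemma atile_center y j z : atile r y j z z.
Proof. by apply/translateE; rewrite subrr; apply: tile_ball; rewrite nrm0. Qed.

Definition off j y (T : set (Zd d)) := forall j' z', (j' < j)%N -> anc r j' (shift z' y) ->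
  thicken (atile r y j' z') m `&` T = set0.

Definition offL j (L : nat * Zd d -> ldata d) (T : set (Zd d)) := forall j' z', (j' < j)%N ->
  (L (j', z')).1 -> thicken (ltile L j' z') m `&` T = set0.

(** The truncated view is as good as the full one near the tile: lower tiles beyond the truncation
    radius cannot come within [m] of [T]. Hence the truncated condition does not depend on the level
    [n] from which it is viewed. *)
Lemma offLE j n y T : (j <= n)%N -> (forall a, T a -> (nrm a <= 2 * rho n)%N) ->
  offL j (Low n y) T <-> off j y T.
Proof.
move=> jn Tn; split=> h j' z' jj'; last first.
  by move=> /Low_anc[j'n zn az]; rewrite Low_tile //; exact: h.
move=> az; have [zn|zn] := leqP (nrm z') (4 * rho n).
  have j'n := leq_trans jj' jn.
  by have := h j' z' jj'; rewrite Low_tile //; apply; apply/Low_anc.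
apply/seteqP; split=> // a [/thickenE[b /nrm_atile hb ab] /Tn ha].
have := sc_lt S (leq_trans jj' jn); have := rho_ge S n; have := D_ge.
have := nrm_tri b z' a; have := nrmD (z' - a) a; rewrite subrK (nrmBC z' b) (nrmBC b a); lia.
Qed.

Definition good n (L : nat * Zd d -> ldata d) (K : set (Zd d)) v :=
  [/\ cube N v `<=` K, offL n L (cube N v) & thicken (@box1 d (cM S)) m `&` cube N v = set0].

Definition hcen j : Zd d := \row_ _ (kap j)%:Z.

(** The radius allows a shift by [sc j] away from the lower tiles and [N] for rounding to a cube.
    Tiles of level [j] or more are not consulted, so the place can be found before the level of the
    tile is known. *)
Definition hd j (L : nat * Zd d -> ldata d) : Zd d :=
  xget 0 [set v | cube N v `<=` ball (hcen j) (sc j + N) /\ offL j L (cube N v)].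

Lemma nrm_hcen j : nrm (hcen j) = kap j.
Proof.
apply/eqP; rewrite eqn_leq; apply/andP; split.
  by apply/nrm_leP => l; rewrite coordE.
by apply: leq_trans (nrm_ge _ (Ordinal (ltnW (d2 S)))); rewrite coordE.
Qed.

Lemma ball_hcen_nrm j a : ball (hcen j) (sc j + N) a -> (nrm a <= kap j + sc j + N)%N.
Proof. by rewrite /ball /= => h; have := nrmD (a - hcen j) (hcen j); rewrite subrK nrm_hcen; lia. Qed.

Lemma ball_hcen_ge j a : ball (hcen j) (sc j + N) a -> (kap j <= nrm a + sc j + N)%N.
Proof.
rewrite /ball /= => h; have := nrmB a (a - hcen j); rewrite opprB addrC subrK nrm_hcen; lia.
Qed.

Lemma off_ex j y c : exists v, cube N v `<=` ball c (sc j + N) /\ off j y (cube N v).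
Proof.
have [z zs zf] := ngood_ex r j (shift c y).
have hc := cube_cidx (c + z) N0.
exists (cidx N (c + z)); split=> [a ha|j' z' jj' az].
  rewrite /ball /=; have := cube_dist ha hc; have := nrm_tri (c + z) a c.
  rewrite [c + z - c]addrAC subrr add0r; lia.
apply/seteqP; split=> // a [/thickenE[b Tb ab] ha].
have := zf j' (z' - c) (b - c) jj'; rewrite shift_shift [c + _]addrC subrK => /(_ az).
have Tb' : atile r (shift c y) j' (z' - c) (b - c).
  by apply/atile_shift; rewrite ![c + _]addrC !subrK.
move=> /(_ Tb'); have := gf_big j'; have := D_ge; have := D_M.
have -> : b - c - z = b - (c + z) by rewrite opprD addrA.
have := nrm_tri a b (c + z); have := cube_dist ha hc; rewrite (nrmBC b a).
by move=> h1 h2 h3 h4 h5; rewrite ltnNge => /negP; apply; lia.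
Qed.

Lemma hdP n j y : (j <= n)%N -> cube N (hd j (Low n y)) `<=` ball (hcen j) (sc j + N) /\
  off j y (cube N (hd j (Low n y))).
Proof.
move=> jn.
have bd a : ball (hcen j) (sc j + N) a -> (nrm a <= 2 * rho n)%N.
  move=> /ball_hcen_nrm; have := kap_gf S j; have := gf_mono jn; have := rho_ge S n; lia.
have [h1 h2] : [set v | cube N v `<=` ball (hcen j) (sc j + N) /\ offL j (Low n y) (cube N v)]
    (hd j (Low n y)).
  rewrite /hd; apply: xgetPex; have [v [h1 h2]] := off_ex j y (hcen j).
  by exists v; split=> //; apply/(@offLE _ n) => // a /h1; exact: bd.
by split=> //; apply/(@offLE _ n) => // a /h1; exact: bd.
Qed.

Lemma hd_nrm n j y a : (j <= n)%N -> cube N (hd j (Low n y)) a -> (nrm a + m < gf j)%N.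
Proof. by move=> jn /(proj1 (hdP y jn)) /ball_hcen_nrm; have := kap_gf S j; lia. Qed.

Lemma hd_ge n j y a : (j <= n)%N -> cube N (hd j (Low n y)) a ->
  (kap j <= nrm a + sc j + N)%N.
Proof. by move=> jn /(proj1 (hdP y jn)) /ball_hcen_ge. Qed.

Lemma box1_nrm n a : @box1 d n a -> (nrm a <= n)%N.
Proof. by move=> /box1P h; apply/nrm_leP => j; have := h j; lia. Qed.

(** Tiles of level below [j] are avoided by the choice of the place; those of levels [j] to [n - 1]
    because header [j] lies within [gf j] of the anchor, where they do not reach. The marker ends
    before [kap j]. *)
Lemma hd_good n j y : anc r n y -> (j <= n)%N ->
  good n (Low n y) (tile r n y) (hd j (Low n y)).
Proof.
move=> an jn; have rn := rho_ge S n; have gn := gf_mono jn; split.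
- move=> a /(hd_nrm jn) h; apply: tile_ball; lia.
- apply/offLE => // [a /(hd_nrm jn)|j' z' j'n az]; first by lia.
  have [j'j|jj'] := ltnP j' j; first exact: (proj2 (hdP y jn)).
  apply/seteqP; split=> // a [/thickenE[b Tb ab] /(hd_nrm jn) ha].
  have := anc_free an j'n az Tb; have := nrm_tri a b 0; rewrite !subr0 (nrmBC b a).
  have := gf_mono jj'; lia.
- apply/seteqP; split=> // a [/thickenE[b /box1_nrm hb ab] /(hd_ge jn) ha].
  have := nrmD (a - b) b; rewrite subrK; have := kap_big j; lia.
Qed.

Lemma hd_inj n y j j' : (j <= n)%N -> (j' <= n)%N ->
  hd j (Low n y) = hd j' (Low n y) -> j = j'.
Proof.
suff H i i' : (i < i')%N -> (i' <= n)%N -> hd i (Low n y) <> hd i' (Low n y).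
  by move=> jn j'n e; have [/H/(_ j'n)|/H/(_ jn)|//] := ltngtP j j'; rewrite e.
move=> ii' i'n e.
have [a ha] : exists a, cube N (hd i (Low n y)) a.
  exists (N%:Z *: hd i (Low n y) + \row_ _ 1) => l.
  by rewrite coordE coordZ coord_row; have := N0; lia.
have := hd_nrm (leq_trans (ltnW ii') i'n) ha; rewrite e in ha; have := hd_ge i'n ha.
have := gf_lt_kap ii'; lia.
Qed.

End ToastGeometry.

(** * Patterns on tiles *)

Section FiniteGluing.
Variables (d : nat) (A : finType) (X : set (Zd d -> A)) (k m : nat).
Variable P : set (Zd d) -> set (Zd d -> option A).
Hypothesis PF : property_F X k P m.

Lemma glue_seq (I : eqType) (l : seq I) (Sf : I -> set (Zd d)) (cf : I -> Zd d -> option A)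
    (K : set (Zd d)) :
  grid_union k K -> uniq l ->
  (forall i, i \in l -> [/\ grid_union k (Sf i), P (Sf i) (cf i) & thicken (Sf i) m `<=` K]) ->
  (forall i j, i \in l -> j \in l -> i != j -> thicken (Sf i) m `&` thicken (Sf j) m = set0) ->
  exists2 c, P K c & forall i a, i \in l -> Sf i a -> c a = cf i a.
Proof.
move=> gK ul hl dl.
have mem (o : 'I_(size l)) : tnth (in_tuple l) o \in l by exact: mem_tnth.
have inj : injective (tnth (in_tuple l)) by apply/tuple_uniqP.
have [||||c Pc hc] := (proj1 PF) K (size l) (fun o => Sf (tnth (in_tuple l) o))
  (fun o => cf (tnth (in_tuple l) o)) gK.
- by move=> o; have [] := hl _ (mem o).
- by move=> o; have [] := hl _ (mem o).
- by move=> o o' oo'; apply: dl; rewrite ?(inj_eq inj).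
- by move=> o; have [] := hl _ (mem o).
exists c => // i a /(tnthP (in_tuple l)) [i0 ->]; exact: hc.
Qed.

End FiniteGluing.

Section Code.
Variables (d : nat) (A B : finType) (S : scales d) (r : rawseq B S).
Notation cfg := (Zd d -> B).
Implicit Types (y : cfg) (z a v : Zd d) (L : nat * Zd d -> ldata d) (K : set (Zd d)).
Local Notation m := (mm S).
Local Notation N := (cN S).
Local Notation N' := (cN' S).
Local Notation M := (cM S).
Local Notation rho := (rho S).
Local Notation Low := (low S (data r)).

Definition sym (nc : nat) := ({ffun 'rV['I_N]_d -> B} * bool + option 'I_nc)%type.

(* What is needed from the entropy gap: a marker [cmark], and code words [cword s] that do not occur in
   it. *)
Record coding (X : set (Zd d -> A)) (P : set (Zd d) -> set (Zd d -> option A))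
    (Y : set cfg) (nc : nat) := Coding {
  cmark : Zd d -> option A;
  cword : sym nc -> Zd d -> option A;
  cvalid : sym nc -> Prop := fun s => if s is inl (q, _) then
    exists2 y, Y y & forall i, y (boxpt i) = q i else True;
  card_B : (#|B| <= 2 ^ cb S)%N;
  c_fam : pattern_family X (kk S) P;
  c_F : property_F X (kk S) P m;
  c_inv : shift_invariant Y;
  mark_P : P (box1 M) cmark;
  mark_aper : forall u : Zd d, u != 0 -> (nrm u <= 2 * N + m)%N ->
    exists a, [/\ @box1 d M a, @box1 d M (u + a) & cmark a <> cmark (u + a)];
  word_P : forall s, cvalid s -> P (box1 N') (cword s);
  word_inj : forall s s', cvalid s -> cvalid s' ->
    (forall a, @box1 d N' a -> cword s a = cword s' a) -> s = s';
  word_mark : forall s o, cvalid s -> ~ (forall a, @box1 d N' a -> cmark (o + a) = cword s a) }.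

Variables (X : set (Zd d -> A)) (P : set (Zd d) -> set (Zd d -> option A)) (Y : set cfg) (nc : nat).
Variables (cd : coding X P Y nc) (col : 'I_nc).
Local Notation mark := (cmark cd).
Local Notation word := (cword cd).

(** Moved by [cstart v], the box of side [N'] sits in cube [v] with a margin of [m] on every side,
    so code words in distinct cubes can be glued. *)
Definition cstart v : Zd d := N%:Z *: v + \row_ _ m%:Z.

Definition isdata n L K v := good S n L K v /\ forall j, (j <= n)%N -> v <> hd S j L.

(** The sites a tile must store in spare bits: it answers for its [N + m]-neighbourhood, except for
    data cubes, which store themselves, and for sites that close to a lower tile, which are that
    tile's business. *)
Definition ring n L K : set (Zd d) :=
  [set a | [/\ thicken K (N + m) a, ~ (exists2 v, isdata n L K v & cube N v a) &
    ~ exists j z, (L (j, z)).1 /\ thicken (ltile L j z) (N + m) a]].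

(** One bit per point of [G] determines [y] on [E]. The encoder [enc] is selected from [G] and [E]
    alone, so equal tiles are read with equal encoders. *)
Definition encP (G E : set (Zd d)) (e : cfg -> Zd d -> bool) :=
  forall y y', (forall v, G v -> e y v = e y' v) -> forall a, E a -> y a = y' a.

Definition enc (G E : set (Zd d)) : cfg -> Zd d -> bool := xget (fun _ _ => false) [set e | encP G E e].

(* Header cubes carry [inr]: [None] at the cubes number [j < n] and the colour at number [n]; the others
   carry the pattern of [y] on the cube and one bit of the encoding of [y] on [ring]. *)
Definition symb n L K y v : sym nc :=
  if asbool (exists2 j, (j <= n)%N & v = hd S j L) then inr (if v == hd S n L then Some col else None)
  else inl ([ffun i => y (N%:Z *: v + boxpt i)], enc (isdata n L K) (ring n L K) y v).

Definition spec n L K (pl : nat * Zd d -> Zd d -> option A) y (c : Zd d -> option A) :=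
  [/\ P K c,
     forall j z, (L (j, z)).1 -> ltile L j z `<=` K ->
       forall a, ltile L j z a -> c a = pl (j, z) (a - z),
     forall a, box1 M a -> c a = mark a &
     forall v, good S n L K v -> forall a, box1 N' a -> c (cstart v + a) = word (symb n L K y v) a].

Definition patF n L pl y : Zd d -> option A := xget (fun=> None) [set c | spec n L (tileF S n L) pl y c].

Definition plow (lo : nat -> cfg -> Zd d -> option A) n y (p : nat * Zd d) : Zd d -> option A :=
  if p \in trunc S n then lo p.1 (shift p.2 y) else fun=> None.

(** Reading [y] in a finite window keeps the number of values countable, as [bfun] requires; [y 0]
    is an arbitrary filler in the absence of a distinguished symbol. *)
Definition ytr n y : cfg := fun a => if (nrm a <= 4 * rho n)%N then y a else y 0.

Fixpoint ptow n : nat -> cfg -> Zd d -> option A :=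
  if n is n'.+1 then fun j y => if j == n' then patF n' (Low n' y) (plow (ptow n') n' y) (ytr n' y)
    else ptow n' j y
  else fun _ _ => fun=> None.

Definition pat n := ptow n.+1 n.

Lemma ptow_pat n j : (j < n)%N -> ptow n j = pat j.
Proof.
elim: n => // n IH; rewrite ltnS leq_eqVlt => /orP[/eqP->//|jn].
by apply/funext => y /=; rewrite (ltn_eqF jn) IH.
Qed.

Lemma patE n y : pat n y = patF n (Low n y) (plow pat n y) (ytr n y).
Proof.
rewrite /pat /= eqxx; congr patF; apply/funext => -[j z]; rewrite /plow mem_trunc.
by case: ifP => // /andP[/ptow_pat->].
Qed.

Lemma bfun_ytr n : bfun (ytr n).
Proof.
have := bfun_comp2 (fun (f : Zd d -> option B) (b : B) a => odflt b (f a))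
  (bfun_fin (zball d (4 * rho n)) (fun=> None) (fun a => bfun_comp Some (bfun_eval a))) (bfun_eval 0).
congr bfun; apply/funext => y; apply/funext => a; rewrite mem_zball /ytr.
by case: ifP.
Qed.

Lemma bfun_pat n : bfun (pat n).
Proof.
elim/ltn_ind: n => n IH.
have hL : bfun (Low n) by apply: bfun_low => j _; exact: bfun_data.
have hP : bfun (plow pat n).
  have H p : bfun (fun y => if (p.1 < n)%N then pat p.1 (shift p.2 y) else (fun=> None)).
    have [pn|_] := boolP (p.1 < n)%N; last exact: bfun_cst.
    exact: (bfun_shift p.2 (IH _ pn)).
  have := bfun_fin (trunc S n) (fun=> (fun=> None)) H; congr bfun.
  apply/funext => y; apply/funext => -[j z]; rewrite /plow mem_trunc.
  by case: ifP => // /andP[/= ->].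
have := bfun_comp (fun q => patF n q.1.1 q.1.2 q.2) (bfun_pair (bfun_pair hL hP) (bfun_ytr n)).
by congr bfun; apply/funext => y; rewrite patE.
Qed.

End Code.

Section PatternExistence.
Variables (d : nat) (A B : finType) (S : scales d) (r : rawseq B S).
Notation cfg := (Zd d -> B).
Variables (X : set (Zd d -> A)) (P : set (Zd d) -> set (Zd d -> option A)) (Y : set cfg) (nc : nat).
Variables (cd : coding S X P Y nc) (col : 'I_nc).
Implicit Types (y : cfg) (z a v : Zd d).
Local Notation m := (mm S).
Local Notation N := (cN S).
Local Notation N' := (cN' S).
Local Notation M := (cM S).
Local Notation D := (cD S).
Local Notation rho := (rho S).
Local Notation Low := (low S (data r)).
Local Notation mark := (cmark cd).
Local Notation word := (cword cd).
Local Notation valid := (cvalid cd).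
Local Notation pat := (pat r cd col).
Local Notation anc := (anc r).
Local Notation tile := (tile r).
Local Notation atile := (atile r).
Local Notation symb := (symb S col).
Local Notation cstart := (cstart S).

Lemma cube_shift v a : @box1 d N a -> cube N v (N%:Z *: v + a).
Proof. by move=> /box1P h j; rewrite coordD coordZ; have := h j; lia. Qed.

Lemma box1_boxpt n (i : 'rV['I_n]_d) : @box1 d n (boxpt i).
Proof. by apply/box1P => j; rewrite coordE; case: (i ord0 j) => x hx /=; lia. Qed.

Lemma boxpt_ex n a : @box1 d n a -> exists i : 'rV['I_n]_d, a = boxpt i.
Proof.
move=> /box1P h.
have hj j : (absz (a ord0 j - 1)%R < n)%N by have := h j; lia.
exists (\row_j Ordinal (hj j)); apply: zdP => j; rewrite coordE mxE /=; have := h j; lia.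
Qed.

Lemma thick_code v : thicken (translate (@box1 d N') (cstart v)) m `<=` cube N v.
Proof.
move=> a /thickenE[b /translateE /box1P hb /nrm_leP hab] j.
have := hb j; have := hab j; rewrite /cstart !coordE /cN; lia.
Qed.

Lemma code_cube v a : @box1 d N' a -> cube N v (cstart v + a).
Proof.
by move=> ha; apply/thick_code/sub_thicken/translateE; rewrite addrAC subrr add0r.
Qed.

Lemma ytr_id n y a : (nrm a <= 4 * rho n)%N -> ytr S n y a = y a.
Proof. by rewrite /ytr => ->. Qed.

Lemma good_nrm n y v a : good S n (Low n y) (tile n y) v -> cube N v a -> (nrm a <= 2 * rho n)%N.
Proof. by move=> [h _ _] /h /nrm_tile. Qed.

Lemma good_v n y v : good S n (Low n y) (tile n y) v -> (nrm v <= (2 * rho n).+1)%N.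
Proof.
move=> gv; have one : @box1 d N (\row_ _ 1) by apply/box1P => j; rewrite coordE; have := N0 S; lia.
have /nrm_leP h := good_nrm gv (cube_shift v one).
apply/nrm_leP => j; have := h j; have := N0 S; rewrite !coordE.
set x := v ord0 j; clearbody x; move: (cN S) (rho n) => N1 R N10 hx.
have : `|x| <= `|N1%:Z * x| by rewrite normrM; nia.
lia.
Qed.

Lemma symb_valid n y v : Y y -> good S n (Low n y) (tile n y) v ->
  valid (symb n (Low n y) (tile n y) (ytr S n y) v).
Proof.
move=> Yy gv; rewrite /symb /cvalid; case: ifP => // _.
exists (shift (N%:Z *: v) y); first exact: (c_inv cd).
move=> i; rewrite ffunE ytr_id //.
have := good_nrm gv (cube_shift v (box1_boxpt i)); lia.
Qed.

Local Notation Spec n y := (spec cd col n (Low n y) (tile n y) (plow S pat n y) (ytr S n y)).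

Lemma spec_agree y j z j' z' a : Spec j' (shift z' y) (pat j' (shift z' y)) ->
  (j < j')%N -> anc j (shift z y) -> atile y j z `<=` atile y j' z' -> atile y j z a ->
  pat j' (shift z' y) (a - z') = pat j (shift z y) (a - z).
Proof.
move=> [_ + _ _] jj' az sub Ta.
have zz' : (nrm (z - z') <= 4 * rho j')%N.
  have := nrm_atile (sub _ (atile_center r y j z)); lia.
have az' : anc j (shift (z - z') (shift z' y)) by rewrite shift_shift addrC subrK.
have e b : atile (shift z' y) j (z - z') b <-> atile y j z (z' + b).
  by have := atile_shift r z' y j (z - z') b; rewrite [z' + (z - z')]addrC subrK.
move=> /(_ j (z - z')); rewrite Low_tile // => /(_ _ _ (a - z')) ->.
- by rewrite /plow mem_trunc jj' zz' /= shift_shift [z' + _]addrC subrK opprB addrA subrK.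
- by apply/Low_anc.
- by move=> b /e /sub /translateE; rewrite addrAC subrr add0r.
- by apply/e; rewrite addrC subrK.
Qed.

Definition low_in n y (p : nat * Zd d) :=
  [/\ p \in trunc S n, anc p.1 (shift p.2 y) & atile y p.1 p.2 `<=` tile n y].

(** Gluing needs disjoint pieces, so only lower tiles not contained in an intermediate one are
    glued; the others come along inside these. *)
Definition low_max n y p := low_in n y p /\
  forall p', low_in n y p' -> (p.1 < p'.1)%N -> ~ (atile y p.1 p.2 `<=` atile y p'.1 p'.2).

Lemma low_max_ex n y p : low_in n y p -> exists2 p', low_max n y p' &
  p' = p \/ ((p.1 < p'.1)%N /\ atile y p.1 p.2 `<=` atile y p'.1 p'.2).
Proof.
have [s ps] : exists s, (n - p.1 <= s)%N by exists (n - p.1)%N.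
elim: s p ps => [|s IH] p ps lp.
  by case: lp => + _ _; case: p ps => j z /=; rewrite mem_trunc; lia.
have [[p' [lp' [pp' sub]]]|h] := pselect (exists p', low_in n y p' /\
  ((p.1 < p'.1)%N /\ atile y p.1 p.2 `<=` atile y p'.1 p'.2)); last first.
  by exists p; [split=> // p' lp' pp' sub; apply: h; exists p'|left].
have [|q mq hq] := IH p' _ lp'; first by lia.
exists q => //; right; case: hq => [->//|[p'q sub']]; split; first exact: ltn_trans pp' p'q.
exact: subset_trans sub sub'.
Qed.

Lemma low_thick n y p : low_in n y p -> thicken (atile y p.1 p.2) m `<=` tile n y.
Proof.
case: p => j z [/=]; rewrite mem_trunc => /andP[jn zn] az sub.
have mD : (m <= D)%N by have := D_ge S; lia.
case: (tile_dichotomy jn az) => h; first exact: subset_trans (thicken_sub mD) h.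
have Tz := atile_center r y j z.
by have : (thicken (atile y j z) D `&` tile n y) z; [split; [exact: sub_thicken|exact: sub]|rewrite h].
Qed.

Lemma low_disj n y p p' : low_max n y p -> low_max n y p' -> p != p' ->
  thicken (atile y p.1 p.2) m `&` thicken (atile y p'.1 p'.2) m = set0.
Proof.
have mD : (m + m <= D)%N by have := D_ge S; lia.
have H q q' : low_max n y q -> low_max n y q' -> (q.1 < q'.1)%N ->
    thicken (atile y q.1 q.2) m `&` thicken (atile y q'.1 q'.2) m = set0.
  move=> [[_ aq _] mq] [lq' _] qq'; apply: thicken_disj mD _.
  case: (tile_dich q'.2 qq' aq) => // h; case: (mq _ lq' qq').
  exact: subset_trans (@sub_thicken _ _ _) h.
move=> mp mp' pp'; have [lt|lt|e] := ltngtP p.1 p'.1; first exact: H.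
  by rewrite setIC; exact: H.
apply: thicken_disj mD _; case: mp mp' => [[_ ap _] _] [[_ ap' _] _].
rewrite -e in ap' *; apply: tile_same => //.
by apply: contraNneq pp' => e'; case: p p' e e' {ap ap'} => j z [j' z'] /= -> ->.
Qed.

Lemma pat_spec n y : Y y -> anc n y -> Spec n y (pat n y).
Proof.
elim/ltn_ind: n y => n IH y Yy an; rewrite patE /patF -tileE.
apply: (@xgetPex _ _ [set c | Spec n y c]).
have gK : grid_union (kk S) (tile n y) by exact: tile_grid.
have [rn gn] := (rho_ge S n, gf_big S n).
have DM := D_M S; have Dge := D_ge S; have Mge := M_ge S; have Wge := W_ge S.
pose K := tile n y.
pose Sf (i : option (Zd d) + nat * Zd d) : set (Zd d) := match i with
  | inl None => @box1 d M | inl (Some v) => translate (@box1 d N') (cstart v)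
  | inr p => atile y p.1 p.2 end.
pose cf (i : option (Zd d) + nat * Zd d) : Zd d -> option A := match i with
  | inl None => mark
  | inl (Some v) => tpat (word (symb n (Low n y) K (ytr S n y) v)) (cstart v)
  | inr p => tpat (pat p.1 (shift p.2 y)) p.2 end.
pose ok (i : option (Zd d) + nat * Zd d) : Prop := match i with
  | inl None => True | inl (Some v) => good S n (Low n y) K v | inr p => low_max n y p end.
pose l0 := inl None :: [seq inl (Some v) | v <- zball d (2 * rho n).+1] ++ [seq inr p | p <- trunc S n].
pose l : seq (option (Zd d) + nat * Zd d) := [seq i <- undup l0 | `[<ok i>]].
have lok i : i \in l -> ok i by rewrite mem_filter => /andP[/asboolP].
have okl i : ok i -> i \in l.
  move=> oi; rewrite mem_filter; apply/andP; split; first exact/asboolP.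
  rewrite mem_undup inE; case: i oi => [[v|]|p] //= oi; rewrite mem_cat.
    apply/orP; left; apply/mapP; exists v => //; rewrite mem_zball.
    exact: (good_v oi).
  by apply/orP; right; apply/mapP; exists p => //; case: oi => -[].
have hl i : i \in l -> [/\ grid_union (kk S) (Sf i), P (Sf i) (cf i) & thicken (Sf i) m `<=` K].
  move=> /lok; case: i => [[v|]|p] /= oi.
  - split.
    + by apply: grid_union_translate; apply: grid_union_box; [exact: d2|exact: kk0].
    + apply: (proj1 ((c_fam cd).2 _ _ _ _)); first by apply: grid_union_box; [exact: d2|exact: kk0].
      by apply: word_P; exact: symb_valid.
    + by move=> a /thick_code; case: oi => + _ _; apply.
  - split; first by apply: grid_union_box; [exact: d2|exact: kk0].
      exact: mark_P.
    move=> a /thickenE[b /box1_nrm hb ab]; apply: tile_ball.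
    have := nrmD (a - b) b; rewrite subrK; lia.
  - split; first by apply: grid_union_translate; exact: tile_grid.
      have pn : (p.1 < n)%N by case: oi => -[+ _ _] _; case: p => j z; rewrite mem_trunc => /andP[].
      have ap : anc p.1 (shift p.2 y) by case: oi => -[].
      apply: (proj1 ((c_fam cd).2 _ _ _ _)); first exact: tile_grid.
      by have [] := IH _ pn (shift p.2 y) (c_inv cd _ Yy) ap.
    by apply: low_thick; case: oi.
have dl i j : i \in l -> j \in l -> i != j -> thicken (Sf i) m `&` thicken (Sf j) m = set0.
  have mK p a : low_max n y p -> thicken (atile y p.1 p.2) m a -> (8 * M < nrm a + m)%N.
    case: p => j' z [[/=]]; rewrite mem_trunc => /andP[jn _] ap _ _ /thickenE[b Tb ab].
    have := anc_free an jn ap Tb; have := gf_big S j'; have := nrm_tri a b 0.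
    rewrite !subr0 (nrmBC b a); lia.
  have mk_t p : low_max n y p -> thicken (@box1 d M) m `&` thicken (atile y p.1 p.2) m = set0.
    move=> mp; apply/seteqP; split=> // a [/thickenE[b /box1_nrm hb ab] /(mK _ _ mp)].
    have := nrmD (a - b) b; rewrite subrK; lia.
  have mk_c v : good S n (Low n y) K v ->
      thicken (@box1 d M) m `&` thicken (translate (@box1 d N') (cstart v)) m = set0.
    by move=> [_ _ h]; apply/seteqP; split=> // a [h1 /thick_code h2]; rewrite -h.
  have c_t v p : good S n (Low n y) K v -> low_max n y p ->
      thicken (translate (@box1 d N') (cstart v)) m `&` thicken (atile y p.1 p.2) m = set0.
    case: p => j' z [_ h _] [[/=]]; rewrite mem_trunc => /andP[jn zn] ap _ _.
    apply/seteqP; split=> // a [/thick_code h1 h2]; rewrite -(h j' z jn); last exact/Low_anc.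
    by rewrite Low_tile.
  have c_c v v' : v != v' -> thicken (translate (@box1 d N') (cstart v)) m `&`
      thicken (translate (@box1 d N') (cstart v')) m = set0.
    move=> vv'; apply/seteqP; split=> // a [/thick_code /(cubeE _ _ (N0 S)) h1].
    by move=> /thick_code /(cubeE _ _ (N0 S)) h2; move: vv'; rewrite -h1 -h2 eqxx.
  move=> /lok + /lok; case: i j => [[v|]|p] [[v'|]|p'] //= oi oj ij.
  - by apply: c_c; apply: contraNneq ij => ->.
  - by rewrite setIC; exact: mk_c.
  - exact: c_t.
  - exact: mk_c.
  - exact: mk_t.
  - by rewrite setIC; exact: c_t.
  - by rewrite setIC; exact: mk_t.
  - by apply: (low_disj oi oj); apply: contraNneq ij => ->.
have [c Pc hc] := glue_seq (c_F cd) gK (filter_uniq _ (undup_uniq l0)) hl dl.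
exists c; split=> //.
(* A lower tile that is not maximal sits in a maximal one, whose pattern extends its own by the
   induction hypothesis. *)
- move=> j z /Low_anc[jn zn az]; rewrite Low_tile // => sub a Ta.
  have lp : low_in n y (j, z) by split=> //; rewrite mem_trunc jn.
  have [p' mp' h] := low_max_ex lp.
  have hc' b := hc (inr p') b (okl (inr p') mp').
  rewrite /plow mem_trunc jn zn /=.
  case: h => [e|[/= pp' sub']]; first by rewrite (hc' a) e.
  rewrite (hc' a); last exact: sub'.
  have pn : (p'.1 < n)%N by case: mp' => -[+ _ _] _; case: (p') => j' z'; rewrite mem_trunc => /andP[].
  have ap : anc p'.1 (shift p'.2 y) by case: mp' => -[].
  exact: (spec_agree (IH _ pn (shift p'.2 y) (c_inv cd _ Yy) ap) pp' az sub' Ta).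
- by move=> a ha; exact: (hc (inl None) a (okl (inl None) I)).
- move=> v gv a ha; rewrite (hc (inl (Some v)) _ (okl (inl (Some v)) gv)) /= /tpat.
    by rewrite [cstart v + a]addrC addrK.
  by apply/translateE; rewrite [cstart v + a]addrC addrK.
Qed.

End PatternExistence.

Lemma card_injection (T1 T2 : finType) : (#|T1| <= #|T2|)%N -> exists f : T1 -> T2, injective f.
Proof.
move=> h; exists (fun x => enum_val (widen_ord h (enum_rank x))).
by move=> x x' /enum_val_inj /(congr1 val) /= /val_inj /enum_rank_inj.
Qed.

(** Counting: there are at most [2 ^ (cb * size es)] patterns on [es], and [2 ^ size gs] bit strings
    on [gs]. *)
Lemma enc_exists (d : nat) (B : finType) (cb : nat) (G E : set (Zd d)) (gs es : seq (Zd d)) :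
  (#|B| <= 2 ^ cb)%N -> uniq gs -> (forall v, v \in gs -> G v) -> (forall a, E a -> a \in es) ->
  (cb * size es <= size gs)%N -> exists e : (Zd d -> B) -> Zd d -> bool, encP G E e.
Proof.
move=> hB ug gG Ee hs.
have [phi inj] : exists phi : {ffun 'I_(size es) -> B} -> {ffun 'I_(size gs) -> bool}, injective phi.
  apply: card_injection; rewrite !card_ffun !card_ord card_bool.
  have [->|s0] := posnP (size es); first by rewrite expn0 expn_gt0.
  apply: leq_trans (_ : ((2 ^ cb) ^ size es <= _)%N); first by rewrite leq_exp2r.
  by rewrite -expnM leq_exp2l.
pose F (y : Zd d -> B) := [ffun i : 'I_(size es) => y (tnth (in_tuple es) i)].
exists (fun y v => if insub (index v gs) is Some i then phi (F y) i else false).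
move=> y y' h a /Ee /(tnthP (in_tuple es)) [i ->].
suff /inj /ffunP /(_ i) : phi (F y) = phi (F y') by rewrite !ffunE.
apply/ffunP => o; have := h _ (gG _ (mem_tnth o (in_tuple gs))).
have -> : index (tnth (in_tuple gs) o) gs = o.
  by rewrite (tnth_nth 0) /= index_uniq.
by rewrite valK.
Qed.

(** * Storage capacity of a tile *)

Section Capacity.
Variables (d : nat) (B : finType) (S : scales d) (r : rawseq B S).
Notation cfg := (Zd d -> B).
Implicit Types (y : cfg) (z a v : Zd d).
Local Notation N := (cN S).
Local Notation W := (cW S).
Local Notation rho := (rho S).
Local Notation gf := (gf S).
Local Notation sc := (sc S).
Local Notation Low := (low S (data r)).
Local Notation tile := (tile r).

Lemma isdata_intro n y v : cube N v `<=` tile n y -> offL S n (Low n y) (cube N v) ->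
  (forall a, cube N v a -> (gf n < nrm a)%N) -> isdata S n (Low n y) (tile n y) v.
Proof.
move=> h1 h2 h3; split=> [|j jn e].
  split=> //; apply/seteqP; split=> // a [/thickenE[b /box1_nrm hb ab] /h3].
  have := nrmD (a - b) b; rewrite subrK; have := gf_big S n; have := D_ge S; have := D_M S; lia.
have hc : cube N v (N%:Z *: v + \row_ _ 1).
  by apply: cube_shift; apply/box1P => l; rewrite coordE; have := N0 S; lia.
have := h3 _ hc; rewrite e in hc; have := hd_nrm jn hc; rewrite -e.
have := gf_mono S jn; lia.
Qed.

(** The centres [c u] form a grid of mesh [2 * s + 1] in the positive orthant beyond [gf n], clear
    of marker and headers. The balls of radius [s] around them are disjoint, and each contains a
    cube off the lower tiles. *)
Lemma data_many n y : exists gs : seq (Zd d),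
  [/\ uniq gs, size gs = (qn S n ^ d)%N & forall v, v \in gs -> isdata S n (Low n y) (tile n y) v].
Proof.
pose s := (sc n + N)%N.
pose c (u : 'rV['I_(qn S n)]_d) : Zd d :=
  \row_l (gf n + s + 1 + (2 * s + 1) * nat_of_ord (u ord0 l))%N%:Z.
pose v u := projT1 (cid (off_ex r n y (c u))).
have vP u : cube N (v u) `<=` ball (c u) s /\ off r n y (cube N (v u)).
  exact: (projT2 (cid (off_ex r n y (c u)))).
have bnd u a l : ball (c u) s a ->
    (gf n + (2 * s + 1) * nat_of_ord (u ord0 l))%N%:Z < a ord0 l <=
    (gf n + (2 * s + 1) * (nat_of_ord (u ord0 l)).+1)%N%:Z.
  by move=> /nrm_leP/(_ l); rewrite !coordE; nia.
have l0 := Ordinal (ltnW (d2 S)).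
exists [seq v u | u : 'rV['I_(qn S n)]_d]; split.
- rewrite map_inj_uniq ?enum_uniq // => u u' e; apply/rowP => l.
  have hc : cube N (v u) (N%:Z *: v u + \row_ _ 1).
    by apply: cube_shift; apply/box1P => i; rewrite coordE; have := N0 S; lia.
  have := bnd u _ l ((vP u).1 _ hc); rewrite e in hc *; have := bnd u' _ l ((vP u').1 _ hc).
  by move=> h1 h2; apply/val_inj => /=; move: h1 h2; case: (u _ l) (u' _ l) => i hi [i' hi'] /=; nia.
- by rewrite size_map -cardE card_mx card_ord mul1n.
move=> _ /mapP[u _ ->]; have qr := qn_rho S n.
have big a l : ball (c u) s a -> (gf n)%:Z < a ord0 l <= (rho n)%:Z.
  move=> h0; have := bnd u a l h0; case: (u _ l) => i hi /= h.
  have : ((2 * s + 1) * i.+1 <= (2 * s + 1) * (qn S n).+1)%N by rewrite leq_mul2l; lia.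
  move: h qr; rewrite -/s; lia.
have small a : ball (c u) s a -> (nrm a <= rho n)%N.
  by move=> h; apply/nrm_leP => l; have := big a l h; lia.
apply: isdata_intro.
- by move=> a /(vP u).1 /small; exact: tile_ball.
- apply/offLE => //; last exact: (vP u).2.
  by move=> a /(vP u).1 /small; lia.
- move=> a /(vP u).1 h; have := big a l0 h; have := nrm_ge a l0; lia.
Qed.

(** A site of norm between [gf n + N] and [rho n - N] has its whole cube in the tile and away from
    the headers, so it is in a data cube or close to a lower tile. Only an outer shell and an inner
    ball remain. *)
Lemma ring_few n y : exists2 es : seq (Zd d), forall a, ring S n (Low n y) (tile n y) a -> a \in es &
  size es = ((2 * (rho n + ab S n + 2 * W)).+1 ^ d - (2 * (rho n - N)).+1 ^ d + (2 * (gf n + N)).+1 ^ d)%N.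
Proof.
set R := (rho n + ab S n + 2 * W)%N.
have rR : (rho n - N <= R)%N by rewrite /R; lia.
pose p (a : Zd d) := (nrm a <= rho n - N)%N.
exists ([seq a <- zball d R | predC p a] ++ zball d (gf n + N)); last first.
  rewrite size_cat size_zball; congr addn; rewrite size_filter -!size_zball -(count_predC p).
  rewrite -[X in (_ = X + _ - _)%N]size_filter (perm_size (_ : perm_eq _ (zball d (rho n - N)))) ?addKn //.
  apply: uniq_perm; [exact/filter_uniq/zball_uniq|exact: zball_uniq|].
  by move=> a; rewrite mem_filter !mem_zball; apply/andP/idP => [[]//|h]; split=> //; exact: leq_trans h rR.
move=> a [/thickenE[b Tb ab'] nd nl]; rewrite mem_cat mem_filter !mem_zball /= /p.
have aR : (nrm a <= R)%N.
  have hb : (nrm b <= rho n + ab S n + W)%N.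
    by move: Tb; rewrite tileE => /fill_nrm; apply => x; exact: hull_core_nrm.
  have := nrmD (a - b) b; rewrite subrK /R; have := W_ge S; lia.
rewrite aR andbT; case: leqP => //= ha.
rewrite leqNgt; apply/negP => ag; apply: nd; exists (cidx N a); last exact: (cube_cidx _ (N0 S)).
have near x : cube N (cidx N a) x -> (nrm (x - a) <= N)%N.
  by move=> hx; exact: cube_dist hx (cube_cidx _ (N0 S)).
have rn := rho_ge S n; have Wn := W_ge S.
apply: isdata_intro.
- move=> x /near hx; apply: tile_ball; have := nrmD (x - a) a; rewrite subrK; lia.
- move=> j z jn lz; apply/seteqP; split=> // x [/thickenE[c Tc xc] /near hx]; apply: nl.
  exists j, z; split=> //; apply/thickenE; exists c => //.
  have := nrm_tri x a c; rewrite (nrmBC a x); lia.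
- move=> x /near hx; have := nrmD (a - x) x; rewrite subrK (nrmBC a x); lia.
Qed.

Lemma encP_enc n y : (#|B| <= 2 ^ cb S)%N ->
  encP (B := B) (isdata S n (Low n y) (tile n y)) (ring S n (Low n y) (tile n y))
    (enc (isdata S n (Low n y) (tile n y)) (ring S n (Low n y) (tile n y))).
Proof.
move=> hB; set G := isdata _ _ _ _; set E := ring _ _ _ _.
apply: (@xgetPex _ _ [set e : cfg -> Zd d -> bool | encP G E e]).
have [gs [ug sg gG]] := data_many n y; have [es eE se] := ring_few n y.
by apply: (enc_exists hB ug gG eE); rewrite se sg; exact: cap.
Qed.

End Capacity.

(** * The factor map and its markers *)

Section FactorMap.
Variables (d : nat) (A B : finType) (S : scales d) (r : rawseq B S).
Notation cfg := (Zd d -> B).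
Variables (X : set (Zd d -> A)) (P : set (Zd d) -> set (Zd d -> option A)) (Y : set cfg) (nc : nat).
Variables (cd : coding S X P Y nc) (col : 'I_nc) (a0 : A).
Implicit Types (y : cfg) (z a v u b x o c l q : Zd d).
Local Notation m := (mm S).
Local Notation N := (cN S).
Local Notation N' := (cN' S).
Local Notation M := (cM S).
Local Notation D := (cD S).
Local Notation W := (cW S).
Local Notation rho := (rho S).
Local Notation Low := (low S (data r)).
Local Notation mark := (cmark cd).
Local Notation word := (cword cd).
Local Notation pat := (pat r cd col).
Local Notation anc := (anc r).
Local Notation tile := (tile r).
Local Notation atile := (atile r).
Local Notation symb := (symb S col).
Local Notation cstart := (cstart S).

Definition fmap y : Zd d -> A := fun a =>
  xget a0 [set s | exists n z, anc n (shift z y) /\ pat n (shift z y) (a - z) = Some s].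

Lemma pat_lang n y : Y y -> anc n y -> exists2 x, X x & pat n y = restr (tile n y) x.
Proof.
move=> Yy an; have [Pc _ _ _] := pat_spec cd col Yy an.
by have [x Xx <-] := (c_fam cd).1 _ (tile_grid r n y) _ Pc; exists x.
Qed.

Lemma pat_some n y a s : Y y -> anc n y -> pat n y a = Some s -> tile n y a.
Proof. by move=> Yy an; have [x _ ->] := pat_lang Yy an; rewrite /restr; case: ifP => // /asboolP. Qed.

Lemma pat_tile n y a : Y y -> anc n y -> tile n y a -> exists s, pat n y a = Some s.
Proof.
move=> Yy an ta; have [x _ ->] := pat_lang Yy an; exists (x a).
by rewrite /restr; case: ifP => // /asboolP.
Qed.

(** Two tiles through a common site are equal or nested, and the pattern of the larger extends that
    of the smaller. *)
Lemma pat_agree y n z n' z' a : Y y -> anc n (shift z y) -> anc n' (shift z' y) ->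
  atile y n z a -> atile y n' z' a -> pat n (shift z y) (a - z) = pat n' (shift z' y) (a - z').
Proof.
move=> Yy.
suff H i j w w' : (i < j)%N -> anc i (shift w y) -> anc j (shift w' y) -> atile y i w a ->
    atile y j w' a -> pat i (shift w y) (a - w) = pat j (shift w' y) (a - w').
  move=> an an' ta ta'; have [/H|/H h|e] := ltngtP n n'; [exact|by apply/esym/h|].
  rewrite e in an ta *.
  have [->//|zz'] := eqVneq z z'.
  by have : (thicken (atile y n' z) D `&` atile y n' z') a; [split=> //; exact: sub_thicken|rewrite tile_same].
move=> ij ai aj ti tj; apply: esym.
case: (tile_dich w' ij ai) => h; last first.
  by have : (thicken (atile y i w) D `&` atile y j w') a; [split=> //; exact: sub_thicken|rewrite h].
apply: (spec_agree _ ij ai _ ti); last exact: subset_trans (@sub_thicken _ _ _) h.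
exact: (pat_spec _ _ (c_inv cd _ Yy) aj).
Qed.

Lemma fmapE y n z a : Y y -> anc n (shift z y) -> atile y n z a ->
  pat n (shift z y) (a - z) = Some (fmap y a).
Proof.
move=> Yy an ta; have Yz := c_inv cd z Yy.
have [s hs] := pat_tile Yz an (proj1 (translateE _ _ _) ta).
have [n' [z' [an' e]]] : [set s | exists n z, anc n (shift z y) /\ pat n (shift z y) (a - z) = Some s] (fmap y a).
  by apply: xgetPex; exists s, n, z.
rewrite -e; apply: pat_agree => //; apply/translateE.
exact: pat_some (c_inv cd z' Yy) an' e.
Qed.

Lemma bfun_fmap a : bfun (fun y => fmap y a).
Proof.
have H s : bfun (fun y => exists n z, anc n (shift z y) /\ pat n (shift z y) (a - z) = Some s).
  apply: bfun_ex => n; apply: bfun_ex => z; apply: bfun_and.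
    exact: (bfun_shift z (bfun_comp fst (bfun_data r n))).
  exact: bfun_eq (bfun_shift z (bfun_comp (fun f => f (a - z)) (bfun_pat r cd col n))).
have := bfun_comp (fun Q : A -> Prop => xget a0 [set s | Q s]) (bfun_fin (enum A) (fun=> False) H).
congr bfun; apply/funext => y; congr xget; apply/seteqP.
by split=> s /=; rewrite mem_enum.
Qed.

Lemma fmap_shift g y : fmap (shift g y) = shift g (fmap y).
Proof.
apply/funext => a; rewrite {2}/shift /fmap; congr xget; apply/seteqP; split=> s [n [z]].
  rewrite shift_shift => h; exists n, (g + z); rewrite opprD addrACA subrr add0r; exact: h.
move=> h; exists n, (z - g); rewrite shift_shift [g + _]addrC subrK opprB addrA [a + g]addrC; exact: h.
Qed.

Definition exhausted y := forall R, exists n z, anc n (shift z y) /\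
  forall a, (nrm a <= R)%N -> atile y n z a.

Lemma exhausted_shift g y : exhausted y -> exhausted (shift g y).
Proof.
move=> h R; have [n [z [az hz]]] := h (R + nrm g)%N.
exists n, (z - g); rewrite shift_shift [g + _]addrC subrK; split=> // a aR.
apply/atile_shift; rewrite [g + (z - g)]addrC subrK; apply: hz.
have := nrmD g a; lia.
Qed.

Lemma bfun_exhausted : bfun exhausted.
Proof.
apply: bfun_all => R; apply: bfun_ex => n; apply: bfun_ex => z; apply: bfun_and.
  exact: (bfun_shift z (bfun_comp fst (bfun_data r n))).
apply: bfun_comp (fun T : ldata d => forall a, (nrm a <= R)%N -> translate T.2 z a) _ _.
exact: (bfun_shift z (bfun_data r n)).
Qed.

Lemma atile_grid y n z : grid_union (kk S) (atile y n z).
Proof. exact/grid_union_translate/tile_grid. Qed.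

Lemma atile_P y n z : Y y -> anc n (shift z y) -> P (atile y n z) (restr (atile y n z) (fmap y)).
Proof.
move=> Yy an; have Yz := c_inv cd z Yy; have [Pc _ _ _] := pat_spec cd col Yz an.
have := proj1 ((c_fam cd).2 _ z _ (tile_grid r n (shift z y))) Pc.
congr P; apply/funext => a; rewrite /tpat /restr.
case: asboolP => ha; first exact: fmapE.
have [x _ ->] := pat_lang Yz an; rewrite /restr; case: ifP => // /asboolP h.
by case: ha; apply/translateE.
Qed.

(** An increasing sequence is needed: [nx R] bounds the tile chosen for radius [R], so the tile
    chosen for [nx R] contains it. *)
Lemma fmap_X y : Y y -> exhausted y -> X (fmap y).
Proof.
move=> Yy ex.
have H R : exists p : nat * Zd d, anc p.1 (shift p.2 y) /\ forall a, (nrm a <= R)%N -> atile y p.1 p.2 a.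
  by have [n [z h]] := ex R; exists (n, z).
pose t R := projT1 (cid (H R)); have tP R := projT2 (cid (H R)).
pose nx R := (nrm (t R).2 + 2 * rho (t R).1 + R).+1.
have nxP R a : atile y (t R).1 (t R).2 a -> (nrm a <= nx R)%N.
  by rewrite /nx; case: (t R) => n z /= /nrm_atile ha; have := nrmD (a - z) z; rewrite subrK; lia.
have nx_gt R : (R < nx R)%N by rewrite /nx ltnS leq_addl.
pose C i := atile y (t (iter i nx 0%N)).1 (t (iter i nx 0%N)).2.
have sub i : C i `<=` C i.+1.
  by move=> a /nxP ha; exact: (tP (iter i.+1 nx 0%N)).2.
apply: ((c_F cd).2 (fmap y) C) => //.
- by move=> i; exact: atile_grid.
- apply/seteqP; split=> // a _; exists (nrm a) => //; apply: (tP _).2.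
  by elim: (nrm a) => //= i IH; exact: leq_ltn_trans IH (nx_gt _).
- by move=> i; apply: atile_P => //; exact: (tP _).1.
Qed.

(** * Markers occur only at anchors *)

Section Detection.
Variable y : cfg.
Hypotheses (Yy : Y y) (exy : exhausted y).

Definition occurs (x : Zd d -> A) u := forall a, @box1 d M a -> Some (x (u + a)) = mark a.

Lemma anc_marker n z : anc n (shift z y) -> occurs (fmap y) z.
Proof.
move=> an a ha; have [_ _ h _] := pat_spec cd col (c_inv cd z Yy) an.
rewrite -h // -(@fmapE _ n z) //; first by rewrite addrAC subrr add0r.
apply/translateE; rewrite addrAC subrr add0r; apply: tile_ball.
have := box1_nrm ha; have := rho_ge S n; have := gf_big S n; lia.
Qed.

Lemma anc_word n z v a : anc n (shift z y) -> good S n (Low n (shift z y)) (tile n (shift z y)) v ->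
  @box1 d N' a -> Some (fmap y (z + (cstart v + a))) =
    word (symb n (Low n (shift z y)) (tile n (shift z y)) (ytr S n (shift z y)) v) a.
Proof.
move=> an gv ha; have [_ _ _ h] := pat_spec cd col (c_inv cd z Yy) an.
rewrite -h // -(@fmapE _ n z) //; first by rewrite addrAC subrr add0r.
apply/translateE; rewrite addrAC subrr add0r; case: gv => g1 _ _; apply: g1; exact: code_cube.
Qed.

(** The cube through [b] lies in the tile and off the lower tiles. If it also avoided the marker at
    [z], it would carry a code word inside the occurrence at [u], contrary to [word_mark]. *)
Lemma occurs_near u n z b : occurs (fmap y) u -> anc n (shift z y) ->
  (forall x, (nrm (x - b) <= N + m)%N -> atile y n z x) ->
  (forall j z' x, (j < n)%N -> anc j (shift z' y) -> atile y j z' x -> (N + m < nrm (x - b))%N) ->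
  (forall x, (nrm (x - b) <= N)%N -> @box1 d M (x - u)) ->
  exists2 x : Zd d, (nrm (x - b) <= N)%N & thicken (@box1 d M) m (x - z).
Proof.
move=> oc an inK far inQ; apply: contrapT => nx.
have xz x : z + x - z = x by rewrite addrAC subrr add0r.
pose v := cidx N (b - z).
have hb : cube N v (b - z) by exact: cube_cidx (N0 S).
have near x : cube N v x -> (nrm (z + x - b) <= N)%N.
  by move=> hx; have := cube_dist hx hb; rewrite opprB addrA [x + z]addrC.
have gv : good S n (Low n (shift z y)) (tile n (shift z y)) v.
  have sub : cube N v `<=` tile n (shift z y).
    by move=> x /near hx; have /translateE := inK _ (leq_trans hx (leq_addr _ _)); rewrite xz.
  split=> //.
    apply/offLE => // [x /sub /nrm_tile //|j z' jn az].
    apply/seteqP; split=> // x [/thickenE[c /atile_shift Tc xc] /near hx].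
    rewrite shift_shift in az; have := far j _ _ jn az Tc; have := nrm_tri (z + x) (z + c) b.
    have -> : z + c - (z + x) = c - x by rewrite opprD addrACA subrr add0r.
    rewrite (nrmBC c x); lia.
  apply/seteqP; split=> // x [hx /near hx']; apply: nx; exists (z + x) => //.
  by rewrite xz.
apply: (word_mark (o := z + cstart v - u) (symb_valid cd col (c_inv cd z Yy) gv)) => a ha.
rewrite -(anc_word an gv ha).
have e : u + (z + cstart v - u + a) = z + (cstart v + a) by rewrite addrCA addrA subrK -addrA.
rewrite -e -oc //; have -> : z + cstart v - u + a = z + (cstart v + a) - u by rewrite addrAC -[z + _ + a]addrA.
apply: inQ; apply: near; exact: code_cube.
Qed.

(* Tiles and their complements are unions of cubes of side [W] and boundaries of different tiles are
   far apart, so near every point some ball meets the interior of a single tile only. *)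
Lemma owner_ex c : exists n z b, [/\ anc n (shift z y), (nrm (b - c) + (N + m) <= W)%N,
  (forall x, (nrm (x - b) <= N + m)%N -> atile y n z x) &
  forall j z' x, (j < n)%N -> anc j (shift z' y) -> atile y j z' x -> (N + m < nrm (x - b))%N].
Proof.
have W2 := W_ge S; have D6 : D = (6 * W)%N by [].
pose inside n := `[< exists z, anc n (shift z y) /\ forall x, (nrm (x - c) <= W)%N -> atile y n z x >].
have [|n0 /asboolP[z [an inK]] min] := @ex_minnP inside.
  have [n [z [an h]]] := exy (nrm c + W); exists n; apply/asboolP; exists z; split=> // x hx.
  by apply: h; have := nrmD (x - c) c; rewrite subrK; lia.
have [[j [zl [l [jn aj Tl lc]]]]|nl] := pselect (exists j zl l, [/\ (j < n0)%N, anc j (shift zl y),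
    atile y j zl l & (nrm (l - c) <= N + m)%N]); last first.
  exists n0, z, c; split=> //; first by rewrite subrr nrm0; lia.
    by move=> x hx; apply: inK; lia.
  move=> j z' x jn aj Tx; rewrite ltnNge; apply/negP => h.
  by apply: nl; exists j, z', x.
have ball_l x : (nrm (x - c) <= W)%N -> (nrm (x - l) <= D)%N.
  by have := nrm_tri c x l; rewrite (nrmBC c l); lia.
(* By minimality of [n0] no tile of lower level contains the whole [W]-ball around [c]. *)
have noin j' z' : (j' < n0)%N -> anc j' (shift z' y) -> exists2 o : Zd d, (nrm (o - c) <= W)%N & ~ atile y j' z' o.
  move=> j'n aj'; apply: contrapT => h.
  have : inside j' by apply/asboolP; exists z'; split=> // x hx; apply: contrapT => hx'; apply: h; exists x.
  by move=> /min; rewrite leqNgt j'n.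
pose v := cidx W (c - zl).
have hc : cube W v (c - zl) by exact: cube_cidx (W0 S).
have nearc x : cube W v (x - zl) -> (nrm (x - c) <= W)%N.
  move=> hx; have := cube_dist hx hc; have -> // : x - zl - (c - zl) = x - c.
  by rewrite opprB addrA subrK.
(* [b] is put near the lower corner of the [W]-cube of [c] in the grid of the tile at [zl], so that
   its [N + m]-ball fits into this cube, which lies entirely inside or entirely outside that
   tile. *)
have [b bE] : exists b : Zd d, forall i, b ord0 i = zl ord0 i + (W%:Z * v ord0 i + (N + m + 1)%N%:Z).
  by exists (\row_i (zl ord0 i + (W%:Z * v ord0 i + (N + m + 1)%N%:Z))) => i; rewrite coord_row.
have inb x : (nrm (x - b) <= N + m)%N -> cube W v (x - zl).
  move=> /nrm_leP h i; have := h i; rewrite !coordD !coordN bE; lia.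
have bc : (nrm (b - c) + (N + m) <= W)%N.
  (* [b + h] is a point of the [N + m]-ball farther from [c] by [N + m] in every coordinate; as it
     stays in the cube, [b] has that much to spare. *)
  have [h hE] : exists h : Zd d, forall i, h ord0 i =
      if 0 <= b ord0 i - c ord0 i then (N + m)%N%:Z else - (N + m)%N%:Z.
    by exists (\row_i (if 0 <= b ord0 i - c ord0 i then (N + m)%N%:Z else - (N + m)%N%:Z)) => i; rewrite coord_row.
  have hh : (nrm (b + h - b) <= N + m)%N.
    by rewrite addrAC subrr add0r; apply/nrm_leP => i; rewrite hE; case: ifP => _; lia.
  have /nrm_leP hW := nearc _ (inb _ hh).
  have : (nrm (b - c) <= W - (N + m))%N.
    apply/nrm_leP => i; have := hW i; rewrite !coordD !coordN hE.
    by case: ifP => h1 h2; zlia.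
  lia.
have far_in x : (nrm (x - b) <= N + m)%N -> (nrm (x - l) <= D)%N.
  by move=> /inb /nearc /ball_l.
have al x x' : cube W v (x - zl) -> cube W v (x' - zl) -> atile y j zl x -> atile y j zl x'.
  by move=> hx hx' /translateE tx; apply/translateE; exact: tile_aligned hx hx' tx.
have [Lc|nLc] := pselect (atile y j zl c).
  exists j, zl, b; split=> // [x /inb hx|j' z' x jj' aj' Tx]; first exact: al hc hx Lc.
  rewrite ltnNge; apply/negP => hx; have Lx := al _ _ hc (inb _ hx) Lc.
  case: (tile_dich zl jj' aj') => h.
    have [w oc []] := noin j zl jn aj; apply: h; apply/thickenE; exists x => //.
    have := nrm_tri c w x; have := nearc _ (inb _ hx); rewrite (nrmBC c x); lia.
  by have : (thicken (atile y j' z') D `&` atile y j zl) x; [split=> //; exact: sub_thicken|rewrite h].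
exists n0, z, b; split=> // [x /inb /nearc /inK //|j' z' x jn' aj' Tx].
rewrite ltnNge; apply/negP => hx.
have nLx : ~ atile y j zl x by move=> Lx; apply: nLc; exact: al (inb _ hx) hc Lx.
have Dl : thicken (atile y j zl) D x by apply/thickenE; exists l => //; exact: far_in.
have [jj'|j'j|e] := ltngtP j j'.
- case: (tile_dich z' jj' aj) => h; last first.
    by have : (thicken (atile y j zl) D `&` atile y j' z') x; [|rewrite h].
  have [w oc []] := noin j' z' jn' aj'; apply: h; apply/thickenE; exists l => //; exact: ball_l.
- case: (tile_dich zl j'j aj') => h; first by apply: nLx; apply: h; exact: sub_thicken.
  have : (thicken (atile y j' z') D `&` atile y j zl) l; last by rewrite h.
  by split=> //; apply/thickenE; exists x => //; rewrite nrmBC; exact: far_in.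
- have [e'|zz'] := eqVneq zl z'; first by apply: nLx; rewrite e e'.
  rewrite -e in aj' Tx.
  by have : (thicken (atile y j zl) D `&` atile y j z') x; [|rewrite tile_same].
Qed.

(** A probe inside the occurrence must meet the marker zone of some anchor [z], so [u] is within
    [3 * M] of [z], where no lower tile interferes. If they differ by more than [2 * N + m], a probe
    in a suitable corner misses the marker at [z], a contradiction. Otherwise two copies of the
    marker overlap with a small displacement, which must be zero by [mark_aper]. *)
Lemma occurs_anc u : occurs (fmap y) u -> exists n, anc n (shift u y).
Proof.
move=> oc; have DM := M_ge S; have W2 := W_ge S.
have [n [z [an uz]]] : exists n z, anc n (shift z y) /\ (nrm (u - z) <= 3 * M)%N.
  have [hM hME] : exists h : Zd d, forall i, h ord0 i = (2 * W)%N%:Z.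
    by exists (\row__ (2 * W)%N%:Z) => i; rewrite coord_row.
  have [n [z [b [an bc inK far]]]] := owner_ex (u + hM).
  have inQ x : (nrm (x - b) <= N)%N -> @box1 d M (x - u).
    move=> hx; apply/box1P => i.
    have /nrm_leP/(_ i) : (nrm (x - (u + hM)) <= W)%N.
      by have := nrm_tri b x (u + hM); lia.
    by rewrite !(coordD, coordN) hME; zlia.
  have [x /inQ /box1_nrm hx /thickenE[q /box1_nrm hq xq]] := occurs_near oc an inK far inQ.
  exists n, z; split=> //.
  have := nrmD (x - z - q) q; rewrite subrK; have := nrm_tri x u z; rewrite (nrmBC u x); lia.
exists n; suff -> : u = z by [].
have nearz b x : (nrm (b - z) <= 5 * M)%N -> (nrm (x - b) <= N + m)%N -> (nrm (x - z) < 8 * M)%N.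
  by have := nrm_tri b x z; lia.
have [far|close] := ltnP (2 * N + m) (nrm (u - z)).
  have [i hi] : exists i, (2 * N + m < absz ((u - z)%R ord0 i))%N.
    apply: contrapT => /forallNP h; move: far; rewrite ltnNge => /negP; apply.
    by apply/nrm_leP => i; rewrite leqNgt; apply/negP; exact: h.
  have {}hi : ((2 * N + m)%N%:Z < u ord0 i - z ord0 i) \/ ((2 * N + m)%N%:Z < z ord0 i - u ord0 i).
    by move: hi; rewrite coordD coordN; lia.
  (* [b] lies in the part of the box at [u] that sticks out beyond the marker at [z] in direction
     [i]. *)
  have [b bE] : exists b : Zd d, forall t, b ord0 t = u ord0 t +
      (if (t == i) && (0 < u ord0 i - z ord0 i) then (M - N)%N%:Z else N.+1%:Z).
    by exists (\row_t (u ord0 t + (if (t == i) && (0 < u ord0 i - z ord0 i) then (M - N)%N%:Z else N.+1%:Z))) => t; rewrite coord_row.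
  have bz : (nrm (b - z) <= 5 * M)%N.
    apply/nrm_leP => t; have /nrm_leP/(_ t) := uz; rewrite !(coordD, coordN) bE; case: ifP => _; zlia.
  have inQ x : (nrm (x - b) <= N)%N -> @box1 d M (x - u).
    move=> /nrm_leP hx; apply/box1P => t; have := hx t; rewrite !(coordD, coordN) bE.
    by case: ifP => _; zlia.
  have [||x /nrm_leP/(_ i) hx /thickenE[q /box1P/(_ i) hq /nrm_leP/(_ i) xq]] := occurs_near oc an _ _ inQ.
  - move=> x /(nearz _ _ bz) hx; apply/translateE/tile_ball.
    have := rho_ge S n; have := gf_big S n; lia.
  - move=> j z' x jn az' Tx; rewrite ltnNge; apply/negP => /(nearz _ _ bz).
    rewrite -[shift z' y](_ : shift (z' - z) (shift z y) = _) in az'; last by rewrite shift_shift addrC subrK.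
    have Tx' : atile (shift z y) j (z' - z) (x - z).
      by apply/atile_shift; rewrite ![z + _]addrC !subrK.
    have := anc_free an jn az' Tx'; have := gf_big S j; lia.
  exfalso; move: hx xq; rewrite !(coordD, coordN) bE eqxx /=; case: ifP; zlia.
apply/eqP; rewrite -subr_eq0; apply: contraT => uz0.
have [a [ha ha' ne]] := mark_aper cd uz0 close; case: ne.
rewrite -(oc a ha) -(anc_marker an ha'); congr (Some (fmap y _)).
by rewrite addrA [z + _]addrC subrK.
Qed.


End Detection.
End FactorMap.

(** * Decoding *)

Section Injectivity.
Variables (d : nat) (A B : finType) (S : scales d).
Notation cfg := (Zd d -> B).
Variables (X : set (Zd d -> A)) (P : set (Zd d) -> set (Zd d -> option A)) (Y : set cfg) (nc : nat).
Variables (cd : coding S X P Y nc) (a0 : A).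
Implicit Types (y : cfg) (z a v u : Zd d) (r : rawseq B S).
Local Notation m := (mm S).
Local Notation N := (cN S).
Local Notation Low r := (low S (data r)).
Local Notation symb := (symb S).

(** Anchors keep away from lower tiles, and every tile contains its own anchor, so no point is an
    anchor at two levels. *)
Lemma anc_level r y j n : anc r n y -> anc r j y -> (n <= j)%N.
Proof.
move=> an aj; rewrite leqNgt; apply/negP => jn.
have := @anc_free _ _ _ r n y j 0 0 an jn; rewrite shift0 => /(_ aj (atile_center r y j 0)).
by rewrite nrm0.
Qed.

Lemma symb_eq r1 r2 c1 c2 y1 y2 n1 n2 z v : Y y1 -> Y y2 ->
  fmap r1 cd c1 a0 y1 = fmap r2 cd c2 a0 y2 ->
  anc r1 n1 (shift z y1) -> anc r2 n2 (shift z y2) ->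
  good S n1 (Low r1 n1 (shift z y1)) (tile r1 n1 (shift z y1)) v ->
  good S n2 (Low r2 n2 (shift z y2)) (tile r2 n2 (shift z y2)) v ->
  symb c1 n1 (Low r1 n1 (shift z y1)) (tile r1 n1 (shift z y1)) (ytr S n1 (shift z y1)) v =
  symb c2 n2 (Low r2 n2 (shift z y2)) (tile r2 n2 (shift z y2)) (ytr S n2 (shift z y2)) v.
Proof.
move=> Y1 Y2 e a1 a2 g1 g2; apply: (word_inj (c := cd)).
- exact: symb_valid (c_inv cd z Y1) g1.
- exact: symb_valid (c_inv cd z Y2) g2.
by move=> a ha; rewrite -(anc_word cd c1 a0 Y1 a1 g1 ha) -(anc_word cd c2 a0 Y2 a2 g2 ha) e.
Qed.

Lemma symb_hd (c : 'I_nc) n L K y : symb c n L K y (hd S n L) = inr (Some c).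
Proof. by rewrite /symb asboolT ?eqxx //; exists n. Qed.

Section LevelStep.
Variables (r1 r2 : rawseq B S) (c1 c2 : 'I_nc) (y1 y2 : cfg).
Hypotheses (Y1 : Y y1) (Y2 : Y y2) (ex1 : exhausted r1 y1) (ex2 : exhausted r2 y2).
Hypothesis e12 : fmap r1 cd c1 a0 y1 = fmap r2 cd c2 a0 y2.

Definition same_data j := forall u, data r1 j (shift u y1) = data r2 j (shift u y2).

Lemma same_low n u : (forall j, (j < n)%N -> same_data j) ->
  Low r1 n (shift u y1) = Low r2 n (shift u y2).
Proof.
move=> IH; apply/funext => -[j z]; rewrite /low mem_trunc.
by case: ifP => // /andP[jn _] /=; rewrite !shift_shift; exact: IH.
Qed.

(* The place of header cube number [n] depends on the tiles of level less than [n] only, and its content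
   tells whether the level is [n]. *)
Lemma anc_step n u : (forall j, (j < n)%N -> same_data j) ->
  anc r1 n (shift u y1) -> anc r2 n (shift u y2) /\ c1 = c2.
Proof.
move=> IH an.
have [n' an'] : exists n', anc r2 n' (shift u y2).
  apply: (occurs_anc Y2 ex2 (cd := cd) (col := c2) (a0 := a0)); rewrite -e12.
  exact: (anc_marker cd c1 a0 Y1 an).
have nn' : (n <= n')%N.
  rewrite leqNgt; apply/negP => n'n; have := anc_level an (j := n').
  by rewrite /anc IH // leqNgt n'n => /(_ an').
have offE T : off r1 n (shift u y1) T <-> off r2 n (shift u y2) T.
  split=> h j z jn.
    by have := h j z jn; rewrite /anc /atile /tile !shift_shift IH.
  by have := h j z jn; rewrite /anc /atile /tile !shift_shift IH.
have bd n0 : (n <= n0)%N -> forall v, cube N v `<=` ball (hcen S n) (sc S n + N) ->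
    forall a, cube N v a -> (nrm a <= 2 * rho S n0)%N.
  move=> nn0 v h a /h /ball_hcen_nrm; have := kap_gf S n; have := gf_mono S nn0; have := rho_ge S n0; lia.
have hE : hd S n (Low r1 n (shift u y1)) = hd S n (Low r2 n' (shift u y2)).
  rewrite /hd; congr xget; apply/seteqP; split=> v [h1 h2]; split=> //.
    by apply/(offLE r2 _ nn' (bd _ nn' v h1))/offE/(offLE r1 _ (leqnn n) (bd _ (leqnn n) v h1)).
  by apply/(offLE r1 _ (leqnn n) (bd _ (leqnn n) v h1))/offE/(offLE r2 _ nn' (bd _ nn' v h1)).
(* In the first tile this cube carries [Some c1]. In the second the only header with [Some] is
   number [n'], and distinct headers occupy distinct cubes. *)
have := symb_eq Y1 Y2 e12 an an' (hd_good an (leqnn n)).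
rewrite symb_hd hE => /(_ (hd_good an' nn')).
rewrite /symb asboolT; last by exists n.
case: eqP => // e [->]; split=> //.
by rewrite (hd_inj nn' (leqnn n') e).
Qed.

End LevelStep.

Lemma same_all r1 r2 c1 c2 y1 y2 : Y y1 -> Y y2 -> exhausted r1 y1 -> exhausted r2 y2 ->
  fmap r1 cd c1 a0 y1 = fmap r2 cd c2 a0 y2 -> forall n, same_data r1 r2 y1 y2 n.
Proof.
move=> Y1 Y2 ex1 ex2 e12; elim/ltn_ind => n IH u.
have IH' j : (j < n)%N -> same_data r2 r1 y2 y1 j by move=> jn w; rewrite IH.
rewrite [LHS]surjective_pairing [RHS]surjective_pairing; congr pair.
  apply/propext; split=> h.
    by have [] := anc_step Y1 Y2 ex2 e12 IH h.
  by have [] := anc_step Y2 Y1 ex1 (esym e12) IH' h.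
by have := tileE r1 n (shift u y1); rewrite (same_low _ IH) -tileE.
Qed.

(** By induction on the level, [y] is recovered on the [N + m]-neighbourhood of each tile: a site
    there lies in a data cube, is that close to a lower tile, or belongs to [ring] and is stored in
    the spare bits. Exhaustion makes the tiles reach every site. *)
Lemma fmap_inj r1 r2 c1 c2 y1 y2 :
  Y y1 -> Y y2 -> exhausted r1 y1 -> exhausted r2 y2 ->
  fmap r1 cd c1 a0 y1 = fmap r2 cd c2 a0 y2 -> y1 = y2.
Proof.
move=> Y1 Y2 ex1 ex2 e12.
have same := same_all Y1 Y2 ex1 ex2 e12.
have cc : c1 = c2.
  have [n [z [an _]]] := ex1 0%N.
  by have [] := anc_step Y1 Y2 ex2 e12 (fun j _ => same j) an.
have LE n z : Low r1 n (shift z y1) = Low r2 n (shift z y2) by apply: same_low.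
have ancE n z : anc r1 n (shift z y1) = anc r2 n (shift z y2) by rewrite /anc same.
have tE n z : tile r1 n (shift z y1) = tile r2 n (shift z y2) by rewrite /tile same.
suff H n : forall z a, anc r1 n (shift z y1) -> thicken (atile r1 y1 n z) (N + m) a -> y1 a = y2 a.
  apply/funext => a; have [n [z [an h]]] := ex1 (nrm a).
  by apply: (H n z) => //; exact/sub_thicken/h.
elim/ltn_ind: n => n IH z a an Ta.
have an2 : anc r2 n (shift z y2) by rewrite -ancE.
pose L := Low r1 n (shift z y1); pose K := tile r1 n (shift z y1).
suff : shift z y1 (a - z) = shift z y2 (a - z).
  by rewrite /shift [z + _]addrC subrK.
have Tb : thicken K (N + m) (a - z).
  case/thickenE: Ta => b /translateE Kb ab; apply/thickenE; exists (b - z) => //.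
  by rewrite opprB addrA subrK.
have bK : (nrm (a - z) <= 4 * rho S n)%N.
  case/thickenE: Tb => b /nrm_tile hb ab; have := nrmD (a - z - b) b; rewrite subrK.
  have := rho_ge S n; have := W_ge S; lia.
have data_eq v : isdata S n L K v ->
    (forall i : 'rV['I_N]_d, shift z y1 (N%:Z *: v + boxpt i) = shift z y2 (N%:Z *: v + boxpt i)) /\
    enc (isdata S n L K) (ring S n L K) (ytr S n (shift z y1)) v =
    enc (isdata S n L K) (ring S n L K) (ytr S n (shift z y2)) v.
  move=> [gv nh].
  have gv2 : good S n (Low r2 n (shift z y2)) (tile r2 n (shift z y2)) v by rewrite -LE -tE.
  have := symb_eq Y1 Y2 e12 an an2 gv gv2; rewrite -LE -tE -/L -/K /symb asboolF; last first.
    by move=> [j jn]; exact: nh jn.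
  move=> [/ffunP h1 h2]; split=> // i; have := h1 i; rewrite !ffunE.
  have hi : (nrm (N%:Z *: v + boxpt i) <= 4 * rho S n)%N.
    have := good_nrm gv (cube_shift v (box1_boxpt i)); lia.
  by rewrite !ytr_id.
have [[v dv hv]|nd] := pselect (exists2 v, isdata S n L K v & cube N v (a - z)).
  have hb : @box1 d N (a - z - N%:Z *: v).
    by apply/box1P => i; have := hv i; rewrite !(coordD, coordN, coordZ); zlia.
  have [i hi] := boxpt_ex hb; have [/(_ i) + _] := data_eq v dv.
  by rewrite -hi [_ + (_ - _)]addrC subrK.
have [[j [z' [/Low_anc[jn zn az'] Tl]]]|nl] := pselect (exists j z', (L (j, z')).1 /\
    thicken (ltile L j z') (N + m) (a - z)).
  apply: (IH j jn (z + z')); first by rewrite -shift_shift.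
  case/thickenE: Tl => b; rewrite Low_tile // => /atile_shift Tb' ab; apply/thickenE.
  rewrite [z + (a - z)]addrC subrK; exists (z + b) => //.
  by rewrite opprD addrA.
have rg : ring S n L K (a - z) by split.
have := @encP_enc _ _ _ r1 n (shift z y1) (card_B cd).
move=> /(_ (ytr S n (shift z y1)) (ytr S n (shift z y2)) _ _ rg).
by rewrite !ytr_id //; apply=> v /data_eq[].
Qed.

End Injectivity.

(** * Choice of the scales *)

(** A discrete mean value inequality; it shows that shells have order [d - 1]. *)
Lemma exp_add_sub (x e d : nat) : ((x + e) ^ d - x ^ d <= d * e * (x + e) ^ d.-1)%N.
Proof.
elim: d => [|[|d] IH]; first by [].
  by rewrite !expn1 expn0 mul1n muln1 addKn.
rewrite /= in IH *; rewrite leq_subLR in IH; rewrite leq_subLR !(expnS _ d.+1).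
have h : (x ^ d.+1 <= (x + e) ^ d.+1)%N by rewrite leq_exp2r // leq_addr.
have := leq_mul (leqnn x) IH.
rewrite expnS; move: h; rewrite expnS.
move: (x ^ d.+1)%N ((x + e) ^ d)%N => a b; nia.
Qed.

Section ScaleExistence.
Variables (d k m n0 q l b : nat).
Hypotheses (d2 : (2 <= d)%N) (k0 : (0 < k)%N) (n00 : (0 < n0)%N).
Local Notation N := (k * n0 + 2 * m)%N.
Local Notation W := (k * q)%N.
Local Notation M := (k * l)%N.
Local Notation D := (6 * W)%N.
Hypothesis W_ge : (2 * (N + m) + 2 <= W)%N.
Hypothesis M_ge : (4 * W <= M)%N.

(** The constants [t], [C], [e] and [E] do not involve [Q]. With half radius [C + t * Q] the sites
    to be stored number at most [E * Q ^ d.-1], so [Q > b * E] makes [Q ^ d] data cubes suffice. *)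
Lemma radius_ex n s a g : exists p : nat * nat,
  [/\ (a + 2 * W + D + 2 * g + 3 * s + n + 1 <= 2 * p.1)%N,
      (s + n <= p.1)%N,
      (g + (2 * (s + N) + 1) * p.2.+1 + 2 * N <= 2 * p.1)%N &
      (b * ((2 * (2 * p.1 + a + 2 * W)).+1 ^ d - (2 * (2 * p.1 - N)).+1 ^ d
                          + (2 * (g + N)).+1 ^ d) <= p.2 ^ d)%N].
Proof.
pose t := (2 * (s + N) + 1)%N.
pose C := (a + 2 * W + D + 2 * g + 3 * s + n + 1 + 2 * N + g + t)%N.
pose e := (2 * a + 4 * W + 2 * N)%N.
pose E := (d * e * (4 * t + 4 * C + 2 * a + 4 * W + 1) ^ d.-1 + (2 * (g + N)).+1 ^ d)%N.
pose Q := (b * E).+1.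
exists ((C + t * Q)%N, Q); split=> /=.
- rewrite /C; lia.
- rewrite /C; lia.
- rewrite mulnS -/t /C; lia.
set r := (2 * (C + t * Q))%N.
have rN : (N <= r)%N by rewrite /r /C; lia.
have -> : (2 * (r + a + 2 * W)).+1 = ((2 * (r - N)).+1 + e)%N by rewrite /e; lia.
have h1 := exp_add_sub (2 * (r - N)).+1 e d.
have h2 : ((2 * (r - N)).+1 + e <= (4 * t + 4 * C + 2 * a + 4 * W + 1) * Q)%N.
  have -> : (4 * t + 4 * C + 2 * a + 4 * W + 1 = 4 * t + (4 * C + 2 * a + 4 * W + 1))%N by lia.
  rewrite mulnDl; apply: leq_trans (_ : (4 * t * Q + (4 * C + 2 * a + 4 * W + 1) <= _)%N); last first.
    by rewrite leq_add2l leq_pmulr.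
  rewrite -mulnA; move: rN; rewrite /r /e; move: (t * Q)%N => x; lia.
have h3 : (((2 * (r - N)).+1 + e) ^ d.-1 <= (4 * t + 4 * C + 2 * a + 4 * W + 1) ^ d.-1 * Q ^ d.-1)%N.
  by rewrite -expnMn; case: (d.-1) => // d'; rewrite leq_exp2r.
have Q1 : (1 <= Q ^ d.-1)%N by rewrite expn_gt0.
have -> : (Q ^ d = Q * Q ^ d.-1)%N by rewrite -expnS prednK // ltnW.
apply: leq_trans (_ : (b * (E * Q ^ d.-1) <= _)%N); last first.
  by rewrite mulnA leq_mul2r /Q leqnSn orbT.
rewrite leq_mul2l; apply/orP; right; rewrite /E mulnDl; apply: leq_add.
  by apply: leq_trans h1 _; rewrite -[X in (_ <= X)%N]mulnA leq_mul2l h3 orbT.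
by rewrite -{1}[(_ ^ d)%N]muln1 leq_mul2l Q1 orbT.
Qed.

Definition radius n s a g := projT1 (cid (radius_ex n s a g)).

(* The state at level [n] is [(sc n, ab n, gf n.-1)]. *)
Definition kap_of (p : nat * nat * nat) := (p.2 + p.1.1 + 2 * N + M + m + 1)%N.
Definition gf_of (p : nat * nat * nat) := (kap_of p + p.1.1 + N + m + 1 + 8 * M)%N.

Fixpoint state (n : nat) : nat * nat * nat :=
  if n is n'.+1 then
    let p := state n' in
    let g := gf_of p in
    let R := (2 * (radius n' p.1.1 p.1.2 g).1)%N in
    ((p.1.1 + 4 * R + 2 * (g + p.1.1) + 1, 2 * p.1.2 + 4 * R + 2 * (D + W), g)%N)
  else (0, 0, 0)%N.

(** The covering radius of the raw centres. Half of [rho n] is used to reach a centre; the other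
    half pays for moving it by [sc n] and leaves a ball of radius [n] inside the tile. *)
Definition half n := (radius n (state n).1.1 (state n).1.2 (gf_of (state n))).1.

Lemma scales_ex : exists S : scales d,
  [/\ [/\ kk S = k, mm S = m, nn S = n0 & qq S = q], ll S = l, cb S = b &
      forall n, rho S n = (2 * half n)%N /\ (sc S n + n <= half n)%N].
Proof.
have rP n := projT2 (cid (radius_ex n (state n).1.1 (state n).1.2 (gf_of (state n)))).
unshelve eexists (@Scales d k m n0 q l b (fun n => (state n).1.1) (fun n => (state n).1.2)
  (fun n => gf_of (state n)) (fun n => (2 * half n)%N) (fun n => kap_of (state n))
  (fun n => (radius n (state n).1.1 (state n).1.2 (gf_of (state n))).2) _ _ _ _ _ _ _ _ _ _ _ _ _ _).
- exact: d2.
- exact: k0.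
- exact: n00.
- exact: W_ge.
- exact: M_ge.
- by move=> n /=; exact: leqnn.
- by move=> n /=; exact: leqnn.
- by move=> n; have [h _ _ _] := rP n; exact: h.
- by rewrite /gf_of /=; lia.
- by rewrite /kap_of /=; lia.
- by move=> n; rewrite /gf_of /=; lia.
- by move=> n; rewrite [X in (_ < X)%N]/kap_of (_ : (state n.+1).2 = gf_of (state n)) //; lia.
- by move=> n; have [_ _ h _] := rP n; exact: h.
- by move=> n; have [_ _ _ h] := rP n; exact: h.
by split=> // n; have [_ h _ _] := rP n; split; [reflexivity|exact: h].
Qed.

End ScaleExistence.

(** * One colour exhausts the lattice *)

Section Exhaustion.
Variables (d : nat) (B : finType) (S : scales d) (h : nat -> nat).
Hypothesis hS : forall n, rho S n = (2 * h n)%N /\ (sc S n + n <= h n)%N.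

Lemma raw_far_h i n (y : Zd d -> B) z : raw (h n) i y -> raw (h n) i (shift z y) -> z != 0 ->
  (10 * rho S n < nrm z)%N.
Proof. by move=> r1 r2 z0; have := raw_sep r1 r2 z0; rewrite (hS n).1; lia. Qed.

Definition rseq (i : nat) : rawseq B S :=
  RawSeq (raw_at := fun n => raw (h n) i) (@raw_far_h i) (fun n => @bfun_raw d B (h n) i).

(** At each level [n] some colour has a tile containing the ball of radius [n]. If every colour [i]
    stopped doing so from level [Rf i] on, the maximum of these levels would give a
    contradiction. *)
Lemma exhausted_ex (y : Zd d -> B) : aperiodic y -> exists i : 'I_(ncol d), exhausted (rseq i) y.
Proof.
move=> ay.
have H n : exists i : 'I_(ncol d), exists z, anc (rseq i) n (shift z y) /\
    forall a, (nrm a <= n)%N -> atile (rseq i) y n z a.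
  have [i [z [hz rz]]] := raw_cover (h n) ay; have [r2 sn] := hS n.
  have [z' hz' az'] := @anc_ex _ _ _ (rseq i) n (shift z y) rz.
  exists i, (z + z'); split; first by rewrite -shift_shift.
  move=> a an; apply/translateE/tile_ball; rewrite r2.
  have := nrmB a (z + z'); have := nrmD z z'; lia.
apply: contrapT => /forallNP nex.
have R (i : 'I_(ncol d)) : exists R, forall n (z : Zd d), (R <= n)%N -> ~ (anc (rseq i) n (shift z y) /\
    forall a, (nrm a <= n)%N -> atile (rseq i) y n z a).
  have /existsNP[R /forallNP hR] := nex i; exists R => n z Rn [az hz].
  apply: (hR n); exists z; split=> // a aR; apply: hz; exact: leq_trans aR Rn.
pose Rf i := projT1 (cid (R i)).
have [i [z hz]] := H (\max_i Rf i)%N.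
by apply: (projT2 (cid (R i)) _ z _ hz); exact: leq_bigmax.
Qed.

End Exhaustion.

(** * Markers and code words from counting *)

Lemma in_injection (T1 T2 : finType) (D1 : pred T1) (D2 : pred T2) : (#|D1| <= #|D2|)%N ->
  (0 < #|D2|)%N -> exists f : T1 -> T2, (forall x, D1 x -> D2 (f x)) /\
    forall x x', D1 x -> D1 x' -> f x = f x' -> x = x'.
Proof.
move=> h /card_gt0P[t0 _].
have szE x : D1 x -> (index x (enum D1) < size (enum D2))%N.
  by move=> Dx; rewrite -!cardE; apply: leq_trans h; rewrite cardE index_mem mem_enum.
exists (fun x => nth t0 (enum D2) (index x (enum D1))); split=> [x Dx|x x' Dx Dx' /eqP].
  by have := mem_nth t0 (szE x Dx); rewrite mem_enum.
rewrite nth_uniq ?enum_uniq ?szE // => /eqP e.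
by rewrite -(nth_index x (_ : x \in enum D1)) ?mem_enum // e nth_index ?mem_enum.
Qed.

(** * Patterns without small periods *)

Section Aperiodic.
Variables (d : nat) (A : finType) (M U : nat).
Hypothesis UM : (2 * U <= M)%N.
Local Notation I := ('rV['I_M]_d).
Implicit Types (u : Zd d) (p : {ffun I -> A}).

Definition periodic u p := forall i j : I, boxpt j = u + boxpt i -> p i = p j.

Definition collar : pred I :=
  fun i => [exists l, (i ord0 l < U)%N || (M - U <= i ord0 l)%N].

Lemma periodicN u p : periodic u p -> periodic (- u) p.
Proof. by move=> h i j e; apply/esym/h; rewrite e addrA subrr add0r. Qed.

(** Off the collar, subtracting [u] stays in the box and lowers coordinate [l]; induction on this
    coordinate carries every value back to the collar. *)
Lemma collar_det_pos u l p p' : 0 < u ord0 l -> (nrm u <= U)%N -> periodic u p -> periodic u p' ->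
  (forall i, collar i -> p i = p' i) -> p = p'.
Proof.
move=> ul uU hp hp' hc; apply/ffunP => i.
have [s] := ubnP (nat_of_ord (i ord0 l)); elim: s i => // s IH i hi.
have [/hc//|/existsPn nc] := boolP (collar i).
have hj t : (absz ((i ord0 t : nat)%:Z - u ord0 t) < M)%N.
  have := nc t; rewrite negb_or -leqNgt -ltnNge => /andP[h1 h2].
  have /nrm_leP/(_ t) := uU; move: (nat_of_ord (i ord0 t)) h1 h2 => x h1 h2; lia.
pose j : I := \row_t Ordinal (hj t).
have e : boxpt i = u + boxpt j.
  apply: zdP => t; rewrite coordD !coord_row mxE /=.
  have := nc t; rewrite negb_or -leqNgt -ltnNge => /andP[h1 h2].
  have /nrm_leP/(_ t) := uU; move: (nat_of_ord (i ord0 t)) h1 h2 => x h1 h2; lia.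
rewrite -(hp j i e) -(hp' j i e); apply: IH; rewrite mxE /=.
have := nc l; rewrite negb_or -leqNgt -ltnNge => /andP[h1 h2].
have /nrm_leP/(_ l) := uU; move: (nat_of_ord (i ord0 l)) h1 h2 hi => x h1 h2; lia.
Qed.

Lemma collar_det u p p' : u != 0 -> (nrm u <= U)%N -> periodic u p -> periodic u p' ->
  (forall i, collar i -> p i = p' i) -> p = p'.
Proof.
move=> u0 uU hp hp' hc.
have [l ul] : exists l, u ord0 l != 0 :> int.
  apply: contrapT => /forallNP h; move/eqP: u0; apply; apply: zdP => l.
  by rewrite coord0; apply/eqP; have := h l; case: eqP.
have [upos|uneg] := ltrP 0 (u ord0 l); first exact: (collar_det_pos upos uU).
apply: (@collar_det_pos (- u) l) => //; rewrite ?nrmN //; try exact: periodicN.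
by rewrite coordN; move: ul uneg; move: (u ord0 l) => x; lia.
Qed.

Lemma card_collar : (#|collar| <= M ^ d - (M - 2 * U) ^ d)%N.
Proof.
rewrite -(leq_add2r #|predC collar|) cardC card_mx card_ord mul1n.
suff h : ((M - 2 * U) ^ d <= #|predC collar|)%N.
  have : ((M - 2 * U) ^ d <= M ^ d)%N.
    by case: (d) => // d'; rewrite leq_exp2r // leq_subr.
  lia.
have hj (i : 'rV['I_(M - 2 * U)]_d) t : (U + i ord0 t < M)%N.
  by case: (i ord0 t) => x /= hx; lia.
pose F (i : 'rV['I_(M - 2 * U)]_d) : I := \row_t Ordinal (hj i t).
have Fi : injective F.
  move=> i i' e; apply/rowP => t; apply/val_inj.
  by have := congr1 (fun x : I => nat_of_ord (x ord0 t)) e; rewrite !mxE /= => /addnI.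
have := card_codom Fi; rewrite card_mx card_ord mul1n => <-; apply: subset_leq_card.
apply/fintype.subsetP => _ /codomP[i ->]; rewrite inE; apply/existsPn => t.
by rewrite mxE /=; case: (i ord0 t) => x /= hx; lia.
Qed.

(** A pattern with a period of norm at most [U] is determined by the period, with [(2 * U).+1 ^ d]
    choices, and by its values on the collar. *)
Lemma aperiodic_ex (Q : pred {ffun I -> A}) : (0 < #|A|)%N ->
  ((2 * U).+1 ^ d * #|A| ^ (M ^ d - (M - 2 * U) ^ d) < #|Q|)%N ->
  exists2 p, Q p & forall u, u != 0 -> (nrm u <= U)%N ->
    exists i j : I, boxpt j = u + boxpt i /\ p i <> p j.
Proof.
move=> A0 hQ; apply: contrapT => /forall2NP nh.
have H p : Q p -> exists u, [/\ u != 0, (nrm u <= U)%N & periodic u p].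
  move=> Qp; apply: contrapT => /forallNP h; have [//|nn] := nh p; apply: nn => u u0 uU.
  apply: contrapT => /forallNP hij; apply: (h u); split=> // i j e.
  by apply: contrapT => ne; apply: (hij i); exists j.
pose v p : Zd d := if pselect (Q p) is left h then projT1 (cid (H p h)) else 0.
have vP p : Q p -> [/\ v p != 0, (nrm (v p) <= U)%N & periodic (v p) p].
  by move=> Qp; rewrite /v; case: pselect => // h; exact: (projT2 (cid (H p h))).
pose T : finType := ('I_(size (zball d U)) * {ffun {i : I | collar i} -> A})%type.
have [sz0|szn] := posnP (size (zball d U)).
  by move: sz0; rewrite size_zball => /eqP; rewrite expn_eq0.
have ix p : Q p -> (index (v p) (zball d U) < size (zball d U))%N.
  by move=> /vP[_ h _]; rewrite index_mem mem_zball.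
pose F p : T := (insubd (Ordinal szn) (index (v p) (zball d U)), [ffun i => p (val i)]).
have : (#|Q| <= #|T|)%N.
  apply: (@leq_card_in _ _ F) => p p' Qp Qp' [e1 /ffunP e2].
  have vv : v p = v p'.
    have := congr1 val e1; rewrite !val_insubd !ix // => e.
    have [_ h _] := vP p Qp; have [_ h' _] := vP p' Qp'.
    by rewrite -(nth_index 0 (_ : v p \in zball d U)) ?mem_zball // e nth_index ?mem_zball.
  have [v0 vU hp] := vP p Qp; have [_ _ hp'] := vP p' Qp'; rewrite -vv in hp'.
  apply: (collar_det v0 vU hp hp') => i ci.
  by have := e2 (exist _ i ci); rewrite !ffunE.
apply/negP; rewrite -ltnNge; apply: leq_ltn_trans hQ.
rewrite card_prod card_ord card_ffun size_zball leq_mul2l card_sig.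
by rewrite leq_pexp2l ?orbT // card_collar.
Qed.

End Aperiodic.

Section CodingExistence.
Variables (d : nat) (A B : finType) (S : scales d).
Notation cfg := (Zd d -> B).
Variables (X : set (Zd d -> A)) (P : set (Zd d) -> set (Zd d -> option A)) (Y : set cfg) (nc : nat).
Local Notation m := (mm S).
Local Notation N := (cN S).
Local Notation N' := (cN' S).
Local Notation M := (cM S).
Local Notation U := (2 * N + m)%N.

Definition has_pat n (p : {ffun 'rV['I_n]_d -> A}) :=
  exists c, P (@box1 d n) c /\ forall i, c (boxpt i) = Some (p i).

Definition in_lang n (q : {ffun 'rV['I_n]_d -> B}) :=
  exists2 y, Y y & forall i, y (boxpt i) = q i.

Lemma npatE n : npat P n = #|[pred p | `[<@has_pat n p>]]|.
Proof. by apply: eq_card => p; apply/asboolP/asboolP => /asboolP. Qed.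

Lemma nlangE n : nlang Y n = #|[pred q | `[<@in_lang n q>]]|.
Proof.
apply: eq_card => q; apply/asboolP/asboolP => [/asboolP[y [? ?]]|[y ? ?]]; first by exists y.
by apply/asboolP; exists y.
Qed.

Definition pat_of_fun n (p : {ffun 'rV['I_n]_d -> A}) : Zd d -> option A :=
  xget (fun=> None) [set c | P (@box1 d n) c /\ forall i, c (boxpt i) = Some (p i)].

Lemma pat_of_funP n (p : {ffun 'rV['I_n]_d -> A}) : has_pat p ->
  P (@box1 d n) (pat_of_fun p) /\ forall i, pat_of_fun p (boxpt i) = Some (p i).
Proof.
by move=> h; apply: (@xgetPex _ _ [set c | P (@box1 d n) c /\ forall i, c (boxpt i) = Some (p i)]).
Qed.

Hypotheses (hB : (#|B| <= 2 ^ cb S)%N) (hA : (0 < #|A|)%N).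
Hypotheses (fam : pattern_family X (kk S) P) (PF : property_F X (kk S) P m) (inv : shift_invariant Y).
Hypothesis I1 : ((2 * U).+1 ^ d * #|A| ^ (M ^ d - (M - 2 * U) ^ d) < npat P M)%N.
Hypothesis I2 : (nlang Y N * 2 + nc.+1 + M.+1 ^ d <= npat P N')%N.

(** [I1] leaves a pattern without small periods for the marker. [I2] counts the symbols, with a
    factor 2 for the spare bit and [nc.+1] headers, and at most [M.+1 ^ d] subwords of the marker to
    be discarded, each being determined by its offset. *)
Lemma coding_ex : exists cd : coding S X P Y nc, True.
Proof.
have UM : (2 * U <= M)%N by have := M_ge S; have := W_ge S; lia.
have [||p /asboolP hp ap] := @aperiodic_ex d A M U UM [pred p | `[<@has_pat M p>]] => //.
  by rewrite -npatE.
have [mP mE] := pat_of_funP hp; set mk := pat_of_fun p in mP mE.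
have mk_box a s : mk a = Some s -> @box1 d M a.
  have [|x _ <-] := fam.1 _ _ _ mP; first by apply: grid_union_box; [exact: d2|exact: kk0].
  by rewrite /restr; case: asboolP.
pose sub (w : {ffun 'rV['I_N']_d -> A}) := exists o : Zd d, forall i, mk (o + boxpt i) = Some (w i).
have N'0 : (0 < N')%N by rewrite muln_gt0 kk0 nn0.
have card_sub : (#|[pred w | `[<sub w>]]| <= M.+1 ^ d)%N.
  pose o w : Zd d := if pselect (sub w) is left h then projT1 (cid h) else 0.
  have oP w : sub w -> forall i, mk (o w + boxpt i) = Some (w i).
    by move=> h; rewrite /o; case: pselect => // h'; exact: (projT2 (cid h')).
  have ob w : sub w -> forall t, 0 <= o w ord0 t <= M%:Z.
    move=> /oP h t; have /mk_box/box1P/(_ t) := h (\row_ _ Ordinal N'0).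
    by rewrite coordD coordE mxE /=; move: (o w ord0 t) => x; lia.
  pose F w : 'rV['I_M.+1]_d := \row_t inord (absz (o w ord0 t)).
  have := card_mx 'I_M.+1 1 d; rewrite card_ord mul1n => <-.
  apply: (@leq_card_in _ _ F) => w w' /asboolP hw /asboolP hw' e.
  have oo : o w = o w'.
    apply: zdP => t; have := congr1 (fun x : 'rV['I_M.+1]_d => nat_of_ord (x ord0 t)) e.
    have := ob w hw t; have := ob w' hw' t; rewrite !mxE.
    move: (o w ord0 t) (o w' ord0 t) => x x' h h'.
    have hx : (absz x < M.+1)%N by lia.
    have hx' : (absz x' < M.+1)%N by lia.
    rewrite (inordK hx) (inordK hx'); lia.
  apply/ffunP => i; have := oP w hw i; rewrite oo (oP w' hw').
  by case.
pose D2 : pred {ffun 'rV['I_N']_d -> A} := [pred w | `[<has_pat w>] && ~~ `[<sub w>]].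
pose vd (s : sym B S nc) := if s is inl (q, _) then in_lang q else True.
have cD2 : (nlang Y N * 2 + nc.+1 <= #|D2|)%N.
  have : (npat P N' <= M.+1 ^ d + #|D2|)%N.
    rewrite npatE -(cardID [pred w | `[<sub w>]]); apply: leq_add; last first.
      by apply: eq_leq; apply: eq_card => w; rewrite !inE andbC.
    by apply: leq_trans card_sub; apply: subset_leq_card; apply/fintype.subsetP => w; rewrite !inE => /andP[_ /asboolP].
  lia.
have cD1 : (#|[pred s | `[<vd s>]]| <= nlang Y N * 2 + nc.+1)%N.
  pose T : finType := ({q : {ffun 'rV['I_N]_d -> B} | `[<in_lang q>]} * bool + option 'I_nc)%type.
  pose g (t : T) : sym B S nc := match t with inl x => inl (val x.1, x.2) | inr x => inr x end.
  have := leq_image_card g predT; rewrite card_sum card_prod card_sig card_bool card_option card_ord -nlangE.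
  apply: leq_trans; apply: subset_leq_card; apply/fintype.subsetP => s /asboolP.
  case: s => [[q b]|x] /= h; apply/codomP; last by exists (inr x).
  by exists (inl (exist _ q (introT (asboolP _) h), b)).
have [|io [ioD io_inj]] := in_injection (leq_trans cD1 cD2).
  by apply: leq_trans cD2; rewrite addnS.
have ioP s : vd s -> has_pat (io s) /\ ~ sub (io s).
  by move=> h; have /andP[/asboolP h1 /asboolP h2] := ioD s (introT (asboolP _) h).
unshelve eexists (@Coding d A B S X P Y nc mk (fun s => pat_of_fun (io s)) _ _ _ _ _ _ _ _ _) => //.
- move=> u u0 uU; have [i [j [e ne]]] := ap u u0 uU; exists (boxpt i).
  by rewrite -e !mE; split; [exact: box1_boxpt|exact: box1_boxpt|case].
- by move=> s /ioP[h _]; exact: (pat_of_funP h).1.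
- move=> s s' hs hs' e; apply: io_inj; [exact/asboolP|exact/asboolP|].
  apply/ffunP => i; have := e (boxpt i) (box1_boxpt i).
  by rewrite (pat_of_funP (ioP s hs).1).2 (pat_of_funP (ioP s' hs').1).2 => -[].
- move=> s o hs h; apply: (ioP s hs).2; exists o => i.
  by rewrite (h _ (box1_boxpt i)) (pat_of_funP (ioP s hs).1).2.
Qed.

End CodingExistence.

(** * The entropy gap *)

Section EntropyGap.
Variable R : realType.
Local Open Scope ereal_scope.

Lemma limn_esup_lt (u : nat -> \bar R) x : limn_esup u < x ->
  exists n0, forall n, (n0 <= n)%N -> u n < x.
Proof.
move=> /ereal_inf_lt [_ [V [n0 _ VV] <-] h].
exists n0 => n nn0; apply: le_lt_trans h; apply: ereal_sup_ubound; exists n => //; exact: VV.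
Qed.

Lemma limn_einf_gt (u : nat -> \bar R) x : x < limn_einf u ->
  exists n0, forall n, (n0 <= n)%N -> x < u n.
Proof.
rewrite /limn_einf lteNr => /limn_esup_lt[n0 h]; exists n0 => n /h.
by rewrite lteNr oppeK.
Qed.

Lemma lt_ereal_real (a b : \bar R) : a < b -> exists r : R, a < r%:E /\ r%:E < b.
Proof.
case: a b => [a| |] [b| |] // h.
- by exists ((a + b) / 2)%R; rewrite !lte_fin in h *; split; lra.
- by exists (a + 1)%R; rewrite lte_fin ltry; split=> //; lra.
- by exists (b - 1)%R; rewrite lte_fin ltNyr; split=> //; lra.
- by exists 0%R; rewrite ltNyr ltry.
Qed.

End EntropyGap.

(** * Growth estimates *)

Section Growth.
Variable R : realType.
Implicit Types (al be : R).
Local Open Scope ring_scope.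

(** Write [V = (k * n) ^ d]. Half of the gap [be - al] absorbs the enlargement of the cube by
    [2 * m], of lower order than [V]. The other half beats the remaining terms, which are at most
    quadratic in [V], through the cubic term of the exponential series. *)
Lemma words_growth (d k m c : nat) al be : (0 < d)%N -> (0 < k)%N -> 0 < al -> al < be ->
  exists T, forall n, (T <= n)%N ->
    2 * expR (al * ((k * n + 2 * m) ^ d)%N%:R) + c%:R + ((k * (n * n)).+1 ^ d)%N%:R
      <= expR (be * ((k * n) ^ d)%N%:R).
Proof.
move=> d0 k0 al0 ab.
pose de := (be - al) / 2; have de0 : 0 < de by rewrite /de; lra.
pose c1 := al * (d * (2 * m) * (1 + 2 * m) ^ d.-1)%N%:R.
pose c2 := (2 + c + 2 ^ d)%N%:R * 6 / de ^+ 3.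
have c10 : 0 <= c1 by rewrite mulr_ge0 // ltW.
have c20 : 0 <= c2 by rewrite divr_ge0 // ?exprn_ge0 // ltW.
exists (Num.truncn (c1 / de + c2 + 1)).+1 => n nT.
have n0 : (0 < n)%N by apply: leq_trans nT.
have nT' : c1 / de + c2 + 1 < n%:R.
  by apply: lt_le_trans (truncnS_gt _) _; rewrite ler_nat.
have c1d0 : 0 <= c1 / de by rewrite divr_ge0 // ltW.
set x := (k * n)%N; have x0 : (0 < x)%N by rewrite muln_gt0 k0.
have nx : (n <= x)%N by rewrite leq_pmull.
have nxR : n%:R <= x%:R :> R by rewrite ler_nat.
set V : R := (x ^ d)%N%:R.
have xV : x%:R <= V.
  by rewrite ler_nat -{1}(expn1 x) leq_pexp2l.
have V1 : 1 <= V by apply: le_trans xV; rewrite ler1n.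
have hN : al * ((x + 2 * m) ^ d)%N%:R <= (al + de) * V.
  have h : ((x + 2 * m) ^ d <= x ^ d + d * (2 * m) * ((1 + 2 * m) ^ d.-1 * x ^ d.-1))%N.
    rewrite -leq_subLR; apply: leq_trans (exp_add_sub _ _ _) _; rewrite leq_mul2l -expnMn; apply/orP; right.
    have hx : (x + 2 * m <= (1 + 2 * m) * x)%N by rewrite mulnDl mul1n leq_add2l leq_pmulr.
    by case: (d.-1) => // d'; rewrite leq_exp2r.
  apply: le_trans (_ : al * (x ^ d + d * (2 * m) * ((1 + 2 * m) ^ d.-1 * x ^ d.-1))%N%:R <= _).
    by rewrite ler_pM2l // ler_nat.
  rewrite mulnA natrD natrM mulrDr mulrDl lerD2l mulrA -/c1.
  have -> : V = x%:R * (x ^ d.-1)%N%:R by rewrite -natrM -expnS prednK.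
  rewrite mulrA ler_wpM2r // mulrC -ler_pdivrMr //; lra.
have hM : ((k * (n * n)).+1 ^ d)%N%:R <= (2 ^ d)%N%:R * V ^+ 2.
  rewrite /V -natrX -natrM ler_nat.
  have -> : (2 ^ d * (x ^ d) ^ 2 = (2 * x ^ 2) ^ d)%N by rewrite expnMn -!expnM [(d * 2)%N]mulnC.
  rewrite leq_exp2r // /x expnMn -!mulnn.
  have : (k * (n * n) <= k * k * (n * n))%N by rewrite leq_mul2r leq_pmulr ?orbT.
  have : (0 < k * k * (n * n))%N by rewrite !muln_gt0 k0 n0.
  move: (k * (n * n))%N (k * k * (n * n))%N => p q; lia.
have hde : 2 + c%:R + (2 ^ d)%N%:R * V ^+ 2 <= expR (de * V).
  apply: le_trans (expR_ge1Dxn 2 _); last by rewrite mulr_ge0 ?ltW //; lra.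
  have h2 : c2 <= V by apply: le_trans xV; lra.
  have h3 : (2 + c + 2 ^ d)%N%:R <= de ^+ 3 * V / 6.
    move: h2; rewrite /c2 ler_pdivrMr ?exprn_gt0 //; lra.
  have h4 : (2 + c + 2 ^ d)%N%:R * V ^+ 2 <= (de * V) ^+ 3 / 3`!%:R.
    have -> : (de * V) ^+ 3 / 3`!%:R = de ^+ 3 * V / 6 * V ^+ 2 by rewrite (_ : 3`! = 6)%N //; field.
    by rewrite ler_wpM2r // exprn_ge0 // (le_trans _ V1).
  move: h4; rewrite !natrD.
  have V2 : 1 <= V ^+ 2 by rewrite expr_ge1 // (le_trans _ V1).
  have : 0 <= c%:R :> R by [].
  move: (V ^+ 2) V2 => W W1 cc; set D := (2 ^ d)%N%:R; nra.
set E := expR _; set G := expR _.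
have E1 : 1 <= expR ((al + de) * V).
  by apply: le_trans (expR_ge1Dx _); rewrite lerDl mulr_ge0 //; lra.
have EE : E <= expR ((al + de) * V) by rewrite ler_expR.
have GE : G = expR ((al + de) * V) * expR (de * V).
  by rewrite -exp.expRD /G /de; congr expR; rewrite /V; field.
have VV : 0 <= V ^+ 2 by rewrite exprn_ge0 // (le_trans _ V1).
have D0 : 0 <= (2 ^ d)%N%:R :> R by [].
have C0 : 0 <= c%:R :> R by [].
rewrite GE; apply: le_trans (_ : expR ((al + de) * V) * (2 + c%:R + (2 ^ d)%N%:R * V ^+ 2) <= _).
  have h := mulr_ge0 D0 VV; move: hM EE E1 h C0.
  move: ((2 ^ d)%N%:R * V ^+ 2) (expR ((al + de) * V)) E (c%:R : R) => p q E0 c0 hM EE E1 h C0; nra.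
by rewrite ler_wpM2l // expR_ge0.
Qed.

(** The logarithm of the left side is at most a constant times [n * M ^ d.-1], while [M ^ d] is at
    least [n * n * M ^ d.-1]; this is why the marker has side quadratic in [n]. *)
Lemma marker_growth (d k m a : nat) be : (0 < d)%N -> (0 < k)%N -> 0 < be ->
  exists T, forall n, (T <= n)%N ->
    let U := (2 * (k * n + 2 * m) + m)%N in let M := (k * (n * n))%N in (2 * U <= M)%N ->
    ((2 * U).+1 ^ d * a ^ (M ^ d - (M - 2 * U) ^ d))%N%:R < expR (be * (M ^ d)%N%:R).
Proof.
move=> d0 k0 be0.
pose C2 := (d * (2 * (2 * k + 5 * m)))%N.
exists (Num.truncn ((1 + a)%N%:R * C2%:R / be + 1)).+1 => n nT U M UM.
have n0 : (0 < n)%N by apply: leq_trans nT.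
have nT' : (1 + a)%N%:R * C2%:R / be + 1 < n%:R :> R.
  by apply: lt_le_trans (truncnS_gt _) _; rewrite ler_nat.
have M0 : (0 < M)%N by rewrite !muln_gt0 k0 n0.
set c := (M ^ d - (M - 2 * U) ^ d)%N.
have UC : (d * (2 * U) <= C2 * n)%N.
  rewrite /C2 /U -!mulnA leq_mul2l; apply/orP; right; nia.
have cC : (c <= C2 * n * M ^ d.-1)%N.
  have := exp_add_sub (M - 2 * U) (2 * U) d; rewrite subnK // => h.
  apply: leq_trans h _; by rewrite leq_mul2r UC orbT.
have UC' : (d * (2 * U) <= C2 * n * M ^ d.-1)%N.
  by apply: leq_trans UC _; rewrite leq_pmulr // expn_gt0 M0.
have e1 (s : nat) : s.+1%:R <= expR s%:R :> R.
  by rewrite -natr1 addrC; exact: expR_ge1Dx.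
have h1 : ((2 * U).+1 ^ d)%N%:R <= expR (d * (2 * U))%N%:R :> R.
  by rewrite natrX natrM expRM_natl lerXn2r // ?nnegrE // expR_ge0.
have h2 : (a ^ c)%N%:R <= expR (a * c)%N%:R :> R.
  rewrite natrX natrM expRM_natr lerXn2r // ?nnegrE ?expR_ge0 //.
  by apply: le_trans (e1 a); rewrite ler_nat.
rewrite natrM; apply: le_lt_trans (_ : expR (d * (2 * U))%N%:R * expR (a * c)%N%:R < _).
  by rewrite ler_pM.
rewrite -exp.expRD ltr_expR -natrD.
apply: le_lt_trans (_ : ((1 + a) * C2 * n * M ^ d.-1)%N%:R < _).
  rewrite ler_nat; move: UC' cC; rewrite -!mulnA => hU hc.
  by rewrite mulnDl mul1n; apply: leq_add => //; rewrite leq_mul2l hc orbT.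
have -> : (M ^ d)%N%:R = (k * (n * n))%N%:R * (M ^ d.-1)%N%:R :> R.
  by rewrite -natrM -/M -expnS prednK.
rewrite natrM mulrA ltr_pM2r; last by rewrite ltr0n expn_gt0 M0.
have n1 : 0 < n%:R :> R by rewrite ltr0n.
have k1 : 1 <= k%:R :> R by rewrite ler1n.
have -> : (k * (n * n))%N%:R = k%:R * n%:R * n%:R :> R by rewrite mulnA !natrM.
have -> : ((1 + a) * C2 * n)%N%:R = (1 + a)%N%:R * C2%:R * n%:R :> R by rewrite natrM [in LHS]natrM.
rewrite !mulrA ltr_pM2r //.
have h : (1 + a)%N%:R * C2%:R < be * n%:R.
  have : (1 + a)%N%:R * C2%:R / be < n%:R by lra.
  by rewrite ltr_pdivrMr // [n%:R * _]mulrC.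
apply: lt_le_trans h _.
rewrite -mulrA ler_pM2l // -{1}(mul1r n%:R) ler_pM2r //.
Qed.

End Growth.

(** * The Borel embedding *)

Section BorelFree.
Variables (d : nat) (B : finType).
Notation cfg := (Zd d -> B).

Lemma bfun_aperiodic : bfun (@aperiodic d B).
Proof.
apply: bfun_all => g; apply: bfun_imp; apply: bfun_not.
have := bfun_all (fun a : Zd d => bfun_comp2 (@eq B) (bfun_eval (g + a)) (bfun_eval a)).
congr bfun; apply/funext => y; apply/propext; split=> [h|h a]; first by apply/funext.
by rewrite -[RHS]/(y a) -[in RHS]h.
Qed.

(** A closed set is the intersection over all boxes of the union of the cylinders of its patterns on
    a box, and finite patterns are countable in number. *)
Lemma bfun_closed (Y : set cfg) : closed_config Y -> bfun Y.
Proof.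
move=> cY.
pose C (n : nat) (w : seq (Zd d * B)) := (exists2 z, Y z & matches w z) /\
  forall a : Zd d, (nrm a <= n)%N -> exists b, (a, b) \in w.
have := bfun_all (fun n => bfun_ex (fun w => bfun_and (bfun_cst (C n w)) (bfun_matches w))).
congr bfun; apply/funext => y; apply/propext; split=> [h|Yy n].
  apply: cY => n; have [w [[[z Yz mz] cw] my]] := h n; exists z => // a /cboxE /cw[b hb].
  by rewrite (mz _ hb) (my _ hb).
exists [seq (a, y a) | a <- zball d n].
have my : matches [seq (a, y a) | a <- zball d n] y by move=> _ /mapP[a _ ->].
split=> //; split; first by exists y.
by move=> a an; exists (y a); apply/mapP; exists a; rewrite ?mem_zball.
Qed.

End BorelFree.

Section Embedding.
Variables (d : nat) (A B : finType) (S : scales d) (h : nat -> nat).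
Hypothesis hS : forall n, rho S n = (2 * h n)%N /\ (sc S n + n <= h n)%N.
Notation cfg := (Zd d -> B).
Variables (X : set (Zd d -> A)) (P : set (Zd d) -> set (Zd d -> option A)) (Y : set cfg).
Variables (cd : coding S X P Y (ncol d)) (a0 : A).
Hypothesis cY : closed_config Y.
Local Notation rs i := (rseq B hS (nat_of_ord i)).

(** Exhaustion is shift-invariant, so this choice is constant on orbits. The default is used only
    where no colour exhausts, hence never at an aperiodic point. *)
Definition colour (y : cfg) : 'I_(ncol d) := odflt ord0 [pick i : 'I_(ncol d) | `[<exhausted (rs i) y>]].

Definition emb (y : cfg) : Zd d -> A := fmap (rs (colour y)) cd (colour y) a0 y.

Lemma colourP y : aperiodic y -> exhausted (rs (colour y)) y.
Proof.
move=> ay; rewrite /colour; case: pickP => [i /asboolP//|none].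
by have [i hi] := exhausted_ex hS ay; have := none i; rewrite asboolT.
Qed.

Lemma colour_shift g y : colour (shift g y) = colour y.
Proof.
rewrite /colour; congr odflt; apply: eq_pick => i; apply: asbool_equiv_eq; split=> [hx|].
  by have := exhausted_shift (- g) hx; rewrite shift_shift subrr shift0.
exact: exhausted_shift.
Qed.

Lemma bfun_colour : bfun colour.
Proof.
have := bfun_comp (fun Q : 'I_(ncol d) -> Prop => odflt ord0 [pick i : 'I_(ncol d) | `[<Q i>]])
  (bfun_fin (enum 'I_(ncol d)) (fun=> False) (fun i => bfun_exhausted (rs i))).
congr bfun; apply/funext => y; congr odflt; apply: eq_pick => i.
by rewrite mem_enum.
Qed.

Lemma bfun_emb a : bfun (fun y => emb y a).
Proof.
have := bfun_comp2 (fun (f : 'I_(ncol d) -> A) i => f i)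
  (bfun_fin (enum 'I_(ncol d)) (fun=> a0) (fun i => bfun_fmap (rs i) cd i a0 a)) bfun_colour.
by congr bfun; apply/funext => y; rewrite mem_enum.
Qed.

Lemma emb_embedding : equivariant_borel_embedding (Free Y) X emb.
Proof.
split.
- by move=> y [Yy ay]; apply: fmap_X => //; exact: colourP.
- move=> y y' /set_mem [Yy ay] /set_mem [Yy' ay'].
  by apply: fmap_inj => //; exact: colourP.
- by move=> g y _; rewrite /emb colour_shift fmap_shift.
move=> _ [a [s ->]].
have := bfun_bpred (bfun_and (bfun_and (bfun_closed cY) (@bfun_aperiodic d B)) (bfun_eq s (bfun_emb a))).
exact.
Qed.

End Embedding.

Section Counting.
Variables (d : nat) (A B : finType).

(** Positivity of [al] holds even for an empty language, because [ln 0 = 0] here, so that no term of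
    the sequence is negative. *)
Lemma htop_lt (Y : set (Zd d -> B)) (al : Rdefinitions.R) : (htop Y < al%:E)%E ->
  exists n0, forall n, (n0 <= n)%N -> (0 < n)%N -> 0 < al /\
    (nlang Y n)%:R <= expR (al * (n ^ d)%N%:R).
Proof.
move=> /limn_esup_lt[n0 h]; exists n0 => n /h; rewrite lte_fin => hn n1.
have d0 : 0 < (n ^ d)%N%:R :> Rdefinitions.R by rewrite ltr0n expn_gt0 n1.
rewrite ltr_pdivrMr // in hn.
have [z|nz] := posnP (nlang Y n).
  rewrite z ln0 // in hn; rewrite z expR_ge0; split=> //.
  by rewrite -(pmulr_lgt0 _ d0).
have lpos : 0 < (nlang Y n)%:R :> Rdefinitions.R by rewrite ltr0n.
split; last by rewrite -[leLHS]lnK ?posrE // ler_expR ltW.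
rewrite -(pmulr_lgt0 _ d0); apply: le_lt_trans hn; apply: ln_ge0; by rewrite ler1n.
Qed.

Lemma family_entropy_gt (k : nat) (P : set (Zd d) -> set (Zd d -> option A)) (be : Rdefinitions.R) :
  (0 < k)%N -> 0 < be -> (be%:E < family_entropy k P)%E ->
  exists n0, forall n, (n0 <= n)%N -> (0 < n)%N ->
    expR (be * ((k * n) ^ d)%N%:R) <= (npat P (k * n))%:R.
Proof.
move=> k0 be0 /limn_einf_gt[n0 h]; exists n0 => n /h; rewrite lte_fin mulnC => hn n1.
have d0 : 0 < ((k * n) ^ d)%N%:R :> Rdefinitions.R by rewrite ltr0n expn_gt0 muln_gt0 k0 n1.
rewrite ltr_pdivlMr // in hn.
have hpos : 0 < be * ((k * n) ^ d)%N%:R by exact: mulr_gt0.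
have [z|nz] := posnP (npat P (k * n)); first by move: hn; rewrite z ln0 // ltNge ltW.
have lpos : 0 < (npat P (k * n))%:R :> Rdefinitions.R by rewrite ltr0n.
by rewrite -[leRHS]lnK ?posrE // ler_expR ltW.
Qed.

End Counting.

Local Open Scope ereal_scope.

Theorem theorem9p1 (d : nat) (A B : finType)
  (X : set (Zd d -> A)) (k : nat) (P : set (Zd d) -> set (Zd d -> option A))
  (m : nat) (Y : set (Zd d -> B)) :
  (2 <= d)%N ->
  symbolic_system X ->
  (0 < k)%N ->
  pattern_family X k P ->
  property_F X k P m ->
  shift_space Y ->
  htop Y < family_entropy k P ->
  exists f : (Zd d -> B) -> (Zd d -> A),
    equivariant_borel_embedding (Free Y) X f.
Proof.
move=> d2 _ k0 fam PF [iY cY] gap.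
have d0 : (0 < d)%N by exact: ltnW.
have [al [hal gap']] := lt_ereal_real gap; have [be [alb hbe]] := lt_ereal_real gap'.
rewrite lte_fin in alb.
have [n0 nl] := htop_lt hal.
have al0 : (0 < al)%R by have [] := nl n0.+1 (leqnSn _) isT.
have be0 : (0 < be)%R by exact: lt_trans alb.
have [n1 np] := family_entropy_gt k0 be0 hbe.
have [T1 gw] := words_growth m (ncol d).+1 d0 k0 al0 alb.
have [T2 gm] := marker_growth m #|A| d0 k0 be0.
(* The summand [24 * m + 16] gives [4 * (2 * n + 6 * m + 2) <= n * n], the relation between marker
   side and tile grid required by [M_ge]. *)
pose n := (n0 + n1 + T1 + T2 + 24 * m + 16)%N.
have nT : [/\ (n0 <= n)%N, (n1 <= n)%N, (T1 <= n)%N & (T2 <= n)%N] by rewrite /n; split; lia.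
have [n0n n1n T1n T2n] := nT.
have nbig : (24 * m + 16 <= n)%N by rewrite /n; lia.
clearbody n; have npos : (0 < n)%N by lia.
have nn_n : (n <= n * n)%N by rewrite leq_pmull.
have hW : (2 * (k * n + 2 * m + m) + 2 <= k * (2 * n + 6 * m + 2))%N by nia.
have hM : (4 * (k * (2 * n + 6 * m + 2)) <= k * (n * n))%N.
  by rewrite mulnCA leq_mul2l; apply/orP; right; nia.
(* [#|B|] bits per site are allotted, a crude choice that suffices because [#|B| < 2 ^ #|B|]. *)
have [S [[ek em en _] el eb hS]] := scales_ex #|B| d2 k0 npos hW hM.
have fam' : pattern_family X (kk S) P by rewrite ek.
have PF' : property_F X (kk S) P (mm S) by rewrite ek em.
have eN : cN S = (k * n + 2 * m)%N by rewrite /cN /cN' ek en em.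
have eN' : cN' S = (k * n)%N by rewrite /cN' ek en.
have eM : cM S = (k * (n * n))%N by rewrite /cM ek el.
(* Gluing an empty list of pieces in a box gives a pattern of the family, hence a point of [X] and a
   default symbol. *)
have [x Xx] : exists x, X x.
  have gB : grid_union k (@box1 d (k * 1)) by exact: grid_union_box.
  have [//|//|c Pc _] := @glue_seq d A X k m P PF nat [::] (fun=> set0) (fun=> fun=> None) _ gB isT.
  by have [x Xx _] := fam.1 _ gB _ Pc; exists x.
have hA : (0 < #|A|)%N by apply/card_gt0P; exists (x 0%R).
have hB : (#|B| <= 2 ^ cb S)%N by rewrite eb ltnW // ltn_expl.
have [||cd _] := @coding_ex d A B S X P Y (ncol d) hB hA fam' PF' iY.
- rewrite eN eM em -(ltr_nat Rdefinitions.R).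
  have := np (n * n)%N (leq_trans n1n nn_n) (leq_trans npos nn_n).
  apply: lt_le_trans; apply: gm => //; lia.
- rewrite eN eN' eM -(ler_nat Rdefinitions.R).
  apply: le_trans (np n n1n npos); apply: le_trans (gw n T1n).
  have [||_ h] := nl (k * n + 2 * m)%N.
  + by apply: leq_trans n0n _; rewrite (leq_trans (leq_pmull n k0)) // leq_addr.
  + by rewrite ltn_addr // muln_gt0 k0.
  by rewrite !natrD natrM mulrC !lerD2r ler_pM2l.
exists (emb hS cd (x 0%R)); exact: emb_embedding.
Qed.
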